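(* Let $p,q>1$, $c\ge 0$ and $V(x)=c\|x\|_q^p$ on $\mathbb{R}^n$. Then the inequality $$\int_{\mathbb{R}^n} e^{-\Phi(x)}\,dx\,\Bigl(\int_{\mathbb{R}^n} e^{-\frac{1}{p-1}\Phi^*(\nabla V(x))}\,dx\Bigr)^{p-1}\le\Bigl(\int_{\mathbb{R}^n} e^{-V(x)}\,dx\Bigr)^p$$ holds in the following cases: 1. $p\ge q>1$ and $\Phi:\mathbb{R}^n\to(-\infty,+\infty]$ is any unconditional proper convex function; 2. $p\ge q\ge 2$ and $\Phi:\mathbb{R}^n\to(-\infty,+\infty]$ is any even proper convex function.
   Context: $\|x\|_q=(\sum_{i=1}^n|x_i|^q)^{1/q}$. $\Phi^*(y)=\sup_{x\in\mathbb{R}^n}(\langle x,y\rangle-\Phi(x))$ is the Legendre transform. A function is unconditional if $f(\pm x_1,\dots,\pm x_n)=f(x_1,\dots,x_n)$ for all choices of signs. A convex function is proper if it is not identically $+\infty$. Conventions: $e^{-\infty}=0$, $0\cdot\infty=0$. *)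

(* Defs.v *)
From HB Require Import structures.
From mathcomp Require Import all_boot all_order all_algebra.
From mathcomp Require Import all_classical all_reals all_analysis.

Set Implicit Arguments.
Unset Strict Implicit.
Unset Printing Implicit Defensive.

Import Order.TTheory GRing.Theory Num.Theory.
Import numFieldNormedType.Exports.

Local Open Scope classical_set_scope.
Local Open Scope ring_scope.

(* 'rV[R]_n gets the sigma-algebra generated by the coordinates, i.e. the Borel
   one. *)
Definition measure_rV_display : measure_display -> measure_display.
Proof. exact. Qed.

Section measurable_rV.
Context {R : realType} (n : nat).

Definition rV_coord (i : 'I_n) (x : 'rV[R]_n) : measurableTypeR R := x ord0 i.

Let rV_measurable0 : g_sigma_preimage rV_coord set0.
Proof. exact: sigma_algebra0. Qed.

Let rV_measurableC A :
  g_sigma_preimage rV_coord A -> g_sigma_preimage rV_coord (~` A).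
Proof. exact: sigma_algebraC. Qed.

Let rV_measurable_bigcup (F : _^nat) :
  (forall i, g_sigma_preimage rV_coord (F i)) ->
  g_sigma_preimage rV_coord (\bigcup_i (F i)).
Proof. exact: sigma_algebra_bigcup. Qed.

HB.instance Definition _ :=
  @isMeasurable.Build (measure_rV_display default_measure_display) 'rV[R]_n
    (g_sigma_preimage rV_coord)
    rV_measurable0 rV_measurableC rV_measurable_bigcup.

End measurable_rV.

Lemma measurable_rV_coord (R : realType) n (i : 'I_n) :
  measurable_fun [set: 'rV[R]_n] (rV_coord i).
Proof.
move=> _ Y mY; rewrite setTI; apply: sub_sigma_algebra => /=.
rewrite -bigcup_seq/=; exists i => /=; first by rewrite mem_index_enum.
by exists Y => //; rewrite setTI.
Qed.

Lemma measurable_fun_rV d (T : measurableType d) (R : realType) n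
    (f : T -> 'rV[R]_n) :
  (forall i, measurable_fun [set: T] (rV_coord i \o f)) ->
  measurable_fun [set: T] f.
Proof.
move=> mf _ A.
suff : @measurable _ 'rV[R]_n `<=` [set B | measurable (f @^-1` B)].
  by move=> + /= mA => /(_ _ mA); rewrite setTI.
apply: smallest_sub; first split => /=.
- by rewrite preimage_set0; exact: measurable0.
- by move=> B mB; rewrite setTD preimage_setC; exact: measurableC.
- by move=> F mF; rewrite preimage_bigcup; exact: bigcupT_measurable.
- rewrite -bigcup_seq; apply: bigcup_sub => i _ B [C mC <-] /=.
  by rewrite setTI; have := mf i measurableT C mC; rewrite setTI.
Qed.

Definition rV_cons {R : realType} n (z : measurableTypeR R * 'rV[R]_n) :
  'rV[R]_n.+1 :=
  \row_i (if unlift ord0 i is Some j then z.2 ord0 j else z.1).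

Lemma rV_cons0 (R : realType) n (z : measurableTypeR R * 'rV[R]_n) :
  rV_cons z ord0 ord0 = z.1.
Proof. by rewrite mxE unlift_none. Qed.

Lemma rV_consS (R : realType) n (z : measurableTypeR R * 'rV[R]_n) i :
  rV_cons z ord0 (lift ord0 i) = z.2 ord0 i.
Proof. by rewrite mxE liftK. Qed.

Lemma measurable_rV_cons (R : realType) n :
  measurable_fun [set: measurableTypeR R * 'rV[R]_n] (@rV_cons R n).
Proof.
apply: measurable_fun_rV => i.
case: (unliftP ord0 i) => [j ->|->].
  rewrite (_ : _ \o _ = rV_coord j \o snd).
    exact: (measurableT_comp (measurable_rV_coord _)).
  by apply/funext => z; rewrite /= /rV_coord rV_consS.
rewrite (_ : _ \o _ = fst); first exact: measurable_fst.
by apply/funext => z; rewrite /= /rV_coord rV_cons0.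
Qed.

(* Lebesgue measure on R^n as an iterated product; see lebesgue_rV_box.
   Integrals against it are defined on arbitrary nonnegative integrands as
   suprema over Borel simple functions lying below, which agrees with the
   Lebesgue integral on every Lebesgue-measurable integrand (in particular on
   exp (- Phi) for Phi convex, which need not be Borel on the boundary of its
   domain). *)
Fixpoint lebesgue_rV {R : realType} n : set 'rV[R]_n -> \bar R :=
  match n with
  | 0 => dirac (0 : 'rV[R]_0)
  | m.+1 => pushforward
      (@lebesgue_measure R \x @lebesgue_rV R m)%E (@rV_cons R m)
  end.

Section lebesgue_rV_measure.
Context {R : realType}.
Local Open Scope ereal_scope.

Let rV_uncons n (x : 'rV[R]_n.+1) : measurableTypeR R * 'rV[R]_n :=
  (x ord0 ord0, \row_j x ord0 (lift ord0 j)).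

Let rV_unconsK n : cancel (@rV_uncons n) (@rV_cons R n).
Proof.
move=> x; apply/rowP => i.
by case: (unliftP ord0 i) => [j ->|->]; rewrite (rV_consS, rV_cons0) ?mxE.
Qed.

Let rV_consK n : cancel (@rV_cons R n) (@rV_uncons n).
Proof.
move=> [a x]; rewrite /rV_uncons rV_cons0; congr pair.
by apply/rowP => i; rewrite mxE rV_consS.
Qed.

Let measurable_rV_uncons n : measurable_fun setT (@rV_uncons n).
Proof.
apply: measurable_fun_pair; first exact: measurable_rV_coord.
apply: measurable_fun_rV => i.
rewrite (_ : _ \o _ = rV_coord (lift ord0 i)); first exact: measurable_rV_coord.
by apply/funext => z; rewrite /= /rV_coord mxE.
Qed.

Let pushforward_rV_cons n
    (mu : {sigma_finite_measure set 'rV[R]_n -> \bar R}) :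
  {nu : {sigma_finite_measure set 'rV[R]_n.+1 -> \bar R} |
    nu = pushforward (@lebesgue_measure R \x mu) (@rV_cons R n) :> (_ -> _)}.
Proof.
pose lmu : {measure set (measurableTypeR R * 'rV[R]_n)%type -> \bar R} :=
  @lebesgue_measure R \x mu.
pose nu : {measure set 'rV[R]_n.+1 -> \bar R} :=
  measure_function_pushforward__canonical__measure_function_Measure
    lmu (@measurable_rV_cons R n).
have sf : sigma_finite setT nu.
  have [F UF mF] : sigma_finite setT lmu.
    exact: isSigmaFinite.sigma_finiteT
      (lebesgue_integral_fubini.measure_function_Measure_isSigmaFinite__to__measure_function_isSigmaFinite
        (@lebesgue_measure R) mu).
  exists (fun k => @rV_uncons n @^-1` F k).
    by rewrite -preimage_bigcup -UF preimage_setT.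
  move=> k; have [mFk Fk] := mF k; split.
    by rewrite -[X in measurable X]setTI; exact: measurable_rV_uncons.
  rewrite [X in X < _](_ : _ = lmu (F k))//= /pushforward -comp_preimage.
  rewrite (_ : _ \o _ = id) ?preimage_id//.
  by apply/funext => x /=; rewrite rV_consK.
pose snu := @Measure_isSigmaFinite.Build _ _ _ nu sf.
by exists (HB.pack_for {sigma_finite_measure set 'rV[R]_n.+1 -> \bar R}
  (nu : set _ -> \bar R) (Measure.class nu) snu).
Qed.

Let lebesgue_rV_sigma_finite_measure n :
  {mu : {sigma_finite_measure set 'rV[R]_n -> \bar R} |
    mu = @lebesgue_rV R n :> (_ -> _)}.
Proof.
elim: n => [|n [mu muE]].
  by exists (dirac (0%R : 'rV[R]_0)).
have [nu nuE] := pushforward_rV_cons mu.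
by exists nu; rewrite nuE muE.
Qed.

Section instances.
Variable n : nat.

Let lebesgue_rV0 : @lebesgue_rV R n set0 = 0.
Proof. by have [mu <-] := lebesgue_rV_sigma_finite_measure n; exact: measure0. Qed.

Let lebesgue_rV_ge0 A : 0 <= @lebesgue_rV R n A.
Proof.
by have [mu <-] := lebesgue_rV_sigma_finite_measure n; exact: measure_ge0.
Qed.

Let lebesgue_rV_sigma_additive : semi_sigma_additive (@lebesgue_rV R n).
Proof.
have [mu <-] := lebesgue_rV_sigma_finite_measure n.
exact: measure_semi_sigma_additive.
Qed.

HB.instance Definition _ := isMeasure.Build _ _ _ (@lebesgue_rV R n)
  lebesgue_rV0 lebesgue_rV_ge0 lebesgue_rV_sigma_additive.

Let lebesgue_rV_sigma_finite : sigma_finite setT (@lebesgue_rV R n).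
Proof. by have [mu <-] := lebesgue_rV_sigma_finite_measure n; exact: sigma_finiteT. Qed.

HB.instance Definition _ := Measure_isSigmaFinite.Build _ _ _ (@lebesgue_rV R n)
  lebesgue_rV_sigma_finite.

End instances.

End lebesgue_rV_measure.

Lemma lebesgue_rV_box (R : realType) n (A : 'I_n -> set (measurableTypeR R)) :
  (forall i, measurable (A i)) ->
  lebesgue_rV [set x : 'rV[R]_n | forall i, A i (x ord0 i)] =
  (\prod_i lebesgue_measure (A i))%E.
Proof.
elim: n A => [|n IHn] A mA.
  by rewrite big_ord0 /= diracE mem_set// => -[].
rewrite big_ord_recl -IHn => [|i]; last exact: mA.
rewrite -product_measure1E//=; last first.
  rewrite (_ : [set x | _] =
      \bigcap_(i in [set: 'I_n]) (rV_coord i @^-1` A (lift ord0 i))).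
    apply: fin_bigcap_measurable => // i _.
    by rewrite -[X in measurable X]setTI; exact: measurable_rV_coord.
  by apply/seteqP; split => [x + i _|x + i]; [exact|apply].
rewrite /pushforward; congr (_ _); apply/seteqP; split => [[a x]/= Ax|[a x]/=].
  split=> [|i]; first by have := Ax ord0; rewrite rV_cons0.
  by have := Ax (lift ord0 i); rewrite rV_consS.
move=> [Aa Ax] i.
by case: (unliftP ord0 i) => [j ->|->]; rewrite (rV_consS, rV_cons0).
Qed.

Section definitions.
Context {R : realType} {n : nat}.
Implicit Types (x y : 'rV[R]_n) (Phi : 'rV[R]_n -> \bar R).

Definition dotrV x y : R := \sum_i x ord0 i * y ord0 i.

Definition normlq (q : R) x : R :=
  (\sum_i `|x ord0 i| `^ q) `^ q^-1.

(* The vector of partial derivatives; it is the gradient where f is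
   differentiable. *)
Definition gradrV (f : 'rV[R]_n -> R) x : 'rV[R]_n :=
  \row_i 'D_(delta_mx ord0 i) f x.

Definition legendre Phi y : \bar R :=
  ereal_sup [set ((dotrV x y)%:E - Phi x)%E | x in [set: 'rV[R]_n]].

(* The library's convex_function is restricted to finite-valued functions.
   The library convention 0 * +oo = 0 is the intended one at t = 0, 1. *)
Definition econvex Phi :=
  forall x y (t : R), 0 <= t <= 1 ->
    (Phi (t *: x + (1 - t) *: y)%R <= t%:E * Phi x + (1 - t)%:E * Phi y)%E.

Definition eproper Phi := exists x, Phi x != +oo%E.

Definition unconditional Phi :=
  forall (s : 'I_n -> bool) x, Phi (\row_i ((-1) ^+ s i * x ord0 i)) = Phi x.

Definition eeven Phi := forall x, Phi (- x) = Phi x.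

End definitions.

(* Main.v *)
(* Unconditional case: in the logarithmic coordinates [x_i = exp (- t_i)] the
   three integrals are linked by Prekopa-Leindler with weights [1/p] and
   [1 - 1/p].  Its hypothesis is the Young inequality
   [<x, grad V y> <= Phi x + Phi^* (grad V y)] together with
   [V z <= <x, grad V y> / p] for [z_i = x_i^(1/p) y_i^(1-1/p)], which is
   Hoelder's inequality and uses [q <= p].

   Even case: replacing [Phi] by
   [Phi^i x = inf_a (Phi (x + a e_i) + Phi (s_i x + a e_i)) / 2], [s_i] being the
   reflection in the coordinate [i], makes it invariant under [s_i], and doing so
   for every [i] reduces to the unconditional case.  The integral of
   [exp (- Phi)] increases by Prekopa-Leindler.  For the dual integral, write
   [grad V] up to a constant as [x |-> |x|_q^(p-q) S x] with
   [S x = (sg x_i |x_i|^(q-1))_i].  A radial substitution removes the factor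
   [|x|_q^(p-q)] at the cost of a weight [exp (- |x|_q^q)], a product of even
   decreasing functions.  Since [q - 1 >= 1], the image under [S] of this weighted
   measure is a mixture of uniform measures on symmetric boxes, and on each box
   the dual integral increases, by Prekopa-Leindler in the other coordinates. *)
Require Import Defs.
From mathcomp Require Import all_boot all_order all_algebra.
From mathcomp Require Import all_classical all_reals all_analysis.
From HB Require Import structures.
From mathcomp Require Import perm measurable_realfun ring lra.

Set Implicit Arguments.
Unset Strict Implicit.
Unset Printing Implicit Defensive.

Import Order.TTheory GRing.Theory Num.Theory.
Import numFieldNormedType.Exports.

Local Open Scope classical_set_scope.
Local Open Scope ring_scope.

(** * Change of variables *)

(** Measurability shapes the argument: [Phi] need not be Borel, and [Phi^i] is an infimum over
    uncountably many shifts. So [Phi] is first replaced by its infimum over open boxes of radius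
    [e], which is upper semicontinuous, and the symmetrizations preserve upper semicontinuity. This
    lowers [Phi] and raises its Legendre transform at [y] by at most [e] times the l1 norm of [y];
    the factor lost in the dual integral increases to 1 as [e] tends to 0. Convexity enters through
    [Phi 0 <= Phi x], a real lower bound that keeps -oo out of all these infima. On the dual side,
    the Legendre transform of [Phi^i] at [y] is at most the mean of that of [Phi] at two points
    whose coordinates [i] are [y_i] and [- y_i]; these are opposite so that the shift [a] cancels.
    Evenness allows the second point to be negated, which brings it back to the slice of the first.
    Hence the dual comparison runs inside slices, between a function and its reflection through the
    origin. The weights 1/p and 1 - 1/p are forced by (1 - 1/p) / (p - 1) = 1/p: the potential and
    its transform then carry the same weight, as in Young's inequality. *)

Section image_density.
Local Open Scope ereal_scope.
Context d1 d2 (X : measurableType d1) (Y : measurableType d2) (R : realType).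
Variables (mu : {measure set X -> \bar R}) (phi : X -> Y) (w : X -> R).
Hypotheses (mphi : measurable_fun setT phi) (mw : measurable_fun setT w).
Hypothesis w0 : forall x, (0 <= w x)%R.

Import HBNNSimple.

(** The image under [phi] of the measure with density [w] with respect to [mu]. A change of
    variables amounts to identifying this measure. *)
Definition image_density (A : set Y) : \bar R :=
  \int[mu]_x ((\1_A (phi x))%:E * (w x)%:E).

Let mindic A : measurable A ->
  measurable_fun setT (fun x => (\1_A (phi x) : R)%:E * (w x)%:E).
Proof.
move=> mA; apply: emeasurable_funM => //; apply/measurable_EFinP => //.
by apply: (measurableT_comp _ mphi); exact: measurable_indic.
Qed.

Lemma image_density0 : image_density set0 = 0.
Proof.
by rewrite /image_density integral0_eq// => x _; rewrite indic0 mul0e.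
Qed.

Lemma image_density_ge0 A : 0 <= image_density A.
Proof. by apply: integral_ge0 => x _; rewrite mule_ge0// lee_fin//. Qed.

Lemma image_density_sigma_additive : semi_sigma_additive image_density.
Proof.
move=> F mF tF mUF; rewrite /image_density.
have E x : ((\1_(\bigcup_n F n) (phi x))%:E * (w x)%:E =
    \sum_(i <oo) ((\1_(F i) (phi x))%:E * (w x)%:E) :> \bar R).
  have [[i _ Fi]|nF] := pselect ((\bigcup_n F n) (phi x)).
    rewrite indicE mem_set ?mul1e; last by exists i.
    rewrite (@nneseriesD1 _ _ i) ?inE//; last first.
      by move=> k _; rewrite mule_ge0// lee_fin//.
    rewrite indicE mem_set// mul1e eseries0 ?adde0// => k _ /= ki.
    rewrite indicE memNset ?mul0e// => Fk.
    by move/eqP : ki; apply; apply: tF => //; exists (phi x).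
  rewrite indicE memNset// mul0e eseries0// => i _ _.
  by rewrite indicE memNset ?mul0e// => Fi; apply: nF; exists i.
under eq_integral do rewrite E.
rewrite integral_nneseries//; last 2 first.
- by move=> n; exact: mindic.
- by move=> n x _; rewrite mule_ge0// lee_fin//.
apply: is_cvg_nneseries => n _ _; exact: image_density_ge0.
Qed.

HB.instance Definition _ := isMeasure.Build _ _ _ image_density
  image_density0 image_density_ge0 image_density_sigma_additive.

Definition image_measure : {measure set Y -> \bar R} := image_density.

(** Simple functions and monotone limits reduce the formula to indicators. [nu] is kept apart from
    [image_density] so that a uniqueness theorem, tested on intervals or boxes only, can supply the
    first hypothesis. *)
Lemma ge0_integral_image_density (nu : {measure set Y -> \bar R})
    (f : Y -> \bar R) :
  (forall A, measurable A -> nu A = image_density A) ->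
  measurable_fun setT f -> (forall y, 0 <= f y) ->
  \int[mu]_x (f (phi x) * (w x)%:E) = \int[nu]_y f y.
Proof.
move=> nuE mf f0; pose f_ := nnsfun_approx measurableT mf.
have fE y : f y = limn (fun n => (f_ n y)%:E).
  by apply/esym/cvg_lim => //; exact: cvg_nnsfun_approx.
have f_nd y : nondecreasing_seq (fun n => (f_ n y)%:E).
  by move=> m n mn; rewrite lee_fin; exact/lefP/nd_nnsfun_approx.
transitivity (limn (fun n => \int[nu]_y (f_ n y)%:E)); last first.
  rewrite -monotone_convergence//.
  - by apply: eq_integral => y _; rewrite fE.
  - by move=> n; exact/measurable_EFinP.
  - by move=> n y _; rewrite lee_fin.
transitivity (limn (fun n => \int[mu]_x ((f_ n (phi x))%:E * (w x)%:E))).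
  rewrite -monotone_convergence//.
  - apply: eq_integral => x _; rewrite fE muleC -limeMl//.
      by congr (limn _); apply/funext => n; rewrite muleC.
    exact: ereal_nondecreasing_is_cvgn.
  - move=> n; apply: emeasurable_funM => //; apply/measurable_EFinP => //.
    exact: (measurableT_comp _ mphi).
  - by move=> n x _; rewrite mule_ge0// lee_fin//.
  - by move=> x _ m n mn; apply: lee_wpmul2r; rewrite ?lee_fin//; apply: f_nd.
congr (limn _); apply/funext => n.
under eq_integral => x _.
  rewrite fimfunE -fsumEFin// ge0_mule_fsuml; last first.
    by move=> r; rewrite EFinM; exact: nnfun_muleindic_ge0.
  over.
under [RHS]eq_integral do rewrite fimfunE -fsumEFin//.
have mterm r : measurable_fun setT
    (fun x => (r * \1_(f_ n @^-1` [set r]) (phi x))%:E * (w x)%:E).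
  apply: emeasurable_funM => //; apply/measurable_EFinP => //.
  apply: measurable_funM => //; apply: (measurableT_comp _ mphi).
  exact: measurable_indic.
rewrite ge0_integral_fsum//; last first.
  move=> r x _; apply: mule_ge0; last by rewrite lee_fin.
  by rewrite EFinM; exact: nnfun_muleindic_ge0.
rewrite [RHS]ge0_integral_fsum//; last 2 first.
- move=> r; apply/measurable_EFinP; apply: measurable_funM => //.
- by move=> r x _; rewrite EFinM; exact: nnfun_muleindic_ge0.
apply: eq_fsbigr => r _.
rewrite integralZl_indic_nnsfun//= integral_indic// setIT nuE//.
have [r0|r0] := leP 0%R r.
  under eq_integral do rewrite EFinM -muleA.
  rewrite ge0_integralZl_EFin//.
  - by move=> x _; rewrite mule_ge0// lee_fin//.
  - exact: mindic.
(* The approximating simple functions are nonnegative, so a negative value [r] has an empty level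
   set. *)
rewrite (_ : f_ n @^-1` [set r] = set0); last first.
  apply/seteqP; split => // y /= fr.
  by have : (0 <= f_ n y)%R by []; rewrite fr leNgt r0.
rewrite image_density0 mule0 integral0_eq// => x _.
by rewrite indic0 mulr0 mul0e.
Qed.

End image_density.

(** * Substitutions on the real line *)

Section substitution.
Local Open Scope ereal_scope.
Context {R : realType}.
Notation mu := (@lebesgue_measure R).

(** The integral of a nonnegative function is a supremum over the simple functions below it, so
    monotonicity holds without measurability. This serves for [expeR (- Phi x)], which may fail to
    be Borel, and spares measurability proofs for inner integrals. *)
Lemma ge0_le_integral_nonmeasurable d (T : measurableType d)
    (m : {measure set T -> \bar R}) (f g : T -> \bar R) :
  (forall x, 0 <= f x) -> (forall x, f x <= g x) ->
  \int[m]_x f x <= \int[m]_x g x.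
Proof.
move=> f0 fg; have g0 x : 0 <= g x by exact: le_trans (f0 x) (fg x).
rewrite !ge0_integralTE//; apply: ereal_sup_le => _ [h /= hf <-].
by exists h => // x; exact: le_trans (hf x) (fg x).
Qed.

Lemma integral_itv_oc_derive (F f : R -> R) (u v : R) : (u < v)%R ->
  continuous f -> (forall x, is_derive x (1%R : R) F (f x)) ->
  \int[mu]_(x in `]u, v]) (f x)%:E = (F v - F u)%:E.
Proof.
move=> uv cf dF.
have cF : continuous F.
  move=> x; apply: differentiable_continuous; apply/derivable1_diffP.
  by have [] := dF x.
rewrite integral_itv_obnd_cbnd; last first.
  apply/measurable_EFinP; apply: measurable_funTS.
  exact: continuous_measurable_fun.
rewrite (@continuous_FTC2 _ f F)// ?EFinB//.
- exact: continuous_subspaceT.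
- split.
  + by move=> x _; have [] := dF x.
  + exact/cvg_at_right_filter/cF.
  + exact/cvg_at_left_filter/cF.
- by move=> x _; rewrite derive1E; have [] := dF x.
Qed.

(** By uniqueness of Lebesgue measure only intervals have to be tested, and there the fundamental
    theorem of calculus gives the increment of [th]. Strict monotonicity is assumed apart from the
    sign of [j] because the derivative of a signed power may vanish at 0. *)
Lemma ge0_integral_subst (th j : R -> R) (F : R -> \bar R) :
  {homo th : x y / (x < y)%R} -> (forall y, exists x, th x = y) ->
  continuous j -> (forall x, is_derive x (1%R : R) th (j x)) ->
  (forall x, 0 <= j x)%R ->
  measurable_fun setT F -> (forall y, 0 <= F y) ->
  \int[mu]_x (F (th x) * (j x)%:E) = \int[mu]_y F y.
Proof.
move=> hth sth cj dth j0 mF F0.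
have mj : measurable_fun setT j by exact: continuous_measurable_fun.
have mth : measurable_fun setT th.
  apply: continuous_measurable_fun => x; apply: differentiable_continuous.
  by apply/derivable1_diffP; have [] := dth x.
apply: (@ge0_integral_image_density _ _ (measurableTypeR R) (measurableTypeR R))
  => //.
apply: lebesgue_measure_unique => _ [[a b]/= ab <-].
have [u ua] := sth a; have [v vb] := sth b.
have mono := le_mono hth.
rewrite /image_density lebesgue_measure_itv/= lte_fin.
have E x : (\1_`]a, b] (th x))%:E * (j x)%:E =
    (((fun x => (j x)%:E) \_ `]u, v]) x) :> \bar R.
  rewrite patchE indicE; case: ifPn => [/set_mem|/negP xuv] /=.
    rewrite in_itv/= => /andP[ux xv]; rewrite mem_set ?mul1e//=.
    by rewrite in_itv/= -ua -vb hth// mono.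
  rewrite memNset ?mul0e//= in_itv/= -ua -vb mono => /andP[ux xv].
  apply: xuv; apply/mem_set; rewrite /= in_itv/= xv andbT.
  by rewrite ltNge -mono -ltNge.
under eq_integral do rewrite E.
rewrite -integral_mkcond; case: ifPn => ab'.
  rewrite (@integral_itv_oc_derive th)// -?ua -?vb ?EFinB//.
  by rewrite ltNge -mono ua vb -ltNge.
rewrite set_itv_ge ?integral_set0// bnd_simp -leNgt -mono ua vb.
by rewrite leNgt.
Qed.

Lemma ge0_integral_affine (a b : R) (F : R -> \bar R) : (0 < a)%R ->
  measurable_fun setT F -> (forall y, 0 <= F y) ->
  \int[mu]_x (F (a * x + b)%R * a%:E) = \int[mu]_y F y.
Proof.
move=> a0 mF F0.
apply: (@ge0_integral_subst (fun x => a * x + b)%R (cst a)) => //.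
- by move=> x y xy /=; rewrite ltrD2r ltr_pM2l.
- by move=> y; exists ((y - b) / a)%R; rewrite mulrC divfK ?gt_eqF// subrK.
- by move=> x; exact: cvg_cst.
- by move=> x; apply: is_derive_eq; rewrite /GRing.scale/=; ring.
- by move=> x; exact: ltW.
Qed.

Lemma ge0_integral_opp (F : R -> \bar R) :
  measurable_fun setT F -> (forall y, 0 <= F y) ->
  \int[mu]_x F (- x)%R = \int[mu]_y F y.
Proof.
move=> mF F0.
transitivity (\int[mu]_x (F (- x)%R * (cst 1%R x)%:E)).
  by apply: eq_integral => x _; rewrite mule1.
apply: (@ge0_integral_image_density _ _ (measurableTypeR R)
  (measurableTypeR R)) => //.
move=> A mA; rewrite -[LHS]lebesgue_measureN// /pushforward /image_density.
  under eq_integral do rewrite mule1.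
  rewrite (_ : (fun x => _) = EFin \o \1_(-%R @^-1` A))//.
  rewrite integral_indic ?setIT//.
  rewrite -[X in measurable X]setTI.
  by apply: (continuous_measurable_fun opp_continuous).
Qed.

Lemma integral_expRN_ge (a : R) :
  \int[mu]_(x in `[a, +oo[) (expR (- x))%:E = (expR (- a))%:E.
Proof.
have cE : continuous (fun x : R => expR (- x)).
  move=> x; apply: continuous_comp; first exact: opp_continuous.
  exact: continuous_expR.
have cNE : continuous (fun x : R => - expR (- x))%R.
  by move=> x; apply: cvgN; exact: cE.
have dE (x : R) : is_derive x (1%R : R) (fun x => - expR (- x))%R (expR (- x)).
  apply: is_derive_eq; rewrite /GRing.scale/=; ring.
rewrite (@ge0_continuous_FTC2y _ _ (fun x => - expR (- x))%R a 0)//.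
- by rewrite sub0e EFinN oppeK.
- exact: continuous_subspaceT.
- rewrite -oppr0; apply: cvgN; exact: cvgr_expR.
- exact/cvg_at_right_filter/cNE.
- by move=> x _; rewrite derive1E; have [] := dE x.
Qed.

End substitution.

Lemma eq_indic (R : pzRingType) T U (A : set T) (B : set U) x y :
  (A x <-> B y) -> \1_A x = \1_B y :> R.
Proof.
move=> AB; rewrite !indicE; congr ((nat_of_bool _)%:R).
by apply/idP/idP => /set_mem/AB/mem_set.
Qed.

(** * The substitution y = exp (- t) *)

Section exponential_substitution.
Local Open Scope ereal_scope.
Context {R : realType}.
Notation mu := (@lebesgue_measure R).

Let G (t : R) := (expR (- t))%R.

Let mG : measurable_fun setT G.
Proof.
apply: continuous_measurable_fun => x; apply: continuous_comp.
  exact: opp_continuous.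
exact: continuous_expR.
Qed.

Let image_expRN (a b : R) : (a < b)%R ->
  \int[mu]_x ((\1_`]a, b] (G x))%:E * (G x)%:E) = mu (`]a, b] `&` `]0%R, +oo[).
Proof.
move=> ab.
have E0 (c : R) : (0 < c)%R ->
    \int[mu]_x ((\1_`]0%R, c] (G x))%:E * (G x)%:E) = c%:E.
  move=> c0; transitivity (\int[mu]_(x in `[(- ln c)%R, +oo[) (G x)%:E).
    rewrite [RHS]integral_mkcond; apply: eq_integral => x _.
    rewrite patchE indicE; case: ifPn => [/set_mem|/negP xc]/=.
      rewrite in_itv/= andbT => cx; rewrite mem_set ?mul1e//=.
      rewrite in_itv/= expR_gt0/= -[leRHS](lnK c0) ler_expR.
      by rewrite lerNl.
    rewrite memNset ?mul0e//= in_itv/= expR_gt0/= -[leRHS](lnK c0) ler_expR.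
    by rewrite lerNl => cx; apply: xc; apply/mem_set; rewrite /= in_itv/= andbT.
  by rewrite integral_expRN_ge opprK lnK.
have [b0|b0] := leP b 0%R.
  rewrite integral0_eq; last first.
    move=> x _; rewrite indicE memNset ?mul0e//= in_itv/= => /andP[_ Gb].
    by have := le_trans Gb b0; rewrite leNgt expR_gt0.
  rewrite (_ : _ `&` _ = set0) ?measure0//; apply/seteqP; split => // x [] /=.
  rewrite !in_itv/= andbT => /andP[_ xb] x0.
  by have := le_trans xb b0; rewrite leNgt x0.
have [a0|a0] := leP a 0%R.
  rewrite (_ : _ `&` _ = `]0%R, b]%classic); last first.
    apply/seteqP; split => [x [] /=|x /=]; rewrite !in_itv/= ?andbT.
      by move=> /andP[_ ->] ->.
    by move=> /andP[x0 ->]; rewrite x0 (le_lt_trans a0).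
  rewrite lebesgue_measure_itv/= lte_fin b0 sube0 -[RHS](E0 b b0).
  apply: eq_integral => x _; congr (_%:E * _); apply: eq_indic => /=.
  by rewrite !in_itv/= expR_gt0 (le_lt_trans a0)// expR_gt0.
rewrite (_ : _ `&` _ = `]a, b]%classic); last first.
  apply/seteqP; split => [x [] //|x /=]; rewrite !in_itv/= andbT => axb.
  by split => //; case/andP : axb => /(lt_trans a0).
rewrite lebesgue_measure_itv/= lte_fin ab.
(* The value on []a, b]] is found by subtracting the value on []0, a]] from that on []0, b]], both
   known from [E0]. *)
have : \int[mu]_x ((\1_`]0%R, a] (G x))%:E * (G x)%:E) +
    \int[mu]_x ((\1_`]a, b] (G x))%:E * (G x)%:E) = b%:E.
  rewrite -ge0_integralD//.
  - rewrite -(E0 b b0); apply: eq_integral => x _.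
    rewrite -muleDl//= -EFinD !indicE; congr (_%:E * _).
    have [Ga|Ga] := leP (G x) a.
      rewrite mem_set/= ?in_itv/= ?expR_gt0//.
      rewrite memNset/=; last by rewrite in_itv/= ltNge Ga.
      by rewrite mem_set ?addr0//= in_itv/= expR_gt0 (le_trans Ga)// ltW.
    rewrite memNset/=; last by rewrite in_itv/= leNgt Ga andbF.
    rewrite add0r -!indicE; apply: eq_indic.
    by rewrite /= !in_itv/= Ga expR_gt0.
  - by move=> x _; rewrite mule_ge0 ?lee_fin ?expR_ge0.
  - apply: emeasurable_funM; apply/measurable_EFinP => //.
    by apply: (measurableT_comp _ mG); exact: measurable_indic.
  - by move=> x _; rewrite mule_ge0 ?lee_fin ?expR_ge0.
  - apply: emeasurable_funM; apply/measurable_EFinP => //.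
    by apply: (measurableT_comp _ mG); exact: measurable_indic.
rewrite (E0 a a0) => <-.
by rewrite addeAC subee// add0e.
Qed.

(** The map covers only the positive half line, while the uniqueness theorem concerns the whole
    line. The image measure is therefore completed by Lebesgue measure on the complement, the sum is
    identified with [mu], and the result is restricted back. *)
Lemma ge0_integral_expRN (F : R -> \bar R) :
  measurable_fun setT F -> (forall y, 0 <= F y) ->
  \int[mu]_x (F (expR (- x)) * (expR (- x))%:E) =
  \int[mu]_(y in `]0%R, +oo[) F y.
Proof.
move=> mF F0.
have mpos : measurable (`]0%R, +oo[%classic : set (measurableTypeR R)) by [].
have G0 x : (0 <= G x)%R by exact: expR_ge0.
pose m1 : {measure set (measurableTypeR R) -> \bar R} :=
  @image_measure _ _ (measurableTypeR R) (measurableTypeR R) _ mu G G mG mG G0.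
pose m := measure_add m1 (mrestr mu (measurableC mpos)).
have muE (A : set (measurableTypeR R)) : measurable A -> mu A = m A.
  apply: lebesgue_measure_unique => _ [[a b]/= ab <-].
  rewrite [RHS]measure_addE.
  have [ab'|ba] := ltP a b; last first.
    by rewrite set_itv_ge ?measure0 ?adde0// bnd_simp -leNgt.
  rewrite [X in X + _](image_expRN ab') addeC.
  rewrite [X in X + _](_ : _ = mu (`]a, b] `\` `]0%R, +oo[)); last first.
    by rewrite setDE.
  by rewrite -measureDI.
have nuE (A : set (measurableTypeR R)) : measurable A ->
    mrestr mu mpos A = image_density mu G G A.
  move=> mA; rewrite /mrestr muE; last exact: measurableI.
  rewrite [LHS]measure_addE [X in _ + X](_ : _ = 0) ?adde0; last first.
    transitivity (mu ((A `&` `]0%R, +oo[) `&` ~` `]0%R, +oo[)) => //.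
    by rewrite -setIA setICr setI0 measure0.
  apply: eq_integral => x _; congr (_%:E * _); apply: eq_indic.
  by split=> [[]//|AG]; split => //=; rewrite in_itv/= expR_gt0.
transitivity (\int[mrestr mu mpos]_y F y).
  exact: (@ge0_integral_image_density _ _ (measurableTypeR R)
    (measurableTypeR R) _ mu G G mG mG G0 (mrestr mu mpos) F nuE).
rewrite -(@ge0_integral_image_density _ _ (measurableTypeR R)
  (measurableTypeR R) _ mu id (\1_`]0%R, +oo[)%R)//.
- rewrite [RHS]integral_mkcond; apply: eq_integral => x _.
  by rewrite patchE indicE; case: ifPn => _; rewrite ?mule1 ?mule0.
- move=> A mA; transitivity (mu (A `&` `]0%R, +oo[)) => //.
  rewrite -[X in mu X]setIT -integral_indic//; last exact: measurableI.
  by apply: eq_integral => x _; rewrite -EFinM indicI.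
Qed.

(** The factor 2 accounts for the negative half line, which contributes as much as the positive one
    by evenness. *)
Lemma ge0_integral_even_expRN (F : R -> \bar R) :
  measurable_fun setT F -> (forall y, 0 <= F y) ->
  (forall y, F (- y)%R = F y) ->
  \int[mu]_x (F (expR (- x)) * (2 * expR (- x))%:E) = \int[mu]_y F y.
Proof.
move=> mF F0 evF.
have mpos : measurable (`]0%R, +oo[%classic : set (measurableTypeR R)) by [].
have negE : \int[mu]_(y in `]-oo, 0%R]) F y = \int[mu]_(y in `]0%R, +oo[) F y.
  rewrite integral_itv_obnd_cbnd; last exact: measurable_funTS.
  rewrite ge0_integration_by_substitution0//.
  by apply: eq_integral => x _; rewrite evF.
transitivity (2%:E * \int[mu]_(y in `]0%R, +oo[) F y).
  rewrite -ge0_integral_expRN// -ge0_integralZl_EFin//.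
  - by apply: eq_integral => x _; rewrite EFinM muleCA.
  - by move=> x _; apply: mule_ge0 => //; rewrite lee_fin expR_ge0.
  - apply: emeasurable_funM; last by apply/measurable_EFinP; exact: mG.
    exact: (measurableT_comp mF mG).
rewrite -[in RHS](setUv `]0%R, +oo[%classic) ge0_integral_setU//=.
- by rewrite setCitvr negE mule_natl mule2n.
- exact: measurableC.
- by rewrite setUv.
- exact/disj_setPCl.
Qed.

End exponential_substitution.

(** * The Prekopa-Leindler inequality *)

Lemma measurable_lte_set d (T : measurableType d) (R : realType)
    (f g : T -> \bar R) : measurable_fun setT f -> measurable_fun setT g ->
  measurable [set x | (f x < g x)%E].
Proof.
move=> mf mg; rewrite -[X in measurable X]setTI.
exact: (measurable_fun_lte mf mg).
Qed.

Section power_limits.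
Local Open Scope ereal_scope.
Context {R : realType}.

Lemma le_poweR (x y : \bar R) (s : R) : (0 <= s)%R -> 0 <= x -> x <= y ->
  x `^ s <= y `^ s.
Proof.
move=> s0 x0 xy; apply: gt0_ler_poweR => //; rewrite in_itv/= leey andbT//.
exact: le_trans xy.
Qed.

Lemma poweRK (x : \bar R) (s : R) : (0 < s)%R -> 0 <= x ->
  (x `^ s) `^ s^-1 = x.
Proof. by move=> s0 x0; rewrite -poweRrM mulfV ?gt_eqF// poweRe1. Qed.

(** Once the degenerate values 0 and +oo of [c] and [x] are set aside, the bound is solved for
    [u n], as [u n <= (z / c) ^ (1/s)], and an inequality of this form passes to the limit.
    Continuity of the power at +oo is thus avoided. *)
Lemma poweR_lim_le (u : nat -> \bar R) (x c z : \bar R) (s : R) : (0 < s)%R ->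
  (forall n, 0 <= u n) -> u @ \oo --> x -> 0 <= c ->
  (forall n, u n `^ s * c <= z) -> x `^ s * c <= z.
Proof.
move=> s0 u0 ux c0 ucz.
have xE : limn u = x by exact/cvg_lim.
have cu : cvgn u by apply/cvg_ex; exists x.
have z0 : 0 <= z by apply: le_trans (ucz 0%N); rewrite mule_ge0// poweR_ge0.
have x0 : 0 <= x by rewrite -xE; apply: lime_ge => //; exact: nearW.
have [->|cN0] := eqVneq c 0; first by rewrite mule0.
have cgt0 : 0 < c by rewrite lt_neqAle eq_sym cN0.
have [->|xN0] := eqVneq x 0; first by rewrite poweR0r ?gt_eqF// mul0e.
have [n un] : exists n, u n != 0.
  apply: contrapT => /forallNP un; move: xN0; rewrite -xE.
  rewrite (_ : u = cst 0); first by rewrite lim_cst// eqxx.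
  by apply/funext => n; apply/eqP; have /negP := un n; rewrite negbK.
have [cy|cfin] := eqVneq c +oo.
  suff -> : z = +oo by rewrite leey.
  apply/eqP; rewrite -leye_eq (le_trans _ (ucz n))// cy gt0_muley//.
  by rewrite poweR_gt0// lt_neqAle eq_sym un u0.
have fc : c \is a fin_num by rewrite ge0_fin_numE// ltey.
have rc : (0 < fine c)%R by rewrite fine_gt0// cgt0 ltey.
rewrite -(fineK fc) -lee_pdivlMr//.
rewrite -[leRHS]poweRe1; last by rewrite mule_ge0// lee_fin invr_ge0 ltW.
rewrite -(mulVf (lt0r_neq0 s0)) poweRrM.
apply: le_poweR => //; first exact: ltW.
rewrite -xE; apply: lime_le => //; apply: nearW => m.
rewrite -[leLHS](poweRK s0)//; apply: le_poweR; rewrite ?poweR_ge0//.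
  by rewrite invr_ge0 ltW.
by rewrite lee_pdivlMr// fineK.
Qed.

Lemma poweR_AGM (a b : \bar R) (l : R) : (0 < l < 1)%R -> 0 <= a -> 0 <= b ->
  a `^ (1 - l) * b `^ l <= (1 - l)%:E * a + l%:E * b.
Proof.
move=> /andP[l0 l1] a0 b0; have l1' : (0 < 1 - l)%R by rewrite subr_gt0.
case: a a0 => [a||//] a0; last first.
  have : 0 <= l%:E * b by rewrite mule_ge0// lee_fin ltW.
  by rewrite (gt0_muley (_ : 0 < (1 - l)%:E)) ?lte_fin//; case: (_ * b) => // *;
    rewrite leey.
case: b b0 => [b||//] b0; last first.
  by rewrite (gt0_muley (_ : 0 < l%:E)) ?lte_fin// leey.
rewrite !lee_fin in a0 b0.
rewrite -EFinM -EFinD lee_fin.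
have -> : ((1 - l) * a + l * b =
    (a `^ (1 - l)) `^ (1 - l)^-1 / (1 - l)^-1 + (b `^ l) `^ l^-1 / l^-1)%R.
  rewrite -!powRrM !mulfV ?gt_eqF// !powRr1// !invrK.
  by rewrite mulrC (mulrC l).
by apply: conjugate_powR; rewrite ?powR_ge0// ?invr_gt0// !invrK subrK.
Qed.

End power_limits.

(** * The layer-cake formula *)

Section one_dimensional.
Local Open Scope ereal_scope.
Context {R : realType}.
Notation mu := (@lebesgue_measure R).

Let subgraph (F : R -> \bar R) :=
  [set z : measurableTypeR R * measurableTypeR R | 0 < z.2%:E < F z.1].

Let measurable_subgraph F : measurable_fun setT F -> measurable (subgraph F).
Proof.
move=> mF; rewrite (_ : subgraph F =
    [set z | 0 < z.2%:E] `&` [set z | z.2%:E < F z.1]); last first.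
  apply/seteqP; split => z /=; first by move=> /andP[].
  by move=> [h1 h2]; apply/andP.
have m2 : measurable_fun setT
    (fun z : measurableTypeR R * measurableTypeR R => z.2%:E).
  by apply/measurable_EFinP; exact: measurable_snd.
apply: measurableI; apply: measurable_lte_set => //.
by apply: (measurableT_comp mF); exact: measurable_fst.
Qed.

Lemma measurable_layer (F : R -> \bar R) : measurable_fun setT F ->
  measurable_fun setT (fun t : R => mu [set x | 0 < t%:E < F x]).
Proof.
move=> mF; rewrite (_ : (fun t => _) = mu \o ysection (subgraph F)).
  exact: measurable_fun_ysection (measurable_subgraph mF).
apply/funext => t /=; congr (mu _).
by apply/seteqP; split => x; rewrite /ysection/= inE.
Qed.

(** Tonelli's theorem on the region under the graph. The condition [0 < t] sits inside the level set
    so that the outer integral can run over the whole line. *)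
Lemma layer_cake (F : R -> \bar R) :
  measurable_fun setT F -> (forall x, 0 <= F x) ->
  \int[mu]_x F x = \int[mu]_t mu [set x | 0 < t%:E < F x].
Proof.
move=> mF F0; pose A := subgraph F; have mA := measurable_subgraph mF.
pose f (z : measurableTypeR R * measurableTypeR R) : \bar R := (\1_A z)%:E.
have mf : measurable_fun setT f by apply/measurable_EFinP; exact: measurable_indic.
have f0 z : 0 <= f z by rewrite lee_fin.
transitivity (\int[mu]_x \int[mu]_t f (x, t)).
  apply: eq_integral => x _.
  rewrite (_ : (fun t => f (x, t)) = EFin \o \1_(xsection A x)); last first.
    by apply/funext => t /=; congr EFin; apply: eq_indic; rewrite /xsection/= inE.
  rewrite integral_indic ?setIT//; last exact: (measurable_xsection x mA).
  rewrite (_ : xsection A x = [set t | 0 < t%:E < F x]); last first.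
    by apply/seteqP; split => t; rewrite /xsection/= inE.
  case: (F x) (F0 x) => [r||//] r0.
    transitivity (mu `]0%R, r[%classic); last first.
      by congr (mu _); apply/seteqP; split => t /=; rewrite in_itv/= !lte_fin.
    rewrite lebesgue_measure_itv/= lte_fin EFinN sube0.
    by case: ifPn => // /negPf r0'; move: r0; rewrite lee_fin le_eqVlt r0' orbF
      => /eqP <-.
  transitivity (mu `]0%R, +oo[%classic); last first.
    congr (mu _); apply/seteqP; split => t /=; rewrite in_itv/= lte_fin ltry.
      by rewrite !andbT.
    by rewrite !andbT.
  by rewrite lebesgue_measure_itv/= ltry.
rewrite fubini_tonelli//; apply: eq_integral => t _.
rewrite (_ : (fun x => f (x, t)) = EFin \o \1_(ysection A t)); last first.
  by apply/funext => x /=; congr EFin; apply: eq_indic; rewrite /ysection/= inE.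
rewrite integral_indic ?setIT//; last exact: (measurable_ysection t mA).
by congr (mu _); apply/seteqP; split => x; rewrite /ysection/= inE.
Qed.

End one_dimensional.

(** * The Brunn-Minkowski inequality on the line *)

Section brunn_minkowski.
Local Open Scope ereal_scope.
Context {R : realType}.
Notation mu := (@lebesgue_measure R).
Notation RT := (measurableTypeR R).

Let measurable_affine_preimage (a b : R) (A : set RT) : measurable A ->
  measurable [set x : RT | A (a * x + b)%R].
Proof.
move=> mA.
have mf : measurable_fun setT (fun x : R => a * x + b)%R.
  by apply: measurable_funD => //; apply: measurable_funM.
by rewrite -[X in measurable X]setTI; exact: mf.
Qed.

Lemma lebesgue_measure_affine (a b : R) (A : set RT) : (0 < a)%R ->
  measurable A -> mu [set x : RT | A (a * x + b)%R] = (a^-1)%:E * mu A.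
Proof.
move=> a0 mA; have mA' := measurable_affine_preimage a b mA.
rewrite -[in RHS](setIT A) -integral_indic//.
rewrite -(@ge0_integral_affine _ a b)//; last exact/measurable_EFinP.
rewrite ge0_integralZr ?lee_fin//.
- rewrite muleCA -EFinM mulVf ?gt_eqF// mule1.
  by rewrite -[in LHS](setIT [set x | _]) -integral_indic.
- apply/measurable_EFinP; apply: (measurableT_comp (measurable_indic mA)).
  by apply: measurable_funD => //; apply: measurable_funM.
- by apply: ltW.
Qed.

(** The part of [A] left of [a], translated by [b], and the part of [B] right of [b], translated by
    [a], both lie in [C] and are separated by the point [a + b]. Translation preserves measure. *)
Let brunn_minkowski_split (A B C : set RT) (a b : R) :
  measurable A -> measurable B -> measurable C -> A a -> B b ->
  (forall x y, A x -> B y -> C (x + y)%R) ->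
  mu (A `&` `]-oo, a]) + mu (B `&` `]b, +oo[) <= mu C.
Proof.
move=> mA mB mC Aa Bb ABC.
pose S1 := [set x : RT | (A `&` `]-oo, a]) (1 * x + - b)%R].
pose S2 := [set x : RT | (B `&` `]b, +oo[) (1 * x + - a)%R].
have mS1 : measurable S1 by apply: measurable_affine_preimage; exact: measurableI.
have mS2 : measurable S2 by apply: measurable_affine_preimage; exact: measurableI.
have muT (c : R) (D : set RT) : measurable D ->
    mu [set x : RT | D (1 * x + c)%R] = mu D.
  by move=> mD; rewrite lebesgue_measure_affine// invr1 mul1e.
rewrite -(muT (- b)%R (A `&` _)); last exact: measurableI.
rewrite -(muT (- a)%R (B `&` _)); last exact: measurableI.
rewrite -measureU//; last first.
  apply/seteqP; split => // x /= [[_ +] [_ +]].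
  rewrite !in_itv/= andbT !mul1r => h1 h2.
  have : (x <= a + b)%R by rewrite -lerBlDr.
  by rewrite leNgt addrC; move: h2; rewrite ltrBrDr => ->.
apply: le_measure; rewrite ?inE//; first exact: measurableU.
move=> x [|] /=; rewrite mul1r => -[h _].
  by rewrite -(subrK b x); exact: ABC.
by rewrite -(subrK a x) addrC; exact: ABC.
Qed.

(** The splitting points are taken within [e / 2] of the supremum of [A] and of the infimum of [B],
    so each discarded piece has measure at most [e / 2]. *)
Lemma brunn_minkowski (A B C : set RT) (k : R) :
  measurable A -> measurable B -> measurable C -> A !=set0 -> B !=set0 ->
  A `<=` `[(- k)%R, k] -> B `<=` `[(- k)%R, k] ->
  (forall x y, A x -> B y -> C (x + y)%R) ->
  mu A + mu B <= mu C.
Proof.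
move=> mA mB mC A0 B0 Ak Bk ABC.
have supA : has_sup A.
  split => //; exists k => x /Ak /=; rewrite in_itv/=.
  by case/andP.
have infB : has_inf B.
  split => //; exists (- k)%R => x /Bk /=; rewrite in_itv/=.
  by case/andP.
apply/lee_addgt0Pr => e e0.
have e2 : (0 < e / 2)%R by rewrite divr_gt0.
have [a Aa ae] := sup_adherent e2 supA.
have [b Bb be] := inf_adherent e2 infB.
have hA : mu A <= mu (A `&` `]-oo, a]) + (e / 2)%:E.
  rewrite (measureDI mu mA (measurable_itv `]-oo, a]))// addeC.
  rewrite leeD2l//; apply: (@le_trans _ _ (mu `]a, (a + e / 2)%R])).
    apply: le_measure; rewrite ?inE//; first exact: measurableD.
    move=> x [Ax] /=; rewrite !in_itv/= => /negP; rewrite -ltNge => -> /=.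
    apply: (@le_trans _ _ (sup A)); first exact: sup_upper_bound.
    rewrite -lerBlDr; exact: ltW.
  by rewrite lebesgue_measure_itv/= lte_fin ltrDl e2 -EFinB lee_fin; lra.
have hB : mu B <= mu (B `&` `]b, +oo[) + (e / 2)%:E.
  rewrite (measureDI mu mB (measurable_itv `]b, +oo[))// addeC.
  rewrite leeD2l//; apply: (@le_trans _ _ (mu `[(b - e / 2)%R, b])).
    apply: le_measure; rewrite ?inE//; first exact: measurableD.
    move=> x [Bx] /=; rewrite !in_itv/= andbT => /negP; rewrite -leNgt => ->.
    rewrite andbT; apply: (@le_trans _ _ (inf B)); last first.
      by apply: ge_inf => //; exact: (proj2 infB).
    rewrite lerBlDr; exact: ltW.
  by rewrite lebesgue_measure_itv/= lte_fin ltrBlDr ltrDl e2 -EFinB lee_fin; lra.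
apply: (le_trans (leeD hA hB)).
rewrite addeACA -EFinD -splitr leeD2r//.
exact: brunn_minkowski_split.
Qed.

Let scaleVM (l x : R) : (0 < l)%R -> (l * (l^-1 * x + 0) = x)%R.
Proof. by move=> l0; rewrite addr0 mulrA mulfV ?gt_eqF// mul1r. Qed.

Lemma brunn_minkowski_conv (A B C : set RT) (k l : R) : (0 < l < 1)%R ->
  measurable A -> measurable B -> measurable C -> A !=set0 -> B !=set0 ->
  A `<=` `[(- k)%R, k] -> B `<=` `[(- k)%R, k] ->
  (forall x y, A x -> B y -> C ((1 - l) * x + l * y)%R) ->
  (1 - l)%:E * mu A + l%:E * mu B <= mu C.
Proof.
move=> /andP[l0 l1] mA mB mC [a Aa] [b Bb] Ak Bk ABC.
have l1' : (0 < 1 - l)%R by rewrite subr_gt0.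
have := @brunn_minkowski [set x : RT | A ((1 - l)^-1 * x + 0)%R]
  [set x : RT | B (l^-1 * x + 0)%R] C k.
rewrite !lebesgue_measure_affine ?invr_gt0// !invrK; apply => //.
- exact: measurable_affine_preimage.
- exact: measurable_affine_preimage.
- by exists ((1 - l) * a)%R; rewrite /= addr0 mulrA mulVf ?gt_eqF// mul1r.
- by exists (l * b)%R; rewrite /= addr0 mulrA mulVf ?gt_eqF// mul1r.
- move=> x /Ak /=; rewrite !in_itv/= -!ler_norml addr0 normrM.
  rewrite gtr0_norm ?invr_gt0// ler_pdivrMl// => h; apply: (le_trans h).
  have k0 : (0 <= k)%R.
    by have /= := Ak _ Aa; rewrite in_itv/= -ler_norml; exact: le_trans.
  by rewrite ler_piMl// gerBl ltW.
- move=> x /Bk /=; rewrite !in_itv/= -!ler_norml addr0 normrM.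
  rewrite gtr0_norm ?invr_gt0// ler_pdivrMl// => h; apply: (le_trans h).
  have k0 : (0 <= k)%R.
    by have /= := Ak _ Aa; rewrite in_itv/= -ler_norml; exact: le_trans.
  by rewrite ler_piMl// ltW.
- by move=> x y Ax By; rewrite -(scaleVM x l1') -(scaleVM y l0); exact: ABC.
Qed.

End brunn_minkowski.

(** * The Prekopa-Leindler inequality on the line *)

Section prekopa_leindler_1d.
Local Open Scope ereal_scope.
Context {R : realType}.
Notation mu := (@lebesgue_measure R).
Notation RT := (measurableTypeR R).
Variable l : R.
Hypothesis l01 : (0 < l < 1)%R.

Let l0 : (0 < l)%R. Proof. by case/andP : l01. Qed.
Let l1 : (0 < 1 - l)%R. Proof. by case/andP : l01 => _; rewrite subr_gt0. Qed.

Let measurable_gt (F : R -> \bar R) (t : R) : measurable_fun setT F ->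
  measurable ([set x | t%:E < F x] : set RT).
Proof. by move=> mF; apply: measurable_lte_set. Qed.

Let layerE (F : R -> \bar R) (t : R) :
  mu [set x | 0 < t%:E < F x] = if (0 < t)%R then mu [set x | t%:E < F x] else 0.
Proof.
case: ifPn => t0; first by congr (mu _); apply/seteqP; split => x /=;
  rewrite lte_fin t0.
rewrite (_ : [set x | _] = set0) ?measure0//.
by apply/seteqP; split => x //=; rewrite lte_fin (negbTE t0).
Qed.

(** With both suprema equal to 1, the level sets of [f] and [g] at height [t] are nonempty for the
    same [t], namely those below 1. Brunn-Minkowski then applies level by level and yields the
    arithmetic mean of the integrals. *)
Let PL_normalized (f g : R -> R) (h : R -> \bar R) (k : R) :
  measurable_fun setT f -> measurable_fun setT g -> measurable_fun setT h ->
  (forall x, 0 <= f x <= 1)%R -> (forall x, 0 <= g x <= 1)%R ->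
  (forall x, 0 <= h x) ->
  (forall x, f x != 0 -> - k <= x <= k)%R ->
  (forall x, g x != 0 -> - k <= x <= k)%R ->
  (forall t, t < 1 -> exists x, t < f x)%R ->
  (forall t, t < 1 -> exists x, t < g x)%R ->
  (forall x y, (f x `^ (1 - l) * g y `^ l)%:E <= h ((1 - l) * x + l * y)%R) ->
  (1 - l)%:E * \int[mu]_x (f x)%:E + l%:E * \int[mu]_x (g x)%:E <= \int[mu]_x h x.
Proof.
move=> mf mg mh f01 g01 h0 fk gk f1 g1 fgh.
have mEf : measurable_fun setT (EFin \o f) by exact/measurable_EFinP.
have mEg : measurable_fun setT (EFin \o g) by exact/measurable_EFinP.
have f0 x : 0 <= (f x)%:E by rewrite lee_fin; case/andP: (f01 x).
have g0 x : 0 <= (g x)%:E by rewrite lee_fin; case/andP: (g01 x).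
rewrite (layer_cake mEf)// (layer_cake mEg)// (layer_cake mh)//.
rewrite -ge0_integralZl_EFin ?(ltW l0) ?(ltW l1)//; last exact: measurable_layer.
rewrite -ge0_integralZl_EFin ?(ltW l0) ?(ltW l1)//; last exact: measurable_layer.
rewrite -ge0_integralD//; last 4 first.
- by move=> t _; rewrite mule_ge0// lee_fin ltW.
- by apply: measurable_funeM; exact: measurable_layer.
- by move=> t _; rewrite mule_ge0// lee_fin ltW.
- by apply: measurable_funeM; exact: measurable_layer.
apply: ge0_le_integral_nonmeasurable => t.
  by rewrite adde_ge0// mule_ge0// lee_fin ?(ltW l0) ?(ltW l1).
rewrite !layerE; case: ifPn => t0; last by rewrite !mule0 adde0.
have [t1|t1] := ltP t 1%R; last first.
  rewrite [X in _ * X + _](_ : _ = 0); last first.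
    rewrite (_ : [set x | _] = set0) ?measure0//; apply/seteqP; split => x //=.
    by rewrite lte_fin ltNge; case/andP: (f01 x) => _ /le_trans ->.
  rewrite [X in _ + _ * X](_ : _ = 0); last first.
    rewrite (_ : [set x | _] = set0) ?measure0//; apply/seteqP; split => x //=.
    by rewrite lte_fin ltNge; case/andP: (g01 x) => _ /le_trans ->.
  by rewrite !mule0 adde0.
apply: (@brunn_minkowski_conv _ _ _ _ k) => //; try exact: measurable_gt.
- by have [x fx] := f1 _ t1; exists x; rewrite /= lte_fin.
- by have [x gx] := g1 _ t1; exists x; rewrite /= lte_fin.
- move=> x /=; rewrite lte_fin in_itv/= => tf; apply: fk.
  by rewrite gt_eqF// (lt_trans t0).
- move=> x /=; rewrite lte_fin in_itv/= => tg; apply: gk.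
  by rewrite gt_eqF// (lt_trans t0).
- move=> x y /=; rewrite !lte_fin => tf tg; apply: lt_le_trans (fgh x y).
  (* The level is split as t = t^(1-l) t^l, to be compared factor by factor. *)
  rewrite lte_fin -[ltLHS]powRr1 ?ltW// -[X in (_ `^ X)%R](subrK l) powRD; last first.
    by rewrite subrK oner_eq0.
  by apply: ltr_pM; rewrite ?powR_ge0//; apply: gt0_ltr_powR => //;
    rewrite nnegrE ltW// (lt_trans t0).
Qed.

(** Dividing [f] and [g] by their suprema [a] and [b], and [h] by [c = a^(1-l) b^l], reduces to the
    normalized case; the arithmetic mean obtained there dominates the geometric one, and the
    scalings cancel. *)
Let PL_bounded (f g : R -> R) (h : R -> \bar R) (k : R) :
  measurable_fun setT f -> measurable_fun setT g -> measurable_fun setT h ->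
  (forall x, 0 <= f x <= k)%R -> (forall x, 0 <= g x <= k)%R ->
  (forall x, 0 <= h x) ->
  (forall x, f x != 0 -> - k <= x <= k)%R ->
  (forall x, g x != 0 -> - k <= x <= k)%R ->
  (forall x y, (f x `^ (1 - l) * g y `^ l)%:E <= h ((1 - l) * x + l * y)%R) ->
  (\int[mu]_x (f x)%:E) `^ (1 - l) * (\int[mu]_x (g x)%:E) `^ l <= \int[mu]_x h x.
Proof.
move=> mf mg mh f0k g0k h0 fk gk fgh.
have h1 : 0 <= \int[mu]_x h x by exact: integral_ge0.
have f0 x : (0 <= f x)%R by case/andP : (f0k x).
have g0 x : (0 <= g x)%R by case/andP : (g0k x).
have supf : has_sup (range f).
  by split; [exists (f 0%R), 0%R|exists k => _ [x _ <-]; case/andP : (f0k x)].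
have supg : has_sup (range g).
  by split; [exists (g 0%R), 0%R|exists k => _ [x _ <-]; case/andP : (g0k x)].
set a := sup (range f); set b := sup (range g).
have fa x : (f x <= a)%R by apply: sup_upper_bound => //; exists x.
have gb x : (g x <= b)%R by apply: sup_upper_bound => //; exists x.
have a0 : (0 <= a)%R := le_trans (f0 0%R) (fa 0%R).
have b0 : (0 <= b)%R := le_trans (g0 0%R) (gb 0%R).
have [aE|aN0] := eqVneq a 0%R.
  rewrite [X in X `^ _ * _](_ : _ = 0); last first.
    by apply: integral0_eq => x _; congr EFin; apply/eqP; rewrite eq_le f0 -aE fa.
  by rewrite (poweR0r (lt0r_neq0 l1)) mul0e.
have [bE|bN0] := eqVneq b 0%R.
  rewrite [X in _ * X `^ _](_ : _ = 0); last first.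
    by apply: integral0_eq => x _; congr EFin; apply/eqP; rewrite eq_le g0 -bE gb.
  by rewrite (poweR0r (lt0r_neq0 l0)) mule0.
have agt0 : (0 < a)%R by rewrite lt_neqAle eq_sym aN0.
have bgt0 : (0 < b)%R by rewrite lt_neqAle eq_sym bN0.
pose c := (a `^ (1 - l) * b `^ l)%R.
have c0 : (0 < c)%R by rewrite mulr_gt0// powR_gt0.
have cE : (c * (a^-1 `^ (1 - l) * b^-1 `^ l) = 1)%R.
  rewrite /c mulrACA -!powRM ?invr_ge0// !mulfV//.
  by rewrite !powR1 mulr1.
have intV (u : R -> R) (r : R) : measurable_fun setT u -> (forall x, 0 <= u x)%R ->
    (0 <= r)%R -> \int[mu]_x (r * u x)%:E = r%:E * \int[mu]_x (u x)%:E.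
  move=> mu0 u0 r0; rewrite -ge0_integralZl_EFin//.
  - by move=> x _; rewrite lee_fin.
  - exact/measurable_EFinP.
have := @PL_normalized (fun x => a^-1 * f x)%R (fun x => b^-1 * g x)%R
  (fun x => (c^-1)%:E * h x) k.
rewrite !intV ?invr_ge0// ge0_integralZl_EFin ?invr_ge0// ?(ltW c0)//.
have -> : (\int[mu]_x (f x)%:E) `^ (1 - l) * (\int[mu]_x (g x)%:E) `^ l =
  c%:E * (((a^-1)%:E * \int[mu]_x (f x)%:E) `^ (1 - l) *
          ((b^-1)%:E * \int[mu]_x (g x)%:E) `^ l).
  rewrite !poweRM ?lee_fin ?invr_ge0//; last 2 first.
  - by apply: integral_ge0 => x _; rewrite lee_fin.
  - by apply: integral_ge0 => x _; rewrite lee_fin.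
  by rewrite [in RHS]muleACA [RHS]muleA !poweR_EFin -!EFinM cE mul1e.
move=> PL; rewrite -lee_pdivlMl//; apply: le_trans (PL _ _ _ _ _ _ _ _ _ _ _).
- by apply: poweR_AGM => //; apply: mule_ge0; rewrite ?lee_fin ?invr_ge0//;
    apply: integral_ge0 => x _; rewrite lee_fin.
- exact: measurable_funM.
- exact: measurable_funM.
- exact: measurable_funeM.
- by move=> x; rewrite mulr_ge0 ?invr_ge0//= mulrC ler_pdivrMr// mul1r.
- by move=> x; rewrite mulr_ge0 ?invr_ge0//= mulrC ler_pdivrMr// mul1r.
- by move=> x; rewrite mule_ge0// lee_fin invr_ge0 ltW.
- by move=> x; rewrite mulf_eq0 negb_or => /andP[_]; exact: fk.
- by move=> x; rewrite mulf_eq0 negb_or => /andP[_]; exact: gk.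
- move=> t t1; have : (0 < a - t * a)%R by rewrite subr_gt0 gtr_pMl.
  move=> /sup_adherent /(_ supf) [_ [x _ <-]]; rewrite subKr => tf.
  by exists x; rewrite mulrC ltr_pdivlMr.
- move=> t t1; have : (0 < b - t * b)%R by rewrite subr_gt0 gtr_pMl.
  move=> /sup_adherent /(_ supg) [_ [x _ <-]]; rewrite subKr => tf.
  by exists x; rewrite mulrC ltr_pdivlMr.
- move=> x y; rewrite !powRM ?invr_ge0// mulrACA.
  by rewrite lee_pdivlMl// -EFinM [X in X%:E]mulrA cE mul1r.
Qed.

Let trunc (f : R -> \bar R) (n : nat) (x : R) : R :=
  (fine (mine (f x) n%:R%:E) * \1_`[(- n%:R)%R, n%:R] x)%R.

Let trunc_ge0 (f : R -> \bar R) (n : nat) (x : R) : (forall x, 0 <= f x) ->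
  0 <= mine (f x) n%:R%:E.
Proof. by move=> f0; rewrite le_min f0 lee_fin ler0n. Qed.

Let trunc_fin (f : R -> \bar R) (n : nat) (x : R) : (forall x, 0 <= f x) ->
  mine (f x) n%:R%:E \is a fin_num.
Proof.
by move=> f0; rewrite ge0_fin_numE ?trunc_ge0// gt_min ltry orbT.
Qed.

Let trunc_le f n x : (forall x, 0 <= f x) -> (trunc f n x)%:E <= f x.
Proof.
move=> f0; rewrite /trunc indicE; case: (_ \in _); last by rewrite mulr0.
by rewrite mulr1 fineK ?trunc_fin// ge_min lexx.
Qed.

Let trunc_bound f n x : (forall x, 0 <= f x) -> (0 <= trunc f n x <= n%:R)%R.
Proof.
move=> f0; rewrite /trunc indicE; case: (_ \in _); last by rewrite mulr0 lexx/=.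
rewrite mulr1 fine_ge0 ?trunc_ge0//= -lee_fin fineK ?trunc_fin//.
by rewrite ge_min lexx orbT.
Qed.

Let measurable_trunc f n : measurable_fun setT f -> measurable_fun setT (trunc f n).
Proof.
move=> mf; apply: measurable_funM; last exact: measurable_indic.
by apply: measurableT_comp => //; exact: measurable_mine.
Qed.

Let trunc_nd f x : (forall x, 0 <= f x) ->
  nondecreasing_seq (fun n => (trunc f n x)%:E).
Proof.
move=> f0 m n mn; rewrite lee_fin {1}/trunc indicE.
have [|_] := boolP (x \in _); last first.
  by rewrite mulr0; case/andP: (trunc_bound n x f0).
move=> /set_mem /=; rewrite in_itv/= mulr1 => /andP[h1 h2].
have mn' : (m%:R <= n%:R :> R)%R by rewrite ler_nat.
rewrite /trunc indicE mem_set/=; last first.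
  by rewrite in_itv/= (le_trans h2 mn') (le_trans _ h1)// lerN2.
rewrite mulr1 fine_le ?trunc_fin//.
by rewrite le_min ge_min lexx/= ge_min lee_fin mn' orbT.
Qed.

Let trunc_cvg f x : (forall x, 0 <= f x) -> (trunc f n x)%:E @[n --> \oo] --> f x.
Proof.
move=> f0.
have truncE n : (`|x| <= n%:R)%R -> (trunc f n x)%:E = mine (f x) n%:R%:E.
  move=> xn; rewrite /trunc indicE mem_set/= ?in_itv/= -?ler_norml//.
  by rewrite mulr1 fineK ?trunc_fin.
case E : (f x) (f0 x) => [r||//] r0.
  apply: cvg_near_cst; near=> n; rewrite truncE; last first.
    by near: n; exact: nbhs_infty_ger.
  rewrite E; apply: min_idPl; rewrite lee_fin.
  by near: n; exact: nbhs_infty_ger.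
apply/cvgeyPge => A; near=> n; rewrite truncE; last first.
  by near: n; exact: nbhs_infty_ger.
rewrite E le_min leey lee_fin/=.
by near: n; exact: nbhs_infty_ger.
Unshelve. all: by end_near. Qed.

(** [f] and [g] are cut off in height and in support. The two cut-off levels are sent to infinity
    one after the other, since [poweR_lim_le] handles one factor at a time; [h] stays as it is. *)
Lemma prekopa_leindler_1d (f g h : R -> \bar R) :
  measurable_fun setT f -> measurable_fun setT g -> measurable_fun setT h ->
  (forall x, 0 <= f x) -> (forall x, 0 <= g x) -> (forall x, 0 <= h x) ->
  (forall x y, f x `^ (1 - l) * g y `^ l <= h ((1 - l) * x + l * y)%R) ->
  (\int[mu]_x f x) `^ (1 - l) * (\int[mu]_x g x) `^ l <= \int[mu]_x h x.
Proof.
move=> mf mg mh f0 g0 h0 fgh.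
have cv (u : R -> \bar R) : measurable_fun setT u -> (forall x, 0 <= u x) ->
    (\int[mu]_x (trunc u n x)%:E) @[n --> \oo] --> \int[mu]_x u x.
  move=> mu0 u0; rewrite (_ : (\int[mu]_x u x) =
      \int[mu]_x limn (fun n => (trunc u n x)%:E)); last first.
    by apply: eq_integral => x _; apply/esym/cvg_lim => //; exact: trunc_cvg.
  apply: cvg_monotone_convergence => //.
  - by move=> n; apply/measurable_EFinP; exact: measurable_trunc.
  - by move=> n x _; rewrite lee_fin; case/andP : (trunc_bound n x u0).
  - by move=> x _; exact: trunc_nd.
have int0 (u : R -> \bar R) n : (forall x, 0 <= u x) ->
    0 <= \int[mu]_x (trunc u n x)%:E.
  by move=> u0; apply: integral_ge0 => x _; rewrite lee_fin;
    case/andP : (trunc_bound n x u0).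
apply: (poweR_lim_le l1 (int0 f ^~ f0) (cv f mf f0)); first exact: poweR_ge0.
move=> n; rewrite muleC.
apply: (poweR_lim_le l0 (int0 g ^~ g0) (cv g mg g0)); first exact: poweR_ge0.
move=> m; rewrite muleC.
have trunc_supp (u : R -> \bar R) k N x : (k <= N)%N ->
    (trunc u k x != 0 -> - N%:R <= x <= N%:R)%R.
  rewrite -(ler_nat R) /trunc indicE => kN.
  have [|_] := boolP (x \in _); last by rewrite mulr0 eqxx.
  move=> /set_mem /=; rewrite in_itv/= => /andP[h1 h2] _.
  by rewrite (le_trans h2 kN) (le_trans _ h1)// lerN2.
have trunc_b (u : R -> \bar R) k N x : (k <= N)%N -> (forall x, 0 <= u x) ->
    (0 <= trunc u k x <= N%:R)%R.
  rewrite -(ler_nat R) => kN u0; have /andP[-> uk] := trunc_bound k x u0.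
  exact: le_trans kN.
apply: (@PL_bounded _ _ _ (maxn n m)%:R) => //.
- exact: measurable_trunc.
- exact: measurable_trunc.
- by move=> x; apply: trunc_b => //; rewrite leq_maxl.
- by move=> x; apply: trunc_b => //; rewrite leq_maxr.
- by move=> x; apply: trunc_supp; rewrite leq_maxl.
- by move=> x; apply: trunc_supp; rewrite leq_maxr.
- move=> x y; apply: le_trans (fgh x y); rewrite EFinM -!poweR_EFin.
  apply: lee_pmul; rewrite ?poweR_ge0//; apply: le_poweR; rewrite ?(ltW l0) ?(ltW l1)//.
  + by rewrite lee_fin; case/andP : (trunc_bound n x f0).
  + exact: trunc_le.
  + by rewrite lee_fin; case/andP : (trunc_bound m y g0).
  + exact: trunc_le.
Qed.

End prekopa_leindler_1d.

(** * Lebesgue measure on row vectors *)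

Section lebesgue_rV_theory.
Local Open Scope ereal_scope.
Context {R : realType}.
Notation mu := (@lebesgue_measure R).
Notation RT := (measurableTypeR R).

Section cons.
Variables (n : nat) (F : 'rV[R]_n.+1 -> \bar R).
Hypotheses (mF : measurable_fun setT F) (F0 : forall x, 0 <= F x).

Lemma measurable_rV_cons_comp :
  measurable_fun setT (fun z : RT * 'rV[R]_n => F (rV_cons z)).
Proof. exact: (measurableT_comp mF (@measurable_rV_cons R n)). Qed.

Lemma measurable_rV_cons_slice t :
  measurable_fun setT (fun x : 'rV[R]_n => F (rV_cons (t, x))).
Proof.
exact: (measurableT_comp measurable_rV_cons_comp (pair1_measurable t)).
Qed.

Lemma measurable_integral_rV_cons :
  measurable_fun setT (fun t : RT => \int[@lebesgue_rV R n]_x F (rV_cons (t, x))).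
Proof.
apply: (measurable_fun_fubini_tonelli_F (fun z : RT * 'rV[R]_n => F (rV_cons z))).
- exact: measurable_rV_cons_comp.
- by move=> z; exact: F0.
Qed.

Lemma ge0_integral_rV_cons : \int[@lebesgue_rV R n.+1]_x F x =
  \int[mu]_t \int[@lebesgue_rV R n]_x F (rV_cons (t, x)).
Proof.
pose f (z : RT * 'rV[R]_n) := F (rV_cons z).
transitivity (\int[mu \x @lebesgue_rV R n]_z f z).
  rewrite -(preimage_setT (@rV_cons R n)) /f.
  by rewrite -(@ge0_integral_pushforward _ _ _ _ _ (@rV_cons R n)
    (@measurable_rV_cons R n) (mu \x @lebesgue_rV R n) setT F)//.
apply: (fubini_tonelli1 f); first exact: measurable_rV_cons_comp.
by move=> z; exact: F0.
Qed.

End cons.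

Lemma integral_rV0 (F : 'rV[R]_0 -> \bar R) :
  measurable_fun setT F -> \int[@lebesgue_rV R 0]_x F x = F 0%R.
Proof. by move=> mF; rewrite /= integral_dirac// diracT mul1e. Qed.

Lemma rV_cons_conv n (a b s t : R) (x y : 'rV[R]_n) :
  rV_cons (a * s + b * t, a *: x + b *: y)%R =
  (a *: rV_cons (s : RT, x) + b *: rV_cons (t : RT, y))%R.
Proof.
by apply/rowP => i; case: (unliftP ord0 i) => [j ->|->];
  rewrite !mxE ?liftK ?unlift_none/= ?mxE.
Qed.

(** Induction on the dimension: the inequality for slices is exactly the pointwise hypothesis of the
    one-dimensional inequality for the slice integrals. *)
Lemma prekopa_leindler n (l : R) (f g h : 'rV[R]_n -> \bar R) : (0 < l < 1)%R ->
  measurable_fun setT f -> measurable_fun setT g -> measurable_fun setT h ->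
  (forall x, 0 <= f x) -> (forall x, 0 <= g x) -> (forall x, 0 <= h x) ->
  (forall x y, f x `^ (1 - l) * g y `^ l <= h ((1 - l) *: x + l *: y)%R) ->
  (\int[@lebesgue_rV R n]_x f x) `^ (1 - l) *
  (\int[@lebesgue_rV R n]_x g x) `^ l <= \int[@lebesgue_rV R n]_x h x.
Proof.
move=> l01; elim: n f g h => [|n IH] f g h mf mg mh f0 g0 h0 fgh.
  rewrite !integral_rV0//.
  by have := fgh 0%R 0%R; rewrite !scaler0 addr0.
rewrite !ge0_integral_rV_cons//.
apply: prekopa_leindler_1d => //.
- exact: measurable_integral_rV_cons.
- exact: measurable_integral_rV_cons.
- exact: measurable_integral_rV_cons.
- by move=> t; exact: integral_ge0.
- by move=> t; exact: integral_ge0.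
- by move=> t; exact: integral_ge0.
move=> s t; apply: IH => //.
- exact: measurable_rV_cons_slice.
- exact: measurable_rV_cons_slice.
- exact: measurable_rV_cons_slice.
by move=> x y; rewrite rV_cons_conv.
Qed.

Definition flip_row n (i : 'I_n) (x : 'rV[R]_n) : 'rV[R]_n :=
  \row_k (if k == i then - x ord0 k else x ord0 k)%R.

Lemma map_rV_cons n (th : R -> R) (t : R) (x : 'rV[R]_n) :
  map_mx th (rV_cons (t : RT, x)) = rV_cons (th t : RT, map_mx th x).
Proof.
by apply/rowP => i; case: (unliftP ord0 i) => [j ->|->];
  rewrite !mxE ?liftK ?unlift_none/= ?mxE.
Qed.

Lemma flip_row0_cons n (t : R) (x : 'rV[R]_n) :
  flip_row ord0 (rV_cons (t : RT, x)) = rV_cons ((- t)%R : RT, x).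
Proof.
by apply/rowP => i; case: (unliftP ord0 i) => [j ->|->];
  rewrite !mxE ?liftK ?unlift_none/= ?mxE.
Qed.

Lemma flip_rowS_cons n (i : 'I_n) (t : R) (x : 'rV[R]_n) :
  flip_row (lift ord0 i) (rV_cons (t : RT, x)) = rV_cons (t : RT, flip_row i x).
Proof.
apply/rowP => k; case: (unliftP ord0 k) => [j ->|->];
  rewrite !mxE ?liftK ?unlift_none/= ?mxE//.
Qed.

Lemma measurable_map_rV n (th : R -> R) : measurable_fun setT th ->
  measurable_fun setT (fun x : 'rV[R]_n => map_mx th x).
Proof.
move=> mth; apply: measurable_fun_rV => i.
rewrite (_ : _ \o _ = th \o rV_coord i).
  exact: (measurableT_comp mth (measurable_rV_coord i)).
by apply/funext => x; rewrite /= /rV_coord mxE.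
Qed.

Lemma measurable_prod_rV n (j : R -> R) : measurable_fun setT j ->
  measurable_fun setT (fun x : 'rV[R]_n => \prod_i j (x ord0 i))%R.
Proof.
move=> mj; apply: measurable_prod => i _.
exact: (measurableT_comp mj (measurable_rV_coord i)).
Qed.

(** The flag [b] covers two kinds of substitution at once: when it is true, the one-dimensional
    formula is available for even functions only, and [F] must be invariant under every coordinate
    reflection. The exponential substitution is of that kind. *)
Lemma ge0_integral_map_rV n (b : bool) (th j : R -> R) (F : 'rV[R]_n -> \bar R) :
  measurable_fun setT th -> measurable_fun setT j -> (forall t, 0 <= j t)%R ->
  (forall f : R -> \bar R, measurable_fun setT f -> (forall t, 0 <= f t) ->
    (b -> forall t, f (- t)%R = f t) ->
    \int[mu]_t (f (th t) * (j t)%:E) = \int[mu]_t f t) ->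
  measurable_fun setT F -> (forall x, 0 <= F x) ->
  (b -> forall i x, F (flip_row i x) = F x) ->
  \int[@lebesgue_rV R n]_x (F (map_mx th x) * (\prod_i j (x ord0 i))%:E) =
  \int[@lebesgue_rV R n]_x F x.
Proof.
move=> mth mj j0 sub.
elim: n F => [|n IH] F mF F0 Fb.
  rewrite !integral_rV0//.
    rewrite big_ord0 mule1; congr F; by apply/rowP => -[].
  apply: emeasurable_funM; first exact: (measurableT_comp mF (measurable_map_rV mth)).
  by apply/measurable_EFinP; exact: measurable_prod_rV.
rewrite !ge0_integral_rV_cons//; last 2 first.
- apply: emeasurable_funM; first exact: (measurableT_comp mF (measurable_map_rV mth)).
  by apply/measurable_EFinP; exact: measurable_prod_rV.
- by move=> x; rewrite mule_ge0// lee_fin prodr_ge0.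
rewrite -[RHS]sub; last 3 first.
- exact: measurable_integral_rV_cons.
- by move=> t; exact: integral_ge0.
- by move=> /Fb Fb' t; apply: eq_integral => x _; rewrite -flip_row0_cons Fb'.
apply: eq_integral => t _.
rewrite -[in RHS]IH; last 3 first.
- exact: measurable_rV_cons_slice.
- by move=> x.
- by move=> /Fb Fb' i x; rewrite -flip_rowS_cons Fb'.
rewrite muleC -ge0_integralZl_EFin//.
- apply: eq_integral => x _; rewrite map_rV_cons big_ord_recl rV_cons0/=.
  under eq_bigr do rewrite rV_consS.
  by rewrite EFinM muleCA.
- by move=> x _; rewrite mule_ge0// lee_fin prodr_ge0.
- apply: emeasurable_funM.
    exact: (measurableT_comp (measurable_rV_cons_slice _ _) (measurable_map_rV mth)).
  by apply/measurable_EFinP; exact: measurable_prod_rV.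
Qed.

End lebesgue_rV_theory.

(** * Null hyperplanes, uniqueness and permutations of coordinates *)

Section lebesgue_rV_invariance.
Local Open Scope ereal_scope.
Context {R : realType}.
Notation mu := (@lebesgue_measure R).
Notation RT := (measurableTypeR R).

(** Coordinate hyperplanes are null. This is read off from [ge0_integral_map_rV] with the identity
    map and, as density, the indicator of the complement of 0. *)
Lemma eq_integral_rV_neq0 n (F G : 'rV[R]_n -> \bar R) :
  measurable_fun setT F -> measurable_fun setT G ->
  (forall x, 0 <= F x) -> (forall x, 0 <= G x) ->
  (forall x : 'rV[R]_n, (forall i, x ord0 i != 0%R) -> F x = G x) ->
  \int[@lebesgue_rV R n]_x F x = \int[@lebesgue_rV R n]_x G x.
Proof.
move=> mF mG F0 G0 FG.
have mne0 : measurable (~` [set 0%R] : set RT) by apply: measurableC.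
have E (H : 'rV[R]_n -> \bar R) : measurable_fun setT H -> (forall x, 0 <= H x) ->
    \int[@lebesgue_rV R n]_x
      (H x * (\prod_i \1_(~` [set 0%R] : set RT) (x ord0 i))%:E) =
    \int[@lebesgue_rV R n]_x H x.
  move=> mH H0.
  rewrite -[RHS](@ge0_integral_map_rV R n false id (\1_(~` [set 0%R] : set RT)))//.
    by apply: eq_integral => x _; rewrite map_mx_id.
  move=> f mf f0 _; transitivity (\int[mu]_(t in [set: RT] `\ 0%R) f t).
    rewrite [RHS]integral_mkcond; apply: eq_integral => t _.
    by rewrite patchE indicE setTD; case: ifPn; rewrite ?mule1 ?mule0.
  by apply: integral_setD1; [rewrite setTD|exact: measurable_funTS].
rewrite -(E F)// -(E G)//; apply: eq_integral => x _.
have [x0|/existsNP [i]] := pselect (forall i, x ord0 i != 0%R).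
  by rewrite FG.
move=> /negP; rewrite negbK => /eqP xi.
have -> : (\prod_i \1_(~` [set 0%R] : set RT) (x ord0 i) = 0 :> R)%R.
  by apply/eqP/prodf_eq0; exists i => //; rewrite indicE memNset//= xi; apply.
by rewrite !mule0.
Qed.

Let box n (A : 'I_n -> set RT) := [set x : 'rV[R]_n | forall i, A i (x ord0 i)].

Let measurable_box n (A : 'I_n -> set RT) : (forall i, measurable (A i)) ->
  measurable (box A).
Proof.
move=> mA; rewrite (_ : box A =
    \bigcap_(i in [set: 'I_n]) (rV_coord i @^-1` A i)).
  apply: fin_bigcap_measurable => // i _.
  by rewrite -[X in measurable X]setTI; exact: measurable_rV_coord.
by apply/seteqP; split => [x + i _|x + i]; [exact|apply].
Qed.

Let boxes n : set (set 'rV[R]_n) :=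
  [set B | exists2 A : 'I_n -> set RT, (forall i, measurable (A i)) & B = box A].

Let boxesE n : (@measurable _ 'rV[R]_n) = <<s @boxes n>>.
Proof.
apply/seteqP; split => B.
  apply: smallest_sub; first exact: smallest_sigma_algebra.
  rewrite -bigcup_seq; apply: bigcup_sub => i _ C [D mD <-].
  rewrite setTI; apply: sub_sigma_algebra.
  exists (fun k => if k == i then D else setT); first by move=> k; case: ifP.
  apply/seteqP; split => x /=; last by move=> /(_ i); rewrite eqxx.
  by move=> Dx k; case: eqP => // ->.
apply: smallest_sub; first exact: sigma_algebra_measurable.
by move=> _ [A mA ->]; exact: measurable_box.
Qed.

Lemma lebesgue_rV_unique n (m : {measure set 'rV[R]_n -> \bar R}) :
  (forall A : 'I_n -> set RT, (forall i, measurable (A i)) ->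
    m [set x : 'rV[R]_n | forall i, A i (x ord0 i)] =
    \prod_i lebesgue_measure (A i)) ->
  forall B, measurable B -> @lebesgue_rV R n B = m B.
Proof.
move=> mbox B mB.
pose g (k : nat) := box (fun _ : 'I_n => `[(- k%:R)%R, k%:R]%classic : set RT).
apply: (measure_unique (@boxes n) g) => //.
- exact: boxesE.
- move=> _ _ [A mA ->] [A' mA' ->]; exists (fun i => A i `&` A' i).
    by move=> i; exact: measurableI.
  by apply/seteqP; split => [x [h h'] i|x h]; split => // i; case: (h i).
- by move=> k; exists (fun _ => `[(- k%:R)%R, k%:R]%classic).
- apply/seteqP; split => // x _.
  have [k kP] : exists k : nat, (\sum_i `|x ord0 i| <= k%:R)%R.
    by exists (Num.truncn (\sum_i `|x ord0 i|)).+1; apply/ltW; exact: truncnS_gt.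
  exists k => // i /=; rewrite in_itv/= -ler_norml; apply: le_trans kP.
  by rewrite (bigD1 i)//= lerDl sumr_ge0.
- by move=> _ [A mA ->]; rewrite mbox//; exact: lebesgue_rV_box.
- move=> k; rewrite [X in X < _](lebesgue_rV_box)//.
  rewrite ltey_eq prode_fin_num// => i _.
  by rewrite lebesgue_measure_itv/=; case: ifP.
Qed.

Definition perm_row n (s : {perm 'I_n}) (x : 'rV[R]_n) : 'rV[R]_n :=
  \row_i x ord0 (s i).

Lemma measurable_perm_row n (s : {perm 'I_n}) : measurable_fun setT (@perm_row n s).
Proof.
apply: measurable_fun_rV => i; rewrite (_ : _ \o _ = rV_coord (s i)).
  exact: measurable_rV_coord.
by apply/funext => x; rewrite /= /rV_coord mxE.
Qed.

Lemma ge0_integral_perm_row n (s : {perm 'I_n}) (F : 'rV[R]_n -> \bar R) :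
  measurable_fun setT F -> (forall x, 0 <= F x) ->
  \int[@lebesgue_rV R n]_x F (perm_row s x) = \int[@lebesgue_rV R n]_x F x.
Proof.
move=> mF F0.
transitivity (\int[@lebesgue_rV R n]_x (F (perm_row s x) * (cst 1%R x)%:E)).
  by apply: eq_integral => x _; rewrite mule1.
apply: (@ge0_integral_image_density _ _ _ _ _ (@lebesgue_rV R n)) => //.
  exact: measurable_perm_row.
pose m := image_measure (@lebesgue_rV R n) (@measurable_perm_row n s)
  (measurable_cst (1%R : R)) (fun=> ler01).
apply: (@lebesgue_rV_unique n m) => A mA; rewrite /m /image_measure/=.
rewrite [RHS](reindex_inj (@perm_inj _ s^-1%g))/=.
rewrite -lebesgue_rV_box//.
rewrite -[X in _ = lebesgue_rV X]setIT -integral_indic//; last first.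
  exact: (measurable_box (fun i => mA _)).
apply: eq_integral => x _; rewrite mule1; congr EFin; apply: eq_indic => /=.
split=> h i; last by rewrite mxE; have := h (s i); rewrite permK.
by have := h ((s^-1)%g i); rewrite mxE permKV.
Qed.

End lebesgue_rV_invariance.

(** * Semicontinuity and measurability *)

Section semicontinuity.
Local Open Scope ereal_scope.
Context {R : realType} {n : nat}.
Implicit Types (x y : 'rV[R]_n) (Phi : 'rV[R]_n -> \bar R).

Definition near_row (e : R) x y := forall i, (`|y ord0 i - x ord0 i| < e)%R.

Definition box_open (U : set 'rV[R]_n) :=
  forall x, U x -> exists2 e, (0 < e)%R & forall y, near_row e x y -> U y.

Lemma measurable_near_row e x : measurable (near_row e x).
Proof.
rewrite (_ : near_row e x =
    \bigcap_(i in [set: 'I_n]) (rV_coord i @^-1` ball (x ord0 i) e)).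
  apply: fin_bigcap_measurable => // i _.
  rewrite -[X in measurable X]setTI; apply: measurable_rV_coord => //.
  exact: measurable_ball.
by apply/seteqP; split => [y yx i _|y yx i]; rewrite /ball/= distrC;
  [exact: yx|exact: (yx i Logic.I)].
Qed.

(** [U] is the union of the countably many boxes it contains that have a rational centre and radius
    1/(k+1). Around a point with margin [e] a radius below [e / 2] suffices, half of the margin
    being spent on moving the centre. *)
Lemma box_open_measurable (U : set 'rV[R]_n) : box_open U -> measurable U.
Proof.
move=> oU.
pose c (z : 'rV[rat]_n) : 'rV[R]_n := map_mx ratr z.
pose B (zk : 'rV[rat]_n * nat) : set 'rV[R]_n :=
  if `[< near_row zk.2.+1%:R^-1 (c zk.1) `<=` U >]
  then near_row zk.2.+1%:R^-1 (c zk.1) else set0.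
rewrite (_ : U = \bigcup_zk B zk).
  apply: countable_bigcupT_measurable; first exact: countableP.
  by move=> zk; rewrite /B; case: asboolP => // _; exact: measurable_near_row.
apply/seteqP; split => [x Ux|x [zk _]]; last first.
  by rewrite /B; case: asboolP => // h /h.
have [e e0 eU] := oU x Ux.
have [k] := ltr_add_invr (divr_gt0 e0 (ltr0n R 2)); rewrite add0r => ke.
have k0 : (0 < k.+1%:R^-1 :> R)%R by rewrite invr_gt0.
have q i : {q : rat | (`|ratr q - x ord0 i| < k.+1%:R^-1)%R}.
  apply: cid; have [|q] := @rat_in_itvoo R (x ord0 i - k.+1%:R^-1)
    (x ord0 i + k.+1%:R^-1).
    by rewrite ltrBlDr -addrA ltrDl addr_gt0.
  by rewrite in_itv/= => qx; exists q; rewrite ltr_distl.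
pose z : 'rV[rat]_n := \row_i sval (q i).
have zx i : (`|c z ord0 i - x ord0 i| < k.+1%:R^-1)%R.
  by rewrite !mxE; exact: (svalP (q i)).
exists (z, k) => //; rewrite /B; case: asboolP => [_ i|]; first by rewrite distrC.
case=> y yz; apply: eU => i.
rewrite -(subrK (c z ord0 i) (y ord0 i)) -addrA (le_lt_trans (ler_normD _ _))//.
by rewrite (splitr e) ltrD// (lt_trans _ ke)// ?zx// yz.
Qed.

(** Upper rather than lower semicontinuity, because it is the kind that survives the infimum over
    shifts in the symmetrization. *)
Definition usc Phi := forall a : R, box_open [set x | Phi x < a%:E].

Lemma measurable_usc Phi : usc Phi -> measurable_fun setT Phi.
Proof.
move=> uPhi; apply: (measurability _ (ErealGenInftyO.measurableE R)).
move=> _ [_ [a ->] <-]; rewrite setTI.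
by apply: box_open_measurable; exact: uPhi.
Qed.

(** A supremum of affine functions of [y] is lower semicontinuous. The radius is the available
    margin divided by the l1 norm of the witness [x] plus 1, the 1 preventing a division by zero. *)
Lemma box_open_legendre_gt Phi (a : R) : box_open [set y | a%:E < legendre Phi y].
Proof.
move=> y /= /ereal_sup_gt[_ [x _ <-]].
case Ex : (Phi x) => [r||] // ayx; last first.
  exists 1%R => // y' _; apply: lt_le_trans (_ : +oo <= _); first exact: ltry.
  by apply: ereal_sup_ubound; exists x => //; rewrite Ex.
pose s := (\sum_i `|x ord0 i| + 1)%R.
have s0 : (0 < s)%R by rewrite ltr_wpDl// sumr_ge0.
rewrite -EFinB lte_fin -subr_gt0 in ayx.
exists ((dotrV x y - r - a) / s)%R; first by rewrite divr_gt0.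
move=> y' yy'; apply: (@lt_le_trans _ _ ((dotrV x y')%:E - Phi x)); last first.
  by apply: ereal_sup_ubound; exists x.
rewrite Ex -EFinB lte_fin.
have : (`|dotrV x y' - dotrV x y| < dotrV x y - r - a)%R.
  rewrite /dotrV -sumrB; apply: le_lt_trans (ler_norm_sum _ _ _) _.
  set e := ((dotrV x y - r - a) / s)%R in yy'.
  have e0 : (0 < e)%R by rewrite divr_gt0.
  have -> : (\sum_i x ord0 i * y ord0 i - r - a = e * s)%R by rewrite /e divfK ?gt_eqF.
  apply: (@le_lt_trans _ _ (\sum_i `|x ord0 i| * e)%R).
    by apply: ler_sum => i _; rewrite -mulrBr normrM ler_wpM2l// ltW.
  by rewrite -mulr_suml mulrC ltr_pM2l// ltrDl.
rewrite ltr_distl => /andP[+ _]; lra.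
Qed.

Lemma measurable_legendre Phi : measurable_fun setT (legendre Phi).
Proof.
apply: (measurability _ (ErealGenOInfty.measurableE R)).
move=> _ [_ [a ->] <-]; rewrite setTI.
rewrite (_ : _ @^-1` _ = [set y | a%:E < legendre Phi y]).
  by apply: box_open_measurable; exact: box_open_legendre_gt.
by apply/seteqP; split => y /=; rewrite in_itv/= andbT.
Qed.

End semicontinuity.

(** * Signed powers *)

Section signed_power.
Context {R : realType}.
Implicit Types (r s t u : R).

Definition spow r t : R := Num.sg t * `|t| `^ r.

Lemma spow0 r : spow r 0 = 0. Proof. by rewrite /spow sgr0 mul0r. Qed.

Lemma spowN r t : spow r (- t) = - spow r t.
Proof. by rewrite /spow sgrN normrN mulNr. Qed.

Lemma spow_gt0 r t : 0 < t -> spow r t = t `^ r.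
Proof. by move=> t0; rewrite /spow gtr0_sg// gtr0_norm// mul1r. Qed.

Lemma spow_ge0 r t : 0 < r -> 0 <= t -> spow r t = t `^ r.
Proof.
move=> r0; rewrite le_eqVlt => /predU1P[<-|]; last exact: spow_gt0.
by rewrite spow0 powR0 ?gt_eqF.
Qed.

Lemma norm_spow r t : 0 < r -> `|spow r t| = `|t| `^ r.
Proof.
move=> r0; have [->|t0] := eqVneq t 0; first by rewrite spow0 normr0 powR0 ?gt_eqF.
by rewrite normrM normr_sg t0 mul1r ger0_norm ?powR_ge0.
Qed.

Lemma spowK r t : 0 < r -> spow r (spow r^-1 t) = t.
Proof.
move=> r0; wlog t0 : t / 0 < t => [H|].
  have [|t0|<-] := ltgtP 0 t; [exact: H| |by rewrite !spow0].
  by apply: oppr_inj; rewrite -!spowN H// oppr_gt0.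
by rewrite !spow_gt0 ?powR_gt0// -powRrM mulVf ?gt_eqF// powRr1// ltW.
Qed.

Lemma spowZ r s t : 0 < s -> spow r (s * t) = s `^ r * spow r t.
Proof.
move=> s0; rewrite /spow sgrM gtr0_sg// mul1r normrM gtr0_norm//.
by rewrite powRM ?(ltW s0)// mulrCA.
Qed.

Lemma spow_lt r : 0 < r -> {homo spow r : t u / t < u}.
Proof.
move=> r0.
have pos t u : 0 <= t -> t < u -> spow r t < spow r u.
  move=> t0 tu; rewrite !spow_ge0//; last by rewrite ltW// (le_lt_trans t0).
  by apply: gt0_ltr_powR; rewrite // nnegrE// ltW// (le_lt_trans t0).
move=> t u tu; have [t0|t0] := leP 0 t; first exact: pos.
have [u0|u0] := leP u 0.
  by rewrite -[ltLHS]opprK -[ltRHS]opprK ltrN2 -!spowN pos ?ltrN2// oppr_ge0.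
apply: (@lt_trans _ _ 0); last by rewrite spow_gt0// powR_gt0.
by rewrite -[ltLHS]opprK oppr_lt0 -spowN spow_gt0 ?powR_gt0// oppr_gt0.
Qed.

Lemma powR_norm_homo r t u : 0 <= r -> `|t| <= `|u| -> `|t| `^ r <= `|u| `^ r.
Proof. by move=> r0 tu; apply: ge0_ler_powR; rewrite // nnegrE. Qed.

Lemma continuous_norm_powR r : 0 <= r -> continuous (fun t => `|t| `^ r).
Proof.
rewrite le_eqVlt => /predU1P[<-|r0] t.
  (* For exponent 0 the convention 0^0 = 1 makes the function constant, hence continuous at 0 as
     well. *)
  rewrite (_ : (fun t => _) = cst 1); first exact: cvg_cst.
  by apply/funext => u; rewrite powRr0.
have [->|t0] := eqVneq t 0; last first.
  have nt0 : 0 < `|t| by rewrite normr_gt0.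
  apply: (@continuous_comp _ _ _ (@Num.norm _ R) (fun u => u `^ r)).
    exact: norm_continuous.
  apply: differentiable_continuous; apply/derivable1_diffP.
  by apply: derivable_powR; rewrite in_itv/= nt0.
rewrite /prop_for /continuous_at normr0 powR0 ?gt_eqF//.
apply/cvgr0Pnorm_lt => e e0.
have d0 : 0 < e `^ r^-1 by rewrite powR_gt0.
near=> u; rewrite ger0_norm ?powR_ge0//.
rewrite -[ltRHS]powRr1 ?ltW// -(mulVf (lt0r_neq0 r0)) powRrM.
apply: gt0_ltr_powR; rewrite ?nnegrE ?powR_ge0//.
Unshelve. all: by end_near. Qed.

Lemma cvg_norm_powR0 r : 0 < r -> `|h| `^ r @[h --> (0 : R)^'] --> (0 : R).
Proof.
move=> r0; have := @continuous_norm_powR r (ltW r0) 0.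
rewrite /prop_for /continuous_at normr0 powR0 ?gt_eqF// => H.
by apply: cvg_trans H; apply: cvg_app; exact: cvg_within.
Qed.

Lemma is_derive_oppr_comp (f : R -> R) t d : is_derive (- t) (1 : R) f d ->
  is_derive t (1 : R) (fun u => f (- u)) (- d).
Proof.
move=> df; have : is_derive t (1 : R) (f \o -%R) (d * -1).
  by apply: is_derive1_comp; exact: is_deriveNid.
by rewrite mulrN1.
Qed.

Lemma norm_powR_pred r t : t != 0 -> `|t| `^ r = `|t| `^ (r - 1) * `|t|.
Proof.
move=> t0; rewrite -[X in _ = _ * X]powRr1// -powRD ?subrK//.
by rewrite normr_eq0 t0 implybT.
Qed.

(** Oddness reduces negative [t] to positive [t]. At 0 the difference quotient is |h|^(r-1), which
    tends to 0 for r > 1 and equals 1 for r = 1, in agreement with 0^0 = 1. *)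
Lemma is_derive_spow r t : 1 <= r ->
  is_derive t (1 : R) (spow r) (r * `|t| `^ (r - 1)).
Proof.
move=> r1; have r0 : 0 < r by exact: lt_le_trans r1.
have pos u : 0 < u -> is_derive u (1 : R) (spow r) (r * `|u| `^ (r - 1)).
  move=> u0; rewrite gtr0_norm//.
  apply: (@near_eq_is_derive _ _ _ (fun v => v `^ r)).
    by near=> v; rewrite spow_gt0//; near: v; exact: lt_nbhsr.
  exact: is_derive1_powR.
have [|t0|<-] := ltgtP 0 t; first exact: pos.
  rewrite (_ : spow r = fun u => - spow r (- u)); last first.
    by apply/funext => u; rewrite spowN opprK.
  rewrite -normrN -[X in is_derive _ _ _ X]opprK.
  apply: is_deriveN; apply: is_derive_oppr_comp; apply: pos.
  by rewrite oppr_gt0.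
have : h^-1 *: ((spow r \o shift 0) (h *: (1 : R)) - spow r 0) @[h --> 0^'] -->
    r * `|0 : R| `^ (r - 1).
  have E : {near 0^', (fun h => `|h| `^ (r - 1)) =1
      (fun h => h^-1 *: ((spow r \o shift 0) (h *: (1 : R)) - spow r 0))}.
    near=> h; have h0 : h != 0 by near: h; exact: nbhs_dnbhs_neq.
    rewrite spow0 subr0 /= addr0 /GRing.scale/= mulr1 /spow.
    rewrite [`|h| `^ r](norm_powR_pred r h0) [Num.sg h * _]mulrCA -numEsg.
    by rewrite mulrCA mulVf ?mulr1.
  apply: (cvg_trans (near_eq_cvg E)).
  have [rE|rN1] := eqVneq r 1.
    rewrite rE subrr powRr0 mulr1 (_ : (fun h => _) = cst 1); first exact: cvg_cst.
    by apply/funext => h; rewrite powRr0.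
  have r1' : 0 < r - 1 by rewrite subr_gt0 lt_neqAle eq_sym rN1.
  by rewrite normr0 powR0 ?gt_eqF// mulr0; exact: cvg_norm_powR0.
by move=> H; split; [exact: cvgP H|exact: cvg_lim H].
Unshelve. all: by end_near. Qed.

Lemma is_derive_norm_powR r t : 1 < r ->
  is_derive t (1 : R) (fun u => `|u| `^ r) (r * spow (r - 1) t).
Proof.
move=> r1; have r0 : 0 < r by exact: lt_trans r1.
have r1' : 0 < r - 1 by rewrite subr_gt0.
have pos u : 0 < u -> is_derive u (1 : R) (fun u => `|u| `^ r) (r * spow (r - 1) u).
  move=> u0; rewrite spow_gt0//.
  apply: (@near_eq_is_derive _ _ _ (fun v => v `^ r)).
    by near=> v; rewrite gtr0_norm//; near: v; exact: lt_nbhsr.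
  exact: is_derive1_powR.
have [|t0|<-] := ltgtP 0 t; first exact: pos.
  rewrite (_ : (fun u => _) = fun u => `|- u| `^ r); last first.
    by apply/funext => u; rewrite normrN.
  rewrite -[t in spow _ t]opprK spowN mulrN.
  apply: (@is_derive_oppr_comp (fun u => `|u| `^ r)); apply: pos.
  by rewrite oppr_gt0.
rewrite spow0 mulr0.
have : h^-1 *: (((fun u => `|u| `^ r) \o shift 0) (h *: (1 : R)) - `|0 : R| `^ r)
    @[h --> 0^'] --> (0 : R).
  have H := cvg_norm_powR0 r1'.
  apply/cvgr0Pnorm_lt => e e0; move/cvgr0Pnorm_lt : H => /(_ _ e0).
  apply: filter_app; near=> h.
  have h0 : h != 0 by near: h; exact: nbhs_dnbhs_neq.
  rewrite normr0 powR0 ?gt_eqF// subr0 /= addr0 /GRing.scale/= mulr1.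
  rewrite normrM normfV [X in _ -> _ * X < _]ger0_norm ?powR_ge0//.
  rewrite ger0_norm ?powR_ge0// [`|h| `^ r](norm_powR_pred r h0) mulrCA.
  by rewrite mulVf ?normr_eq0// mulr1.
by move=> H; split; [exact: cvgP H|exact: cvg_lim H].
Unshelve. all: by end_near. Qed.

Lemma measurable_spow r : measurable_fun setT (spow r : R -> R).
Proof.
rewrite /spow; apply: measurable_funM; last first.
  by apply: (measurableT_comp (measurable_powR _)); exact: normr_measurable.
rewrite (_ : Num.sg = fun t : R => (\1_`]0%R, +oo[ t - \1_`]-oo, 0%R[ t)%R).
  by apply: measurable_funB; exact: measurable_indic.
apply/funext => t; rewrite !indicE; have [t0|t0|<-] := ltgtP 0%R t.
- rewrite gtr0_sg// mem_set/= ?in_itv/= ?andbT//.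
  by rewrite memNset/= ?subr0// in_itv/= ltNge ltW.
- rewrite ltr0_sg// memNset/= ?in_itv/= ?andbT//; last by rewrite ltNge ltW.
  by rewrite mem_set/= ?sub0r// in_itv.
- by rewrite sgr0 !memNset/= ?subr0// in_itv/= ltxx.
Qed.

End signed_power.

(** * Reflection under a weighted signed power map *)

Lemma measurable_ltr_set d (T : measurableType d) (R : realType)
    (f g : T -> R) : measurable_fun setT f -> measurable_fun setT g ->
  measurable [set x | f x < g x].
Proof.
move=> mf mg; rewrite -[X in measurable X]setTI.
exact: (measurable_fun_ltr mf mg).
Qed.

Section mixture.
Local Open Scope ereal_scope.
Context {R : realType}.
Notation RT := (measurableTypeR R).

Lemma ge0_integral_oppr_rV n (F : 'rV[R]_n -> \bar R) :
  measurable_fun setT F -> (forall x, 0 <= F x) ->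
  \int[@lebesgue_rV R n]_x F (- x)%R = \int[@lebesgue_rV R n]_x F x.
Proof.
move=> mF F0.
rewrite -[RHS](@ge0_integral_map_rV R n false -%R (cst 1%R))//.
- apply: eq_integral => x _; rewrite big1// mule1; congr (F _).
- move=> f mf f0 _; rewrite -[RHS]ge0_integral_opp//.
  by apply: eq_integral => t _; rewrite mule1.
Qed.

Lemma measurable_oppr_rV n : measurable_fun setT (fun x : 'rV[R]_n => - x)%R.
Proof.
rewrite (_ : (fun x => _) = (fun x : 'rV[R]_n => map_mx -%R x)).
  exact: measurable_map_rV.
by apply/funext => x; apply/rowP => i; rewrite !mxE.
Qed.

Let half_half (x : \bar R) : 0 <= x -> x `^ (1 - 2^-1) * x `^ 2^-1 = x.
Proof.
move=> x0; rewrite -poweRD; first by rewrite subrK poweRe1.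
by apply: add_neq0_poweRD_def; rewrite subrK oner_neq0.
Qed.

(* Prekopa-Leindler for [A * \1_E] and its reflection: both have the same
   integral, so their geometric mean is that integral. *)
Lemma prekopa_leindler_reflect n (A H : 'rV[R]_n -> \bar R) (E : set 'rV[R]_n) :
  measurable_fun setT A -> measurable_fun setT H -> measurable E ->
  (forall x, 0 <= A x) -> (forall x, 0 <= H x) ->
  (forall x, E x -> E (- x)%R) ->
  (forall x y, E x -> E y -> E (2^-1 *: (x + y))%R) ->
  (forall x y, A x `^ 2^-1 * A (- y)%R `^ 2^-1 <= H (2^-1 *: (x + y))%R) ->
  \int[@lebesgue_rV R n]_x (A x * (\1_E x)%:E) <=
  \int[@lebesgue_rV R n]_x (H x * (\1_E x)%:E).
Proof.
move=> mA mH mE A0 H0 symE convE AH.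
have h2 : (1 - 2^-1 = 2^-1 :> R)%R by lra.
have mind : measurable_fun setT (fun x => (\1_E x : R)%:E).
  by apply/measurable_EFinP; exact: measurable_indic.
pose f x := A x * (\1_E x)%:E.
have mf : measurable_fun setT f by exact: emeasurable_funM.
have f0 x : 0 <= f x by rewrite mule_ge0// lee_fin.
have I0 : 0 <= \int[@lebesgue_rV R n]_x f x by exact: integral_ge0.
have mfN : measurable_fun setT (fun x : 'rV[R]_n => f (- x)%R).
  by apply: (measurableT_comp mf); exact: measurable_oppr_rV.
rewrite -[leLHS](half_half I0) -{2}(ge0_integral_oppr_rV mf f0).
apply: prekopa_leindler => //.
- by rewrite invr_gt0 ltr0n invf_lt1 ?ltr1n.
- exact: emeasurable_funM.
- by move=> x; rewrite mule_ge0// lee_fin.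
move=> x y; rewrite h2 -scalerDr /f !indicE.
have [/set_mem Ex|_] := boolP (x \in E); last first.
  by rewrite mule0 poweR0r ?invr_eq0 ?pnatr_eq0// mul0e mule_ge0// lee_fin.
have [/set_mem ENy|_] := boolP ((- y)%R \in E); last first.
  by rewrite mule0 poweR0r ?invr_eq0 ?pnatr_eq0// mule0 mule_ge0// lee_fin.
have Ey : E y by rewrite -(opprK y); exact: symE.
by rewrite mem_set ?mule1//; exact: convE.
Qed.

Variables (r : R) (w : R -> R).
Hypotheses (r1 : (1 <= r)%R) (mw : measurable_fun setT w).
Hypotheses (w0 : forall t, (0 <= w t)%R).
Hypotheses (w_anti : forall s t, (`|s| <= `|t|)%R -> (w t <= w s)%R).

Let r0 : (0 < r)%R. Proof. exact: lt_le_trans r1. Qed.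
Let th := @spow R r^-1.
Let j (t : R) := (r * `|t| `^ (r - 1))%R.
Let j0 t : (0 <= j t)%R. Proof. by rewrite mulr_ge0 ?powR_ge0// ltW. Qed.
Let j_gt0 t : t != 0%R -> (0 < j t)%R.
Proof. by move=> t0; rewrite mulr_gt0// powR_gt0// normr_gt0. Qed.

Let cj : continuous j.
Proof.
move=> t; apply: cvgM; first exact: cvg_cst.
by apply: continuous_norm_powR; rewrite subr_ge0.
Qed.
Let mj : measurable_fun setT j. Proof. exact: continuous_measurable_fun. Qed.

Let mth : measurable_fun setT th. Proof. exact: measurable_spow. Qed.

Lemma measurable_spow_rV n :
  measurable_fun setT (fun v : 'rV[R]_n => map_mx (spow r) v).
Proof. by apply: measurable_map_rV; exact: measurable_spow. Qed.

Let thK t : th (spow r t) = t.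
Proof. by have := @spowK R r^-1 t; rewrite invrK invr_gt0; exact. Qed.

Lemma ge0_integral_spow_rV n (F : 'rV[R]_n -> \bar R) :
  measurable_fun setT F -> (forall x, 0 <= F x) ->
  \int[@lebesgue_rV R n]_v (F (map_mx (spow r) v) * (\prod_i j (v ord0 i))%:E) =
  \int[@lebesgue_rV R n]_y F y.
Proof.
move=> mF F0; apply: (@ge0_integral_map_rV R n false) => // [|f mf f0 _].
  exact: measurable_spow.
apply: ge0_integral_subst => //.
- exact: spow_lt.
- by move=> y; exists (spow r^-1 y); rewrite spowK.
- by move=> x; exact: is_derive_spow.
Qed.

(** The region where each [tau_i] is positive and below [w / j] at [th y_i], written as a product:
    [j] vanishes at 0 when r > 1, and division by zero would remove the central hyperplanes and
    destroy convexity. *)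
Let E n (tau : 'rV[R]_n) : set 'rV[R]_n := [set y | forall i,
  (0 < tau ord0 i)%R /\ (tau ord0 i * j (th (y ord0 i)) < w (th (y ord0 i)))%R].

Let measurable_forall d (T : measurableType d) n (P : 'I_n -> T -> Prop) :
  (forall i, measurable [set x | P i x]) -> measurable [set x | forall i, P i x].
Proof.
move=> mP; rewrite (_ : [set x | _] = \bigcap_(i in [set: 'I_n]) [set x | P i x]).
  by apply: fin_bigcap_measurable.
by apply/seteqP; split => [x + i _|x + i]; [exact|apply].
Qed.

Let measurable_E n tau : measurable (@E n tau).
Proof.
apply: measurable_forall => i; apply: measurableI.
  have [t0|t0] := boolP (0 < tau ord0 i)%R.
    by rewrite [X in measurable X](_ : _ = setT)//; apply/seteqP.
  by rewrite [X in measurable X](_ : _ = set0)//; apply/seteqP; split.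
have m1 : measurable_fun setT (fun y : 'rV[R]_n => th (y ord0 i)).
  exact: (measurableT_comp mth (measurable_rV_coord i)).
apply: (@measurable_ltr_set _ _ _
  (fun y : 'rV[R]_n => (tau ord0 i * j (th (y ord0 i)))%R)
  (fun y : 'rV[R]_n => w (th (y ord0 i)))) => //.
  by apply: measurable_funM => //; exact: (measurableT_comp mj m1).
exact: (measurableT_comp mw m1).
Qed.

(* [w] is the integral of [tau |-> \1_(tau * j < w) * j]; multiplied over the
   coordinates and pushed forward by [spow r], whose Jacobian is [j], it becomes
   a mixture of the boxes [E tau].  They are symmetric and convex because
   [j] is increasing and [w] decreasing in [|t|]; [w / j] can be junk only on
   the null set where a coordinate vanishes. *)
Lemma spow_mixture n (A : 'rV[R]_n -> \bar R) :
  measurable_fun setT A -> (forall x, 0 <= A x) ->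
  \int[@lebesgue_rV R n]_v (A (map_mx (spow r) v) * (\prod_i w (v ord0 i))%:E) =
  \int[@lebesgue_rV R n]_tau \int[@lebesgue_rV R n]_y (A y * (\1_(E tau) y)%:E).
Proof.
move=> mA A0.
pose B (tau : 'rV[R]_n) : set 'rV[R]_n :=
  [set v | forall i, (0 < tau ord0 i)%R /\ (tau ord0 i < w (v ord0 i) / j (v ord0 i))%R].
have mwj : measurable_fun setT (fun t => w t / j t)%R.
  apply: measurable_funM => //.
  rewrite (_ : (fun t => _) = fun t => r^-1 * `|t| `^ (- (r - 1)))%R; last first.
    by apply/funext => t; rewrite /j invfM powRN.
  apply: measurable_funM => //.
  by apply: (measurableT_comp (measurable_powR _)); exact: normr_measurable.
pose f (z : 'rV[R]_n * 'rV[R]_n) := A (map_mx (spow r) z.1) *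
  (\prod_i j (z.1 ord0 i))%:E * (\1_(B z.2) z.1)%:E.
have mAS : measurable_fun setT (fun v : 'rV[R]_n => A (map_mx (spow r) v)).
  by apply: (measurableT_comp mA); exact: measurable_spow_rV.
have mB2 : measurable [set z : 'rV[R]_n * 'rV[R]_n | B z.2 z.1].
  have m1 i : measurable_fun setT (fun z : 'rV[R]_n * 'rV[R]_n => z.1 ord0 i).
    exact: (measurableT_comp (measurable_rV_coord i) measurable_fst).
  have m2 i : measurable_fun setT (fun z : 'rV[R]_n * 'rV[R]_n => z.2 ord0 i).
    exact: (measurableT_comp (measurable_rV_coord i) measurable_snd).
  apply: measurable_forall => i; apply: measurableI.
    by apply: (@measurable_ltr_set _ _ _ (cst 0%R)
      (fun z : 'rV[R]_n * 'rV[R]_n => z.2 ord0 i)).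
  apply: (@measurable_ltr_set _ _ _ (fun z : 'rV[R]_n * 'rV[R]_n => z.2 ord0 i)
    (fun z => w (z.1 ord0 i) / j (z.1 ord0 i))%R) => //.
  exact: (measurableT_comp mwj (m1 i)).
have mBl v : measurable [set tau | B tau v].
  rewrite (_ : [set tau | _] =
    xsection [set z : 'rV[R]_n * 'rV[R]_n | B z.2 z.1] v).
    exact: measurable_xsection.
  by apply/seteqP; split => tau; rewrite /xsection/= inE.
have mBr tau : measurable (B tau).
  rewrite (_ : B tau = ysection [set z : 'rV[R]_n * 'rV[R]_n | B z.2 z.1] tau).
    exact: measurable_ysection.
  by apply/seteqP; split => v; rewrite /ysection/= inE.
have mf : measurable_fun setT f.
  apply: emeasurable_funM; first apply: emeasurable_funM.
  - exact: (measurableT_comp mAS measurable_fst).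
  - apply/measurable_EFinP.
    by apply: (measurableT_comp (measurable_prod_rV mj)); exact: measurable_fst.
  - apply/measurable_EFinP; rewrite (_ : (fun z => _) =
      \1_[set z : 'rV[R]_n * 'rV[R]_n | B z.2 z.1]); first exact: measurable_indic.
    by apply/funext => z; exact: eq_indic.
have f0 z : 0 <= f z.
  by rewrite !mule_ge0// lee_fin// prodr_ge0.
have wj0 t : (0 <= w t / j t)%R by rewrite divr_ge0.
transitivity (\int[@lebesgue_rV R n]_v \int[@lebesgue_rV R n]_tau f (v, tau)).
  transitivity (\int[@lebesgue_rV R n]_v (A (map_mx (spow r) v) *
    (\prod_i j (v ord0 i))%:E * (\prod_i (w (v ord0 i) / j (v ord0 i)))%:E)).
    apply: eq_integral_rV_neq0.
    - apply: emeasurable_funM => //; apply/measurable_EFinP.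
      exact: measurable_prod_rV.
    - apply: emeasurable_funM; first apply: emeasurable_funM => //.
        by apply/measurable_EFinP; exact: measurable_prod_rV.
      by apply/measurable_EFinP; exact: (measurable_prod_rV mwj).
    - by move=> v; rewrite mule_ge0// lee_fin prodr_ge0.
    - by move=> v; rewrite !mule_ge0// lee_fin prodr_ge0.
    - move=> v v0; rewrite -muleA -EFinM -big_split/=; congr (_ * _%:E).
      by apply: eq_bigr => i _; rewrite mulrC divfK// gt_eqF// j_gt0.
  apply: eq_integral => v _; rewrite /f/=.
  have vE (tau : 'rV[R]_n) : \1_(B tau) v = \1_[set tau | B tau v] tau :> R.
    exact: eq_indic.
  under [RHS]eq_integral do rewrite vE.
  rewrite ge0_integralZl//; last 2 first.
  - by apply/measurable_EFinP; exact: measurable_indic.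
  - by rewrite mule_ge0// lee_fin prodr_ge0.
  congr (_ * _).
  pose C (i : 'I_n) : set RT := `]0%R, (w (v ord0 i) / j (v ord0 i))%R[%classic.
  transitivity (@lebesgue_rV R n [set tau : 'rV[R]_n | forall i, C i (tau ord0 i)]).
    rewrite lebesgue_rV_box; last by move=> i; exact: measurable_itv.
    rewrite -prodEFin; apply: eq_bigr => i _.
    rewrite /C lebesgue_measure_itv/= lte_fin EFinN sube0.
    by have := wj0 (v ord0 i); rewrite le_eqVlt => /predU1P[<-|->]//; rewrite ltxx.
  rewrite integral_indic// setIT; congr (lebesgue_rV _).
  apply/seteqP; split => tau H i; have := H i; rewrite /C/= in_itv/=.
    by move=> /andP[].
  by move=> [h1 h2]; apply/andP.
transitivity (\int[@lebesgue_rV R n]_tau \int[@lebesgue_rV R n]_v f (v, tau)).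
  exact: (fubini_tonelli f mf f0).
apply: eq_integral => tau _.
have mAB : measurable_fun setT (fun y => A y * (\1_(B tau) (map_mx th y))%:E).
  apply: emeasurable_funM => //; apply/measurable_EFinP.
  exact: (measurableT_comp (measurable_indic (mBr tau)) (measurable_map_rV mth)).
transitivity (\int[@lebesgue_rV R n]_y (A y * (\1_(B tau) (map_mx th y))%:E)).
  rewrite -[RHS]ge0_integral_spow_rV//.
  - apply: eq_integral => v _; rewrite /f/= muleAC; congr (_ * _%:E * _).
    by apply: eq_indic; rewrite (_ : map_mx th _ = v)//; apply/rowP => i;
      rewrite !mxE thK.
  - by move=> y; rewrite mule_ge0// lee_fin.
apply: eq_integral_rV_neq0.
- exact: mAB.
- apply: emeasurable_funM => //; apply/measurable_EFinP; apply: measurable_indic.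
  exact: measurable_E.
- by move=> y; rewrite mule_ge0// lee_fin.
- by move=> y; rewrite mule_ge0// lee_fin.
- move=> y y0; congr (_ * _%:E); apply: eq_indic.
  have thy i : (0 < j (th (y ord0 i)))%R.
    apply: j_gt0; rewrite -normr_gt0 norm_spow ?invr_gt0// powR_gt0//.
    by rewrite normr_gt0.
  by split=> H i; have [h1 h2] := H i; split=> //; move: h2;
    rewrite mxE ltr_pdivlMr.
Qed.

(** For each [tau] the box [E tau] satisfies the hypotheses of [prekopa_leindler_reflect]:
    membership depends on each |y_i| monotonically, as [j] increases (this uses [1 <= r]) and [w]
    decreases, so reflections and midpoints stay inside. *)
Lemma spow_weight_reflect n (A H : 'rV[R]_n -> \bar R) :
  measurable_fun setT A -> measurable_fun setT H ->
  (forall x, 0 <= A x) -> (forall x, 0 <= H x) ->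
  (forall x y, A x `^ 2^-1 * A (- y)%R `^ 2^-1 <= H (2^-1 *: (x + y))%R) ->
  \int[@lebesgue_rV R n]_v (A (map_mx (spow r) v) * (\prod_i w (v ord0 i))%:E) <=
  \int[@lebesgue_rV R n]_v (H (map_mx (spow r) v) * (\prod_i w (v ord0 i))%:E).
Proof.
move=> mA mH A0 H0 AH; rewrite !spow_mixture//.
apply: ge0_le_integral_nonmeasurable => tau.
  by apply: integral_ge0 => y _; rewrite mule_ge0// lee_fin.
have Emono (x y : 'rV[R]_n) i : (`|x ord0 i| <= `|y ord0 i|)%R ->
    (0 < tau ord0 i)%R /\
      (tau ord0 i * j (th (y ord0 i)) < w (th (y ord0 i)))%R ->
    (0 < tau ord0 i)%R /\
      (tau ord0 i * j (th (x ord0 i)) < w (th (x ord0 i)))%R.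
  move=> xy [ti h]; split => //.
  have thxy : (`|th (x ord0 i)| <= `|th (y ord0 i)|)%R.
    by rewrite /th !norm_spow ?invr_gt0// powR_norm_homo// invr_ge0 ltW.
  apply: le_lt_trans (lt_le_trans h (w_anti thxy)).
  have rj : (`|th (x ord0 i)| `^ (r - 1) <= `|th (y ord0 i)| `^ (r - 1))%R.
    by apply: powR_norm_homo; [rewrite subr_ge0|exact: thxy].
  apply: ler_wpM2l; first exact: ltW.
  by apply: ler_wpM2l; first exact: ltW.
apply: prekopa_leindler_reflect => //.
- by move=> x Ex i; apply: (Emono _ x) => //; rewrite mxE normrN.
- move=> x y Ex Ey i.
  have h : (`|(2^-1 *: (x + y)) ord0 i| <= Num.max `|x ord0 i| `|y ord0 i|)%R.
    rewrite !mxE normrM ger0_norm ?invr_ge0// ler_pdivrMl//.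
    apply: (le_trans (ler_normD _ _)); rewrite mulr_natl mulr2n.
    by apply: lerD; rewrite le_max lexx ?orbT.
  have [xy|yx] := leP `|x ord0 i|%R `|y ord0 i|%R.
    by move: h; rewrite (max_idPr xy) => h; exact: (Emono _ y i h (Ey i)).
  by move: h; rewrite (max_idPl (ltW yx)) => h; exact: (Emono _ x i h (Ex i)).
Qed.

End mixture.

(** * Comparison of weighted integrals slice by slice *)

Section coordinate_symmetrization.
Local Open Scope ereal_scope.
Context {R : realType}.
Notation RT := (measurableTypeR R).
Variables (r : R) (w : R -> R).
Hypotheses (r1 : (1 <= r)%R) (mw : measurable_fun setT w).
Hypotheses (w0 : forall t, (0 <= w t)%R).
Hypotheses (w_anti : forall s t, (`|s| <= `|t|)%R -> (w t <= w s)%R).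

Let weighted n (phi : 'rV[R]_n -> \bar R) :=
  \int[@lebesgue_rV R n]_v (phi (map_mx (spow r) v) * (\prod_i w (v ord0 i))%:E).

Let measurable_weighted n (phi : 'rV[R]_n -> \bar R) : measurable_fun setT phi ->
  measurable_fun setT (fun v : 'rV[R]_n =>
    phi (map_mx (spow r) v) * (\prod_i w (v ord0 i))%:E).
Proof.
move=> mphi; apply: emeasurable_funM.
  by apply: (measurableT_comp mphi); exact: measurable_spow_rV.
by apply/measurable_EFinP; exact: measurable_prod_rV.
Qed.

Let weight_ge0 n (phi : 'rV[R]_n -> \bar R) v : (forall y, 0 <= phi y) ->
  0 <= phi (map_mx (spow r) v) * (\prod_i w (v ord0 i))%:E.
Proof. by move=> phi0; rewrite mule_ge0// lee_fin prodr_ge0. Qed.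

Let weighted_cons n (phi : 'rV[R]_n.+1 -> \bar R) :
  measurable_fun setT phi -> (forall y, 0 <= phi y) ->
  weighted phi = \int[@lebesgue_measure R]_t
    ((w t)%:E * weighted (fun y => phi (rV_cons (spow r t : RT, y)))).
Proof.
move=> mphi phi0; rewrite /weighted ge0_integral_rV_cons; last 2 first.
- exact: measurable_weighted.
- by move=> v; exact: weight_ge0.
apply: eq_integral => t _; rewrite -ge0_integralZl_EFin//.
- apply: eq_integral => v _; rewrite map_rV_cons big_ord_recl rV_cons0/=.
  under eq_bigr do rewrite rV_consS.
  by rewrite EFinM muleCA.
- by move=> v _; apply: (@weight_ge0 n (fun y => phi (rV_cons (spow r t : RT, y)))).
- apply: (@measurable_weighted n (fun y => phi (rV_cons (spow r t : RT, y)))).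
  exact: measurable_rV_cons_slice.
Qed.

Let weighted_perm n (s : {perm 'I_n}) (phi : 'rV[R]_n -> \bar R) :
  measurable_fun setT phi -> (forall y, 0 <= phi y) ->
  weighted (fun y => phi (perm_row s y)) = weighted phi.
Proof.
move=> mphi phi0; rewrite /weighted -[RHS](ge0_integral_perm_row s).
- apply: eq_integral => v _; congr (phi _ * _%:E).
    by apply/rowP => k; rewrite !mxE.
  rewrite (reindex_perm s)/=; apply: eq_bigr => i _; by rewrite mxE.
- exact: measurable_weighted.
- by move=> v; exact: weight_ge0.
Qed.

(** The dual counterpart of [symmetrize]: these are the pairs for which pairing [u] with a shift of
    [x], and [v] with the same shift of its reflection, adds up to twice the pairing of [x] and [y],
    whatever the shift. *)
Definition half_reflected n (i : 'I_n) (y u v : 'rV[R]_n) :=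
  [/\ u ord0 i = y ord0 i, v ord0 i = (- y ord0 i)%R &
      forall k, k != i -> y ord0 k = (2^-1 * (u ord0 k + v ord0 k))%R].

(** A transposition brings coordinate [i] to the front, and the comparison is made for each fixed
    value of that coordinate by [spow_weight_reflect] in the remaining ones. *)
Lemma weighted_symmetrization n (i : 'I_n) (phi psi : 'rV[R]_n -> \bar R) :
  measurable_fun setT phi -> measurable_fun setT psi ->
  (forall y, 0 <= phi y) -> (forall y, 0 <= psi y) ->
  (forall y, phi (- y)%R = phi y) ->
  (forall y u v, half_reflected i y u v ->
    phi u `^ 2^-1 * phi v `^ 2^-1 <= psi y) ->
  \int[@lebesgue_rV R n]_v (phi (map_mx (spow r) v) * (\prod_i w (v ord0 i))%:E) <=
  \int[@lebesgue_rV R n]_v (psi (map_mx (spow r) v) * (\prod_i w (v ord0 i))%:E).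
Proof.
case: n i phi psi => [[]//|n] i phi psi mphi mpsi phi0 psi0 phiN phipsi.
rewrite -/(weighted phi) -/(weighted psi).
rewrite -(weighted_perm (tperm ord0 i))// -[leRHS](weighted_perm (tperm ord0 i))//.
have mperm (F : 'rV[R]_n.+1 -> \bar R) : measurable_fun setT F ->
    measurable_fun setT (fun y => F (perm_row (tperm ord0 i) y)).
  by move=> mF; apply: (measurableT_comp mF); exact: measurable_perm_row.
rewrite !weighted_cons//; try exact: mperm.
apply: ge0_le_integral_nonmeasurable => t.
  rewrite mule_ge0// ?lee_fin//; apply: integral_ge0 => v _.
  exact: (@weight_ge0 n (fun y => phi (perm_row _ (rV_cons (spow r t : RT, y))))).
apply: lee_wpmul2l; first by rewrite lee_fin.
apply: spow_weight_reflect => //.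
- exact: (measurable_rV_cons_slice (mperm _ mphi)).
- exact: (measurable_rV_cons_slice (mperm _ mpsi)).
move=> x y; set s := tperm ord0 i; set st := spow r t.
(* Both points have the same coordinate [i]; negating the second one gives it the opposite value
   there, as [half_reflected] demands, and undoes the reflection of the other coordinates. *)
rewrite -[X in _ * X `^ _]phiN.
apply: phipsi; split.
- by rewrite !mxE tpermR unlift_none.
- by rewrite !mxE tpermR unlift_none.
move=> k ki; rewrite !mxE.
have : s k != ord0 by rewrite -(tpermR ord0 i) (inj_eq perm_inj).
rewrite -/s; case: (unliftP ord0 (s k)) => [l ->|->]; last by rewrite eqxx.
by rewrite /= !mxE opprK.
Qed.

End coordinate_symmetrization.

(** * Radial substitution *)

Section radial.
Local Open Scope ereal_scope.
Context {R : realType}.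
Notation mu := (@lebesgue_measure R).

Lemma ge0_integral_scale_rV n (a : R) (F : 'rV[R]_n -> \bar R) : (0 < a)%R ->
  measurable_fun setT F -> (forall x, 0 <= F x) ->
  \int[@lebesgue_rV R n]_v (F (a *: v)%R * (a ^+ n)%:E) =
  \int[@lebesgue_rV R n]_x F x.
Proof.
move=> a0 mF F0.
rewrite -[RHS](@ge0_integral_map_rV R n false (fun t => a * t + 0)%R (cst a))//.
- apply: eq_integral => v _; congr (F _ * _%:E).
    by apply/rowP => i; rewrite !mxE addr0.
  by rewrite prodr_const card_ord.
- by apply: measurable_funD => //; exact: measurable_funM.
- by move=> t; exact: ltW.
- by move=> f mf f0 _; exact: ge0_integral_affine.
Qed.

Lemma integral_expRN_norm : \int[mu]_t (expR (- `|t|))%:E <= 2%:E.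
Proof.
pose f (t : R) : \bar R := (expR (- t) * \1_`[0%R, +oo[ t)%:E.
have mexpN : measurable_fun setT (fun t : R => expR (- t))%R.
  apply: continuous_measurable_fun => x; apply: continuous_comp.
    exact: opp_continuous.
  exact: continuous_expR.
have mf : measurable_fun setT f.
  by apply/measurable_EFinP; apply: measurable_funM => //; exact: measurable_indic.
have f0 t : 0 <= f t by rewrite lee_fin mulr_ge0// expR_ge0.
have fI : \int[mu]_t f t = 1.
  transitivity (\int[mu]_(t in `[0%R, +oo[) (expR (- t))%:E).
    rewrite [RHS]integral_mkcond; apply: eq_integral => t _.
    by rewrite patchE /f indicE; case: ifPn => _; rewrite ?mulr1 ?mulr0.
  by rewrite integral_expRN_ge oppr0 expR0.
have -> : 2%:E = \int[mu]_t (f t + f (- t)%R).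
  rewrite ge0_integralD//; last exact: (measurableT_comp mf (@oppr_measurable R _)).
  by rewrite ge0_integral_opp// fI -EFinD.
apply: ge0_le_integral_nonmeasurable => t; first by rewrite lee_fin expR_ge0.
rewrite /f -EFinD lee_fin !indicE.
have [t0|t0] := leP 0%R t.
  rewrite ger0_norm// mem_set/= ?in_itv/= ?t0// mulr1 lerDl.
  by rewrite mulr_ge0// expR_ge0.
rewrite ltr0_norm// opprK [in X in (_ <= _ + X)%R]mem_set/=; last first.
  by rewrite in_itv/= andbT oppr_ge0 ltW.
by rewrite mulr1 lerDr mulr_ge0// expR_ge0.
Qed.

Section kernel.
Variables (q d : R).
Hypotheses (q0 : (0 < q)%R) (d0 : (0 < d)%R).

Definition radial_kernel (t : R) : R := (expR (- (t `^ q)) * t `^ d)%R.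

Lemma radial_kernel_ge0 t : (0 <= radial_kernel t)%R.
Proof. by rewrite mulr_ge0 ?expR_ge0 ?powR_ge0. Qed.

Lemma measurable_radial_kernel : measurable_fun setT radial_kernel.
Proof.
apply: measurable_funM; last exact: measurable_powR.
by apply: measurableT_comp => //; apply: measurableT_comp => //.
Qed.

Let kernel_exp t : radial_kernel (expR t) = expR (d * t - expR (q * t)).
Proof.
rewrite /radial_kernel /powR gt_eqF ?expR_gt0// expRK -expRD.
by rewrite addrC.
Qed.

(** The integral of the kernel over the positive half line against dt/t, in the logarithmic
    coordinate. Invariance of dt/t under dilations is what [radial_massE] expresses. *)
Definition radial_mass : \bar R := \int[mu]_t (radial_kernel (expR t))%:E.

Lemma radial_mass_lty : radial_mass < +oo.
Proof.
(* [C] completes a square: for t >= 0 and a = q t / 2, one has 2 d t = 4 z a <= a^2 + 4 z^2, while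
   a^2 <= exp (q t). Hence d t - exp (q t) <= C - d t. *)
pose z := (d / q)%R; pose C := (4 * z ^+ 2)%R.
have dE : d = (z * q)%R by rewrite /z divfK ?gt_eqF.
have bound t : (d * t - expR (q * t) <= C - `|d * t|)%R.
  have e0 := expR_ge0 (q * t).
  have C0 : (0 <= C)%R by rewrite mulr_ge0// sqr_ge0.
  have [t0|t0] := leP 0%R t; last first.
    by rewrite ltr0_norm ?opprK ?pmulr_rlt0//; lra.
  rewrite ger0_norm; last by rewrite mulr_ge0// ltW.
  have h1 : (1 + q * t / 2 <= expR (q * t / 2))%R := expR_ge1Dx _.
  have h2 : (expR (q * t) = expR (q * t / 2) ^+ 2)%R.
    by rewrite expr2 -expRD -splitr.
  have qt0 : (0 <= q * t / 2)%R by rewrite divr_ge0// mulr_ge0// ltW.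
  have h3 : ((q * t / 2) ^+ 2 <= expR (q * t))%R.
    by rewrite h2 ler_sqr ?nnegrE ?expR_ge0//; lra.
  have h4 : (0 <= (q * t / 2 - 2 * z) ^+ 2)%R by exact: sqr_ge0.
  rewrite /C dE; move: h3 h4; rewrite !expr2; set e := expR _; nra.
apply: (@le_lt_trans _ _ ((expR C / d)%:E * 2%:E)); last by rewrite -EFinM ltry.
apply: (@le_trans _ _ (\int[mu]_t ((expR C / d)%:E *
   ((expR (- `|d * t + 0|))%:E * d%:E)))).
  apply: ge0_le_integral_nonmeasurable => t.
    by rewrite lee_fin radial_kernel_ge0.
  rewrite kernel_exp -!EFinM lee_fin addr0.
  rewrite (_ : (expR C / d * (expR (- `|d * t|) * d) = expR (C - `|d * t|))%R).
    by rewrite ler_expR.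
  by rewrite expRD mulrA mulrAC divfK ?gt_eqF.
have mexp : measurable_fun setT (fun t : R => (expR (- `|t|))%:E).
  apply/measurable_EFinP; apply: measurableT_comp => //.
  by apply: measurableT_comp => //; exact: normr_measurable.
have exp0 (t : R) : 0 <= (expR (- `|t|))%:E by rewrite lee_fin expR_ge0.
rewrite ge0_integralZl_EFin//.
- rewrite lee_pmul2l ?lte_fin ?divr_gt0 ?expR_gt0//.
  rewrite (@ge0_integral_affine _ d 0%R _ d0 mexp exp0).
  exact: integral_expRN_norm.
- by move=> t _; rewrite mule_ge0// lee_fin ?expR_ge0 ?ltW.
- apply: emeasurable_funM => //.
  apply: (measurableT_comp mexp).
  by apply: measurable_funD => //; exact: measurable_funM.
- by rewrite divr_ge0 ?expR_ge0// ltW.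
Qed.

Lemma radial_mass_gt0 : 0 < radial_mass.
Proof.
apply: (@lt_le_trans _ _ (expR (- expR q))%:E); first by rewrite lte_fin expR_gt0.
apply: (@le_trans _ _ (\int[mu]_t (expR (- expR q) * \1_`[0%R, 1%R] t)%:E)).
  under eq_integral do rewrite EFinM.
  rewrite ge0_integralZl_EFin ?expR_ge0//.
  - rewrite integral_indic//= setIT.
    by rewrite lebesgue_measure_itv/= lte_fin ltr01 oppr0 adde0 mule1.
  - by apply/measurable_EFinP; exact: measurable_indic.
apply: ge0_le_integral_nonmeasurable => t.
  by rewrite lee_fin mulr_ge0 ?expR_ge0.
rewrite lee_fin indicE; case: (boolP (t \in _)) => [/set_mem|_]; last first.
  by rewrite mulr0 radial_kernel_ge0.
rewrite /= in_itv/= mulr1 => /andP[t0 t1]; rewrite kernel_exp ler_expR.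
have : (expR (q * t) <= expR q)%R by rewrite ler_expR ler_piMr// ltW.
by have : (0 <= d * t)%R by [rewrite mulr_ge0// ltW]; lra.
Qed.

Lemma radial_massE (s : R) : (0 < s)%R ->
  \int[mu]_t (radial_kernel (expR t * s))%:E = radial_mass.
Proof.
move=> s0; rewrite /radial_mass -[RHS](@ge0_integral_affine _ 1%R (ln s))//.
- apply: eq_integral => t _; rewrite mule1 mul1r expRD lnK//.
- by apply/measurable_EFinP; exact: (measurableT_comp measurable_radial_kernel).
- by move=> t; rewrite lee_fin radial_kernel_ge0.
Qed.

End kernel.
End radial.

Section normlq_theory.
Context {R : realType}.
Variables (n : nat) (q : R).
Hypothesis q0 : 0 < q.
Implicit Types (x y : 'rV[R]_n).

Lemma sum_powR_ge0 x : 0 <= \sum_i `|x ord0 i| `^ q.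
Proof. by apply: sumr_ge0 => i _; exact: powR_ge0. Qed.

Lemma normlq_powR x : normlq q x `^ q = \sum_i `|x ord0 i| `^ q.
Proof. by rewrite /normlq -powRrM mulVf ?gt_eqF// powRr1// sum_powR_ge0. Qed.

Lemma normlqZ (a : R) x : 0 <= a -> normlq q (a *: x) = a * normlq q x.
Proof.
move=> a0; rewrite /normlq.
under eq_bigr do rewrite mxE normrM (ger0_norm a0) powRM//.
rewrite -mulr_sumr powRM ?powR_ge0// ?sum_powR_ge0//.
by rewrite -powRrM mulfV ?gt_eqF// powRr1.
Qed.

Lemma normlq_gt0 x i : x ord0 i != 0 -> 0 < normlq q x.
Proof.
move=> xi; apply: powR_gt0; rewrite (bigD1 i)//=.
rewrite ltr_pwDl ?powR_gt0 ?normr_gt0//.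
by apply: sumr_ge0 => k _; exact: powR_ge0.
Qed.

Lemma measurable_normlq : measurable_fun setT (normlq q : 'rV[R]_n -> R).
Proof.
apply: (measurableT_comp (measurable_powR _)).
apply: measurable_sum => i.
apply: (measurableT_comp (measurable_powR _)).
apply: (measurableT_comp (@normr_measurable R _)).
exact: measurable_rV_coord.
Qed.

End normlq_theory.

(** * Removing a radial factor *)

Section radial_substitution.
Local Open Scope ereal_scope.
Context {R : realType}.
Notation mu := (@lebesgue_measure R).
Notation RT := (measurableTypeR R).
Variables (n : nat) (al : R).
Hypothesis (al0 : (0 < al)%R).

Let V := 'rV[R]_n.
Let c := (1 + al)%R.
Let c0 : (0 < c)%R. Proof. by rewrite addr_gt0. Qed.

Variables (N W : V -> R) (k : R -> R) (K : \bar R).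
Hypotheses (mN : measurable_fun setT N) (mW : measurable_fun setT W).
Hypotheses (mk : measurable_fun setT k).
Hypothesis NZ : forall a x, (0 <= a)%R -> N (a *: x)%R = (a * N x)%R.
Hypothesis N0 : forall x : V, (forall i, x ord0 i != 0%R) -> (0 < N x)%R.
Hypotheses (W0 : forall x, (0 <= W x)%R) (k0 : forall t, (0 <= k t)%R).
Hypothesis K0 : 0 <= K.
Hypothesis kK : forall s, (0 < s)%R -> \int[mu]_t (k (expR t * s))%:E = K.
Hypothesis kW : forall x, (0 < N x)%R ->
  k (N x) = (W x * expR (n%:R * al / c * ln (N x)))%R.

Let measurable_scale d' (T : measurableType d') (a : T -> R) (v : T -> V) :
  measurable_fun setT a -> measurable_fun setT v ->
  measurable_fun setT (fun z => a z *: v z)%R.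
Proof.
move=> ma mv; apply: measurable_fun_rV => i.
rewrite (_ : _ \o _ = fun z => (a z * rV_coord i (v z))%R).
  apply: measurable_funM => //.
  exact: (measurableT_comp (measurable_rV_coord i) mv).
by apply/funext => z; rewrite /= /rV_coord mxE.
Qed.

(* Write [K] as [\int k (e ^ t * N x) dt], rescale [x] by [e ^ - t], then shift
   and dilate [t] so that the factor [N x ^ al] is absorbed. *)
Lemma radial_substitution (G : V -> \bar R) :
  measurable_fun setT G -> (forall x, 0 <= G x) ->
  K * \int[@lebesgue_rV R n]_x G (N x `^ al *: x)%R =
  \int[mu]_s ((expR (- (n%:R * s / c)) / c)%:E *
    \int[@lebesgue_rV R n]_v (G (expR (- s) *: v)%R * (W v)%:E)).
Proof.
move=> mG G0.
have mexp : measurable_fun setT (@expR R) by exact: measurable_expR.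
pose f1 (z : V * RT) := G (N z.1 `^ al *: z.1)%R * (k (expR z.2 * N z.1))%:E.
have mf1 : measurable_fun setT f1.
  apply: emeasurable_funM.
    apply: (measurableT_comp mG); apply: measurable_scale; last exact: measurable_fst.
    apply: (measurableT_comp (measurable_powR _)).
    exact: (measurableT_comp mN measurable_fst).
  apply/measurable_EFinP; apply: (measurableT_comp mk).
  apply: measurable_funM; first exact: (measurableT_comp mexp measurable_snd).
  exact: (measurableT_comp mN measurable_fst).
have f10 z : 0 <= f1 z by rewrite mule_ge0// lee_fin.
have mGN : measurable_fun setT (fun x : V => G (N x `^ al *: x)%R).
  apply: (measurableT_comp mG); apply: measurable_scale => //.
  exact: (measurableT_comp (measurable_powR _) mN).
transitivity (\int[@lebesgue_rV R n]_x \int[mu]_t f1 (x, t)).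
  rewrite -ge0_integralZl//.
  apply: eq_integral_rV_neq0.
  - exact: measurable_funeM.
  - exact: (measurable_fun_fubini_tonelli_F f1 mf1 f10).
  - by move=> x; rewrite mule_ge0.
  - by move=> x; exact: integral_ge0.
  - move=> x x0; have Nx := N0 x0.
    rewrite /f1/= ge0_integralZl//; first by rewrite kK// muleC.
    + apply/measurable_EFinP; apply: (measurableT_comp mk).
      exact: measurable_funM.
    + by move=> t _; rewrite lee_fin.
transitivity (\int[mu]_t \int[@lebesgue_rV R n]_x f1 (x, t)).
  exact: (fubini_tonelli f1 mf1 f10).
pose f2 (z : V * RT) := G ((expR (- z.2) * N z.1) `^ al * expR (- z.2) *: z.1)%R *
  (k (N z.1) * expR (- z.2) ^+ n)%:E.
have mexpN : measurable_fun setT (fun z : V * RT => expR (- z.2)).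
  apply: (measurableT_comp mexp).
  exact: (measurableT_comp (@oppr_measurable R _) measurable_snd).
have mf2 : measurable_fun setT f2.
  apply: emeasurable_funM.
    apply: (measurableT_comp mG); apply: measurable_scale; last exact: measurable_fst.
    apply: measurable_funM => //.
    apply: (measurableT_comp (measurable_powR _)); apply: measurable_funM => //.
    exact: (measurableT_comp mN measurable_fst).
  apply/measurable_EFinP; apply: measurable_funM; last exact: measurable_funX.
  by apply: (measurableT_comp mk); exact: (measurableT_comp mN measurable_fst).
have f20 z : 0 <= f2 z.
  by rewrite mule_ge0// lee_fin mulr_ge0 ?exprn_ge0 ?expR_ge0.
transitivity (\int[mu]_t \int[@lebesgue_rV R n]_v f2 (v, t)).
  apply: eq_integral => t _.
  rewrite -[LHS](@ge0_integral_scale_rV _ n (expR (- t)))//.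
  - apply: eq_integral => v _; rewrite /f1 /f2/= NZ ?expR_ge0//.
    rewrite scalerA EFinM muleA; congr (_ * (k _)%:E * _).
    by rewrite mulrA -expRD subrr expR0 mul1r.
  - exact: expR_gt0.
  - exact: (measurableT_comp mf1 (pair2_measurable t)).
transitivity (\int[@lebesgue_rV R n]_v \int[mu]_t f2 (v, t)).
  by rewrite (fubini_tonelli f2 mf2 f20).
pose f3 (z : V * RT) := (expR (- (n%:R * z.2 / c)) / c)%:E *
  (G (expR (- z.2) *: z.1)%R * (W z.1)%:E).
have mf3 : measurable_fun setT f3.
  apply: emeasurable_funM; last apply: emeasurable_funM.
  - apply/measurable_EFinP; apply: measurable_funM => //.
    apply: (measurableT_comp mexp); apply: measurableT_comp => //.
    by apply: measurable_funM => //; apply: measurable_funM => //.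
  - by apply: (measurableT_comp mG); apply: measurable_scale.
  - by apply/measurable_EFinP; exact: (measurableT_comp mW measurable_fst).
have f30 z : 0 <= f3 z.
  by rewrite !mule_ge0// lee_fin// divr_ge0 ?expR_ge0// ltW.
transitivity (\int[@lebesgue_rV R n]_v \int[mu]_s f3 (v, s)).
  apply: eq_integral_rV_neq0.
  - exact: (measurable_fun_fubini_tonelli_F f2 mf2 f20).
  - exact: (measurable_fun_fubini_tonelli_F f3 mf3 f30).
  - by move=> x; exact: integral_ge0.
  - by move=> x; exact: integral_ge0.
  - move=> v v0; have Nv := N0 v0.
    have ic0 : (0 < c^-1)%R by rewrite invr_gt0.
    rewrite -(@ge0_integral_affine _ c^-1 (al * ln (N v) / c) _ ic0)//; last first.
      exact: (measurableT_comp mf2 (pair1_measurable v)).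
    apply: eq_integral => s _; rewrite /f2 /f3/=.
    (* This choice makes (e^(-t) N v)^al e^(-t) equal to e^(-s). The Jacobian e^(-n t) then
       contributes N(v)^(-n al / c), exactly the power that [kW] cancels. *)
    set t := (c^-1 * s + al * ln (N v) / c)%R.
    have ct : (c * t = s + al * ln (N v))%R.
      by rewrite /t; field; exact: lt0r_neq0.
    have -> : ((expR (- t) * N v) `^ al * expR (- t) = expR (- s))%R.
      rewrite -[in LHS](lnK (_ : N v \is Num.pos))// -expRD /powR.
      rewrite gt_eqF ?expR_gt0// expRK -expRD; congr expR.
      by move: ct; rewrite /c; lra.
    rewrite -muleA [RHS]muleCA -!EFinM; congr (_ * _%:E).
    rewrite kW// -expRM_natl.
    have -> : (expR (- (n%:R * s / c)) =
        expR (n%:R * al / c * ln (N v)) * expR (n%:R * - t))%R.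
      rewrite -expRD; congr expR; rewrite /t; field; exact: lt0r_neq0.
    by rewrite -!mulrA mulrC -!mulrA; congr (_ * (_ * _))%R; rewrite mulrC.
transitivity (\int[mu]_s \int[@lebesgue_rV R n]_v f3 (v, s)).
  exact: (fubini_tonelli f3 mf3 f30).
apply: eq_integral => s _; rewrite /f3/= ge0_integralZl//.
- apply: emeasurable_funM; last exact/measurable_EFinP.
  by apply: (measurableT_comp mG); apply: measurable_scale.
- by move=> v _; rewrite mule_ge0// lee_fin.
- by rewrite lee_fin divr_ge0 ?expR_ge0// ltW.
Qed.

End radial_substitution.

Section radial_comparison.
Local Open Scope ereal_scope.
Context {R : realType}.
Variables (m : nat) (q al : R).
Hypotheses (q0 : (0 < q)%R) (al0 : (0 < al)%R).

Let n := m.+1.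
Let V := 'rV[R]_n.
Let N : V -> R := normlq q.
Let W (v : V) : R := (\prod_i expR (- `|v ord0 i| `^ q))%R.

(** [radial_substitution] writes both sides, multiplied by the same mass, as averages over scales of
    weighted integrals, so a comparison at every scale suffices; the mass is positive and finite and
    cancels. The exponent [d] is dictated by [kW], and the dimension is a successor so that [d] is
    positive. *)
Lemma radial_comparison (G1 G2 : V -> \bar R) :
  measurable_fun setT G1 -> measurable_fun setT G2 ->
  (forall x, 0 <= G1 x) -> (forall x, 0 <= G2 x) ->
  (forall s, (0 < s)%R ->
    \int[@lebesgue_rV R n]_v (G1 (s *: v)%R * (W v)%:E) <=
    \int[@lebesgue_rV R n]_v (G2 (s *: v)%R * (W v)%:E)) ->
  \int[@lebesgue_rV R n]_x G1 (N x `^ al *: x)%R <=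
  \int[@lebesgue_rV R n]_x G2 (N x `^ al *: x)%R.
Proof.
move=> mG1 mG2 G10 G20 G12.
have c0 : (0 < 1 + al)%R by rewrite addr_gt0.
pose d := (n%:R * al / (1 + al))%R.
have d0 : (0 < d)%R by rewrite divr_gt0// mulr_gt0.
have K0 := radial_mass_gt0 q0 d0; have Ky := radial_mass_lty q0 d0.
have Kfin : radial_mass q d \is a fin_num by rewrite ge0_fin_numE// ltW.
have mW : measurable_fun setT W.
  apply: (measurable_prod_rV (j := fun t : R => expR (- `|t| `^ q))).
  apply: measurableT_comp => //; apply: measurableT_comp => //.
  by apply: (measurableT_comp (measurable_powR _)); exact: normr_measurable.
have W0 v : (0 <= W v)%R by rewrite prodr_ge0// => i _; exact: expR_ge0.
have sub := @radial_substitution _ n al al0 N W (radial_kernel q d)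
  (radial_mass q d) (measurable_normlq _) mW (measurable_radial_kernel q d)
  (fun a x => @normlqZ _ _ _ q0 a x) (fun x x0 => normlq_gt0 q (x0 ord0)) W0
  (radial_kernel_ge0 q d) (ltW K0) (@radial_massE _ q d).
have kW x : (0 < N x)%R -> radial_kernel q d (N x) =
    (W x * expR (n%:R * al / (1 + al) * ln (N x)))%R.
  move=> Nx; rewrite /radial_kernel [X in (_ * X)%R]/powR gt_eqF//.
  by rewrite normlq_powR// -sumrN expR_sum.
rewrite -(@lee_pmul2l _ (radial_mass q d))// !(sub kW)//.
apply: ge0_le_integral_nonmeasurable => s.
  rewrite mule_ge0 ?lee_fin ?divr_ge0 ?expR_ge0 ?(ltW c0)//.
  by apply: integral_ge0 => v _; rewrite mule_ge0// lee_fin.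
apply: lee_wpmul2l; first by rewrite lee_fin divr_ge0 ?expR_ge0 ?(ltW c0).
by apply: G12; exact: expR_gt0.
Qed.

End radial_comparison.

(** * The gradient of a power of the q-norm *)

Lemma derive_along (R : realType) (V : normedModType R) (f : V -> R) (g : R -> R)
    (a v : V) (b : R) :
  (forall h, f (h *: v + a) = g (h + b)) -> 'D_v f a = 'D_(1 : R) g b.
Proof.
move=> fg; rewrite /derive.
rewrite (_ : (fun h : R => _) =
  (fun h : R => h^-1 *: ((g \o shift b) (h *: (1 : R)) - g b)))//.
apply/funext => h /=; rewrite fg /GRing.scale/= mulr1.
by have := fg 0; rewrite scale0r !add0r => ->.
Qed.

Section gradient.
Context {R : realType}.
Variables (n : nat) (p q c : R).
Hypotheses (p1 : 1 < p) (q1 : 1 < q).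
Implicit Types x : 'rV[R]_n.

Let q0 : 0 < q. Proof. exact: lt_trans q1. Qed.

(** The gradient of |x|_q^p / p. *)
Definition duality_map x : 'rV[R]_n :=
  normlq q x `^ (p - q) *: map_mx (spow (q - 1)) x.

Lemma gradrV_normlq x :
  gradrV (fun x : 'rV[R]_n => c * normlq q x `^ p) x = (c * p) *: duality_map x.
Proof.
apply/rowP => i; rewrite !mxE.
pose b := \sum_(k | k != i) `|x ord0 k| `^ q.
have b0 : 0 <= b by apply: sumr_ge0 => k _; exact: powR_ge0.
pose s (t : R) := `|t| `^ q + b.
pose g (t : R) := c * s t `^ (p / q).
have NE : normlq q x = s (x ord0 i) `^ q^-1.
  by rewrite /normlq (bigD1 i).
have -> : 'D_(delta_mx ord0 i) (fun x : 'rV[R]_n => c * normlq q x `^ p) x =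
    'D_(1 : R) g (x ord0 i).
  apply: derive_along => h.
  rewrite /g /normlq (bigD1 i)//= -powRrM [q^-1 * p]mulrC /s /b.
  rewrite !mxE !eqxx/= mulr1; congr (_ * (_ + _) `^ _).
  by apply: eq_bigr => k ki; rewrite !mxE (negbTE ki) mulr0 add0r.
have ds t : is_derive t (1 : R) s (q * spow (q - 1) t).
  have h := @is_derive_norm_powR R q t q1.
  by apply: is_derive_eq; rewrite addr0.
have [s0|] := eqVneq (s (x ord0 i)) 0.
  have xi0 : x ord0 i = 0.
    apply/eqP; rewrite -normr_eq0; apply/eqP/(powR_eq0_eq0 (p := q)).
    by apply/eqP; rewrite eq_le powR_ge0 andbT -s0 lerDl.
  have bE : b = 0.
    by move: s0; rewrite /s xi0 normr0 powR0 ?gt_eqF// add0r.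
  rewrite xi0 spow0 !mulr0.
  have h := @is_derive_norm_powR R p 0 p1.
  have -> : g = fun t => c * `|t| `^ p.
    apply/funext => t; rewrite /g /s bE addr0 -powRrM.
    by rewrite [q * _]mulrC divfK ?gt_eqF.
  have dg : is_derive (0 : R) (1 : R) (fun t => c * `|t| `^ p) 0.
    by apply: is_derive_eq; rewrite spow0 mulr0 scaler0.
  by have [] := dg.
move=> sN0; have s0 : 0 < s (x ord0 i).
  by rewrite lt_neqAle eq_sym sN0 addr_ge0// powR_ge0.
have h := is_derive1_comp (is_derive1_powR (p / q) s0) (ds (x ord0 i)).
have dg : is_derive (x ord0 i) (1 : R) g
    (c * (p / q * s (x ord0 i) `^ (p / q - 1) * (q * spow (q - 1) (x ord0 i)))).
  rewrite /g; apply: is_deriveZ.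
have [_ ->] := dg; rewrite NE -powRrM.
have -> : q^-1 * (p - q) = p / q - 1 by field; rewrite gt_eqF.
by field; rewrite gt_eqF.
Qed.

End gradient.

Section duality_map_comparison.
Local Open Scope ereal_scope.
Context {R : realType}.
Variables (p q : R).
Hypotheses (q2 : (2 <= q)%R) (qp : (q <= p)%R).

Let q0 : (0 < q)%R. Proof. by apply: lt_le_trans q2. Qed.
Let r1 : (1 <= q - 1)%R. Proof. by rewrite lerBrDr. Qed.
Let r0 : (0 < q - 1)%R. Proof. exact: lt_le_trans r1. Qed.

Lemma map_spowZ n (s : R) (x : 'rV[R]_n) : (0 <= s)%R ->
  map_mx (spow (q - 1)) (s *: x)%R = (s `^ (q - 1) *: map_mx (spow (q - 1)) x)%R.
Proof.
rewrite le_eqVlt => /predU1P[<-|s0]; apply/rowP => i; rewrite !mxE.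
  by rewrite mul0r spow0 powR0 ?gt_eqF// mul0r.
exact: spowZ.
Qed.

(** The coordinatewise power is homogeneous of degree q - 1, so the radial factor can be moved
    inside with its exponent divided by q - 1. This is the form to which [radial_comparison]
    applies. *)
Lemma duality_mapE n (x : 'rV[R]_n) :
  duality_map p q x =
  map_mx (spow (q - 1)) (normlq q x `^ ((p - q) / (q - 1)) *: x)%R.
Proof.
rewrite map_spowZ; last exact: powR_ge0.
by rewrite -powRrM divfK; last exact: lt0r_neq0.
Qed.

Lemma half_reflectedZ n (i : 'I_n) (a : R) (y u v : 'rV[R]_n) :
  half_reflected i y u v ->
  half_reflected i (a *: y)%R (a *: u)%R (a *: v)%R.
Proof.
move=> [uE vE yE]; split; rewrite ?mxE ?uE ?vE ?mulrN//.
by move=> k ki; rewrite !mxE (yE k ki) -mulrDr mulrCA.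
Qed.

Lemma measurable_scale_rV n (a : R) :
  measurable_fun setT (fun x : 'rV[R]_n => a *: x)%R.
Proof.
apply: measurable_fun_rV => i.
rewrite (_ : _ \o _ = fun x => (a * rV_coord i x)%R).
  by apply: measurable_funM => //; exact: measurable_rV_coord.
by apply/funext => x; rewrite /= /rV_coord mxE.
Qed.

Lemma duality_map_symmetrization n (i : 'I_n) (phi psi : 'rV[R]_n -> \bar R) :
  measurable_fun setT phi -> measurable_fun setT psi ->
  (forall y, 0 <= phi y) -> (forall y, 0 <= psi y) ->
  (forall y, phi (- y)%R = phi y) ->
  (forall y u v, half_reflected i y u v ->
    phi u `^ 2^-1 * phi v `^ 2^-1 <= psi y) ->
  \int[@lebesgue_rV R n]_x phi (duality_map p q x) <=
  \int[@lebesgue_rV R n]_x psi (duality_map p q x).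
Proof.
case: n i phi psi => [[]//|n] i phi psi mphi mpsi phi0 psi0 phiN phipsi.
(* For p = q there is no radial factor, and the weight 1 does; the radial substitution requires a
   positive exponent. *)
move: qp; rewrite le_eqVlt => /predU1P[qpE|qp'].
  have E (F : 'rV[R]_n.+1 -> \bar R) :
      \int[@lebesgue_rV R n.+1]_x F (duality_map p q x) =
      \int[@lebesgue_rV R n.+1]_x
        (F (map_mx (spow (q - 1)) x) * (\prod_(k < n.+1) cst 1%R (x ord0 k))%:E).
    apply: eq_integral => x _; rewrite big1// mule1 /duality_map qpE subrr.
    by rewrite powRr0 scale1r.
  by rewrite !E; apply: (@weighted_symmetrization _ _ (cst 1%R) _ _ _ _ _ i).
under eq_integral do rewrite duality_mapE.
under [leRHS]eq_integral do rewrite duality_mapE.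
have mS (F : 'rV[R]_n.+1 -> \bar R) : measurable_fun setT F ->
    measurable_fun setT (fun x : 'rV[R]_n.+1 => F (map_mx (spow (q - 1)) x)).
  by move=> mF; apply: (measurableT_comp mF); exact: measurable_spow_rV.
apply: (@radial_comparison _ n q _ _ _ (fun x => phi (map_mx (spow (q - 1)) x))
  (fun x => psi (map_mx (spow (q - 1)) x))) => //.
- by rewrite divr_gt0// subr_gt0.
- exact: mS.
- exact: mS.
move=> s s0.
under eq_integral do rewrite map_spowZ ?(ltW s0)//.
under [leRHS]eq_integral do rewrite map_spowZ ?(ltW s0)//.
set a := (s `^ (q - 1))%R.
apply: (@weighted_symmetrization _ (q - 1)%R (fun t => expR (- `|t| `^ q)) _ _ _ _ _ i
  (fun y => phi (a *: y)%R) (fun y => psi (a *: y)%R)) => //.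
- apply: measurableT_comp => //; apply: measurableT_comp => //.
  by apply: (measurableT_comp (measurable_powR _)); exact: normr_measurable.
- move=> t u tu; rewrite ler_expR lerN2.
  by apply: powR_norm_homo; first exact: ltW.
- by apply: (measurableT_comp mphi); exact: measurable_scale_rV.
- by apply: (measurableT_comp mpsi); exact: measurable_scale_rV.
- by move=> y; rewrite scalerN phiN.
- by move=> y u v /half_reflectedZ H; apply: phipsi.
Qed.

End duality_map_comparison.

(** * Symmetrization in one coordinate *)

Section symmetrization.
Local Open Scope ereal_scope.
Context {R : realType}.
Notation mu := (@lebesgue_measure R).
Notation RT := (measurableTypeR R).

Lemma expeR_poweR (r : R) (x : \bar R) : (0 < r)%R ->
  expeR x `^ r = expeR (r%:E * x).
Proof.
move=> r0; case: x => [x||].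
- rewrite -EFinM /= /powR gt_eqF ?expR_gt0// expRK//.
- by rewrite gt0_muley ?lte_fin//= gt_eqF.
- by rewrite gt0_muleNy ?lte_fin//= powR0 ?gt_eqF.
Qed.

Lemma measurable_expeR : measurable_fun setT (@expeR R).
Proof.
apply: (measurability _ (ErealGenOInfty.measurableE R)).
move=> _ [_ [a ->] <-]; rewrite setTI.
have [a0|a0] := ltP a 0%R.
  rewrite (_ : _ @^-1` _ = setT)//; apply/seteqP; split => // x _ /=.
  by rewrite in_itv/= andbT (lt_le_trans _ (expeR_ge0 x))// lte_fin.
move: a0; rewrite le_eqVlt => /predU1P[<-|a0].
  rewrite (_ : _ @^-1` _ = [set` `]-oo%E, +oo%E]]); first exact: emeasurable_itv.
  apply/seteqP; split => x /=; rewrite !in_itv/= !andbT ?leey ?andbT.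
    by move=> x0; rewrite ltNye; apply: contraTneq x0 => ->; rewrite /= ltxx.
  exact: expeR_gt0.
rewrite (_ : _ @^-1` _ = [set` `](ln a)%:E, +oo%E]]); first exact: emeasurable_itv.
apply/seteqP; split => x /=; rewrite !in_itv/= !andbT ?leey ?andbT.
  case: x => [x||]//=; rewrite ?ltry// ?lte_fin.
    by rewrite -{1}(lnK (a0 : a \is Num.pos)) ltr_expR.
  by rewrite ltNge (ltW a0).
case: x => [x||]//=; rewrite ?ltry// ?lte_fin.
by rewrite -{2}(lnK (a0 : a \is Num.pos)) ltr_expR.
Qed.

Lemma measurable_expeR_opp d (T : measurableType d) (P : T -> \bar R) :
  measurable_fun setT P -> measurable_fun setT (fun x => expeR (- P x)).
Proof.
move=> mP; apply: (measurableT_comp measurable_expeR).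
exact: (measurableT_comp (@oppe_measurable R _)).
Qed.

(** The value -oo is excluded because for +oo and -oo the left side is 0, while the sum is -oo by
    convention and makes the right side +oo. *)
Lemma expeR_halves (a b : \bar R) : a != -oo -> b != -oo ->
  expeR (- a) `^ 2^-1 * expeR (- b) `^ 2^-1 =
  expeR (- ((2^-1)%:E * (a + b))).
Proof.
move=> aNy bNy; rewrite !expeR_poweR ?invr_gt0// -expeRD; congr expeR.
case: a b aNy bNy => [a||] [b||]// _ _.
- by congr (_%:E); lra.
- by rewrite addey// !gt0_muley ?lte_fin ?invr_gt0//= gt0_muleNy
    ?lte_fin ?invr_gt0// addeNy.
- by rewrite addye// !gt0_muley ?lte_fin ?invr_gt0//= gt0_muleNy
    ?lte_fin ?invr_gt0// addNye.
- by rewrite /= !gt0_muley ?lte_fin ?invr_gt0//= gt0_muleNy ?lte_fin ?invr_gt0.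
Qed.

Definition shift_row n (i : 'I_n) (a : R) (x : 'rV[R]_n) : 'rV[R]_n :=
  (x + a *: delta_mx ord0 i)%R.

Lemma shift_rowE n (i : 'I_n) a x k :
  shift_row i a x ord0 k = (x ord0 k + (if k == i then a else 0))%R.
Proof. by rewrite !mxE eqxx/=; case: eqP => _; rewrite ?mulr1 ?mulr0. Qed.

Lemma flip_rowE n (i : 'I_n) (x : 'rV[R]_n) k :
  flip_row i x ord0 k = (if k == i then - x ord0 k else x ord0 k)%R.
Proof. by rewrite mxE. Qed.

Lemma flip_rowK n (i : 'I_n) (x : 'rV[R]_n) : flip_row i (flip_row i x) = x.
Proof. by apply/rowP => k; rewrite !flip_rowE; case: eqP => // _; rewrite opprK. Qed.

(** Prekopa-Leindler is used only along lines parallel to the axis [i]. On such a line [f] and its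
    reversal have the same integral, whose geometric mean with itself is that integral. *)
Lemma ge0_le_integral_symmetrization n (i : 'I_n) (f h : 'rV[R]_n -> \bar R) :
  measurable_fun setT f -> measurable_fun setT h ->
  (forall x, 0 <= f x) -> (forall x, 0 <= h x) ->
  (forall x a, f (shift_row i a x) `^ 2^-1 *
    f (shift_row i a (flip_row i x)) `^ 2^-1 <= h x) ->
  \int[@lebesgue_rV R n]_x f x <= \int[@lebesgue_rV R n]_x h x.
Proof.
case: n i f h => [[]//|n] i f h mf mh f0 h0 fh.
rewrite -(ge0_integral_perm_row (tperm ord0 i) mf f0).
rewrite -(ge0_integral_perm_row (tperm ord0 i) mh h0).
have mperm (F : 'rV[R]_n.+1 -> \bar R) : measurable_fun setT F ->
    measurable_fun setT (fun y => F (perm_row (tperm ord0 i) y)).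
  by move=> mF; apply: (measurableT_comp mF); exact: measurable_perm_row.
set s := tperm ord0 i in mperm *.
have mf' := mperm _ mf; have mh' := mperm _ mh.
rewrite !ge0_integral_rV_cons//.
rewrite (fubini_tonelli (fun z : RT * 'rV[R]_n => f (perm_row s (rV_cons z)))
  (measurable_rV_cons_comp mf') (fun=> f0 _)).
rewrite (fubini_tonelli (fun z : RT * 'rV[R]_n => h (perm_row s (rV_cons z)))
  (measurable_rV_cons_comp mh') (fun=> h0 _)).
apply: ge0_le_integral_nonmeasurable => x; first exact: integral_ge0.
pose F (t : R) := f (perm_row s (rV_cons (t : RT, x))).
have mF : measurable_fun setT F.
  exact: (measurableT_comp (measurable_rV_cons_comp mf') (pair2_measurable x)).
have I0 : 0 <= \int[mu]_t F t by apply: integral_ge0 => t _; exact: f0.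
have half : (1 - 2^-1 = 2^-1 :> R)%R by lra.
have -> : \int[mu]_t F t =
    (\int[mu]_t F t) `^ (1 - 2^-1) * (\int[mu]_t F (- t)%R) `^ 2^-1.
  rewrite ge0_integral_opp//; last by move=> t; exact: f0.
  rewrite -poweRD; first by rewrite subrK poweRe1.
  by apply: add_neq0_poweRD_def; rewrite subrK oner_neq0.
apply: prekopa_leindler_1d => //.
- by rewrite invr_gt0 ltr0n invf_lt1 ?ltr1n.
- exact: (measurableT_comp mF (@oppr_measurable R _)).
- exact: (measurableT_comp (measurable_rV_cons_comp mh') (pair2_measurable x)).
- by move=> t; exact: f0.
- by move=> t; exact: f0.
move=> u v; rewrite half.
(* With these values t + a = u and - t + a = - v, so the shift [a] carries the midpoint and its
   reflection to the two points at which [f] is evaluated. *)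
set t := (2^-1 * u + 2^-1 * v)%R; pose a := (2^-1 * u - 2^-1 * v)%R.
have sE k : (s k == ord0) = (k == i).
  by rewrite -(tpermR ord0 i) (inj_eq perm_inj).
have := fh (perm_row s (rV_cons (t : RT, x))) a.
have consE (b : R) l : rV_cons (b : RT, x) ord0 l =
    if l == ord0 then b else rV_cons (t : RT, x) ord0 l.
  by case: (unliftP ord0 l) => [j ->|->]; rewrite ?rV_cons0 ?rV_consS.
rewrite (_ : shift_row i a _ = perm_row s (rV_cons (u : RT, x))); last first.
  apply/rowP => k; rewrite shift_rowE !(mxE _ _ ord0 k) (consE u) -sE.
  by case: eqP => [->|_]; rewrite ?addr0// rV_cons0/= /t /a; lra.
rewrite (_ : shift_row i a _ = perm_row s (rV_cons ((- v)%R : RT, x)))//.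
apply/rowP => k; rewrite shift_rowE flip_rowE !(mxE _ _ ord0 k) (consE (- v)%R) -sE.
by case: eqP => [->|_]; rewrite ?addr0// rV_cons0/= /t /a; lra.
Qed.

Variables (n : nat) (i : 'I_n).
Implicit Types (Phi : 'rV[R]_n -> \bar R) (x y : 'rV[R]_n).

(* [expeR (- symmetrize Phi)] is the least [h] satisfying the Prekopa-Leindler
   hypothesis for [expeR (- Phi)] and its reflection in the coordinate [i]. *)
Definition symmetrize Phi x : \bar R := ereal_inf [set (2^-1)%:E *
  (Phi (shift_row i a x) + Phi (shift_row i a (flip_row i x))) | a in [set: R]].

Lemma symmetrize_lb Phi x a : symmetrize Phi x <= (2^-1)%:E *
  (Phi (shift_row i a x) + Phi (shift_row i a (flip_row i x))).
Proof. by apply: ereal_inf_lbound; exists a. Qed.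

Lemma symmetrize_ge (m : R) Phi : (forall x, m%:E <= Phi x) ->
  forall x, m%:E <= symmetrize Phi x.
Proof.
move=> mPhi x; apply: le_ereal_inf_tmp => _ [a _ <-].
apply: (@le_trans _ _ ((2^-1)%:E * (m%:E + m%:E))).
  by rewrite -EFinD -EFinM lee_fin; lra.
by rewrite lee_wpmul2l ?lee_fin ?invr_ge0// leeD.
Qed.

Lemma symmetrize_proper Phi x : Phi x < +oo ->
  exists y, symmetrize Phi y < +oo.
Proof.
(* [y] has coordinate [i] equal to 0, so it is its own reflection, and one shift takes both copies
   back to [x]. *)
move=> Px; pose y := shift_row i (- x ord0 i) x; exists y.
apply: le_lt_trans (symmetrize_lb Phi y (x ord0 i)) _.
have E1 : shift_row i (x ord0 i) y = x.
  by apply/rowP => k; rewrite !shift_rowE; case: eqP => [->|_];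
    rewrite ?subrK ?addr0.
have E2 : shift_row i (x ord0 i) (flip_row i y) = x.
  apply/rowP => k; rewrite shift_rowE flip_rowE shift_rowE.
  by case: eqP => [->|_]; rewrite ?subrr ?oppr0 ?add0r ?addr0.
rewrite E1 E2; case: (Phi x) Px => [r _||]//; first by rewrite -EFinD -EFinM ltry.
by rewrite /= gt0_muleNy ?lte_fin ?invr_gt0.
Qed.

Lemma symmetrize_flip Phi x : symmetrize Phi (flip_row i x) = symmetrize Phi x.
Proof.
rewrite /symmetrize; congr ereal_inf; apply/seteqP.
by split=> _ [a _ <-]; exists a => //; rewrite flip_rowK addeC.
Qed.

Lemma symmetrize_flip_other Phi (k : 'I_n) :
  (forall x, Phi (flip_row k x) = Phi x) ->
  forall x, symmetrize Phi (flip_row k x) = symmetrize Phi x.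
Proof.
move=> Phik x; have [->|ki] := eqVneq k i; first exact: symmetrize_flip.
rewrite /symmetrize; congr ereal_inf; apply/seteqP.
have E a z : shift_row i a (flip_row k z) = flip_row k (shift_row i a z).
  apply/rowP => l; rewrite shift_rowE !flip_rowE shift_rowE.
  have [->|lk] := eqVneq l k; last by [].
  by rewrite (negbTE ki) !addr0.
have E' z : flip_row i (flip_row k z) = flip_row k (flip_row i z).
  apply/rowP => l; rewrite !mxE.
  by have [->|lk] := eqVneq l k; rewrite ?(negbTE ki)//; case: eqP.
by split=> _ [a _ <-]; exists a => //; rewrite E' !E !Phik.
Qed.

Lemma symmetrize_even Phi : eeven Phi -> eeven (symmetrize Phi).
Proof.
move=> evPhi x; rewrite -[RHS]symmetrize_flip.
rewrite /symmetrize; congr ereal_inf; apply/seteqP.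
have E a z : Phi (shift_row i (- a) (- z)%R) = Phi (shift_row i a z).
  rewrite -evPhi; congr Phi; apply/rowP => l; rewrite mxE !shift_rowE mxE.
  by case: eqP => _; lra.
have E1 z : flip_row i (- z)%R = (- flip_row i z)%R.
  by apply/rowP => l; rewrite !mxE; case: eqP.
split=> _ [a _ <-]; exists (- a)%R => //.
  by rewrite flip_rowK -(E (- a)%R x) -(E (- a)%R) opprK -E1 addeC.
by rewrite flip_rowK E1 !E addeC.
Qed.

(** A shift that witnesses a value below [b] at [x] also does so nearby, as shifts and reflections
    carry boxes to boxes of the same radius. The lower bound makes both terms finite, so the slack
    can be divided between them. *)
Lemma symmetrize_usc (m : R) Phi : (forall x, m%:E <= Phi x) -> usc Phi ->
  usc (symmetrize Phi).
Proof.
move=> mPhi uPhi b x /= /ereal_inf_lt[_ [a _ <-]].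
set y := shift_row i a x; set z := shift_row i a (flip_row i x) => yzb.
have NNy u : Phi u != -oo by rewrite gt_eqF// (lt_le_trans _ (mPhi u))// ltNyr.
have fin u : Phi u < +oo -> Phi u \is a fin_num.
  by move=> Pu; rewrite fin_numE NNy/= lt_eqF.
have Py : Phi y < +oo.
  rewrite ltey; apply/eqP => Py; move: yzb; rewrite Py addye//.
  by rewrite gt0_muley ?lte_fin ?invr_gt0// ltNge leey.
have Pz : Phi z < +oo.
  rewrite ltey; apply/eqP => Pz; move: yzb; rewrite Pz addey//.
  by rewrite gt0_muley ?lte_fin ?invr_gt0// ltNge leey.
move: yzb; rewrite -(fineK (fin _ Py)) -(fineK (fin _ Pz)) -EFinD -EFinM lte_fin.
set A := fine (Phi y); set B := fine (Phi z) => AB.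
pose e := ((b - 2^-1 * (A + B)) / 2)%R.
have e0 : (0 < e)%R by rewrite divr_gt0// subr_gt0.
have [|e1 e10 H1] := uPhi (A + e)%R y.
  by rewrite /= -(fineK (fin _ Py)) lte_fin ltrDl.
have [|e2 e20 H2] := uPhi (B + e)%R z.
  by rewrite /= -(fineK (fin _ Pz)) lte_fin ltrDl.
exists (Num.min e1 e2); first by rewrite lt_min e10.
move=> x' xx' /=; apply: le_lt_trans (symmetrize_lb Phi x' a) _.
have h1 : Phi (shift_row i a x') < (A + e)%:E.
  apply: H1 => k; rewrite !shift_rowE opprD addrACA subrr addr0.
  by apply: lt_le_trans (xx' k) _; rewrite ge_min lexx.
have h2 : Phi (shift_row i a (flip_row i x')) < (B + e)%:E.
  apply: H2 => k; rewrite !shift_rowE opprD addrACA subrr addr0 !flip_rowE.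
  have h := lt_le_trans (xx' k) (_ : Num.min e1 e2 <= e2)%R.
  by case: eqP => _; rewrite -?opprD ?normrN; apply: h; rewrite ge_min lexx orbT.
apply: (@lt_trans _ _ ((2^-1)%:E * ((A + e)%:E + (B + e)%:E))).
  rewrite lte_pmul2l ?lte_fin ?invr_gt0//; apply: lteD => //.
by rewrite -EFinD -EFinM lte_fin /e; lra.
Qed.

Lemma le_integral_symmetrize (m : R) Phi : (forall x, m%:E <= Phi x) -> usc Phi ->
  \int[@lebesgue_rV R n]_x expeR (- Phi x) <=
  \int[@lebesgue_rV R n]_x expeR (- symmetrize Phi x).
Proof.
move=> mPhi uPhi.
have NNy u : Phi u != -oo by rewrite gt_eqF// (lt_le_trans _ (mPhi u))// ltNyr.
apply: (@ge0_le_integral_symmetrization n i).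
- by apply: measurable_expeR_opp; exact: measurable_usc.
- by apply: measurable_expeR_opp; apply: measurable_usc; exact: (@symmetrize_usc m).
- by move=> x; exact: expeR_ge0.
- by move=> x; exact: expeR_ge0.
- by move=> x a; rewrite expeR_halves// lee_expeR leeN2 symmetrize_lb.
Qed.

(** The shift contributes a y_i to the first pairing and - a y_i to the second. *)
Lemma dotrV_half_reflected x y u v a : half_reflected i y u v ->
  (dotrV (shift_row i a x) u + dotrV (shift_row i a (flip_row i x)) v =
   2 * dotrV x y)%R.
Proof.
move=> [uE vE yE]; rewrite /dotrV -big_split/= mulr_sumr; apply: eq_bigr => k _.
rewrite !shift_rowE flip_rowE.
have [->|ki] := eqVneq k i; first by rewrite uE vE; lra.
by rewrite (yE k ki); lra.
Qed.

(** For each shift, add Young's inequality for [Phi] at the two shifted points, paired with [u] and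
    [v]; by [dotrV_half_reflected] the left side does not depend on the shift. *)
Lemma legendre_symmetrize Phi x0 y u v : (forall x, Phi x != -oo) ->
  Phi x0 < +oo -> half_reflected i y u v ->
  legendre (symmetrize Phi) y <= (2^-1)%:E * (legendre Phi u + legendre Phi v).
Proof.
move=> NNy Px0 yuv.
have leg x w : (dotrV x w)%:E - Phi x <= legendre Phi w.
  by apply: ereal_sup_ubound; exists x.
have legN w : legendre Phi w != -oo.
  rewrite gt_eqF//; apply: lt_le_trans (leg x0 w).
  by case: (Phi x0) (NNy x0) Px0 => // r _ _; rewrite -EFinB ltNyr.
case Eu : (legendre Phi u) (legN u) => [cu||]// _; last first.
  by case: (legendre Phi v) (legN v) => //= *;
    rewrite gt0_muley ?lte_fin ?invr_gt0// leey.
case Ev : (legendre Phi v) (legN v) => [cv||]// _; last first.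
  by rewrite addey// gt0_muley ?lte_fin ?invr_gt0// leey.
apply: ge_ereal_sup => _ [x _ <-].
rewrite -EFinD -EFinM.
suff : (dotrV x y - 2^-1 * (cu + cv))%:E <= symmetrize Phi x.
  by case: (symmetrize Phi x) => [s||]//=; rewrite -?EFinB ?lee_fin ?addeNy ?leNye//; lra.
apply: le_ereal_inf_tmp => _ [a _ <-].
have := leg (shift_row i a x) u; have := leg (shift_row i a (flip_row i x)) v.
rewrite Eu Ev.
case: (Phi (shift_row i a x)) (NNy (shift_row i a x)) => [A||]// _; last first.
  by case: (Phi _) (NNy (shift_row i a (flip_row i x))) => //= *;
    rewrite gt0_muley ?lte_fin ?invr_gt0// leey.
case: (Phi _) (NNy (shift_row i a (flip_row i x))) => [B||]// _; last first.
  by rewrite addey// gt0_muley ?lte_fin ?invr_gt0// leey.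
rewrite -!EFinB !lee_fin => h1 h2; rewrite -?EFinD -?EFinM ?lee_fin.
by have := dotrV_half_reflected x a yuv; lra.
Qed.

End symmetrization.

(** * Unconditional functions *)

Section unconditional.
Context {R : realType}.

Lemma powR_AGM (a b l : R) : 0 < l < 1 -> 0 <= a -> 0 <= b ->
  a `^ (1 - l) * b `^ l <= (1 - l) * a + l * b.
Proof.
move=> l01 a0 b0; have := @poweR_AGM R a%:E b%:E l l01.
by rewrite !lee_fin; apply.
Qed.

Lemma hoelder_powR_sum n (A B : 'I_n -> R) (l : R) : 0 < l < 1 ->
  (forall i, 0 <= A i) -> (forall i, 0 <= B i) ->
  \sum_i A i `^ (1 - l) * B i `^ l <=
  (\sum_i A i) `^ (1 - l) * (\sum_i B i) `^ l.
Proof.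
move=> l01 A0 B0; have /andP[l0 l1] := l01.
have l1' : 0 < 1 - l by rewrite subr_gt0.
set SA := \sum_i A i; set SB := \sum_i B i.
have SA0 : 0 <= SA by exact: sumr_ge0.
have SB0 : 0 <= SB by exact: sumr_ge0.
have [SAE|SAN] := eqVneq SA 0.
  rewrite big1 ?mulr_ge0 ?powR_ge0// => i _.
  have := psumr_eq0P (fun i _ => A0 i) SAE => /(_ i Logic.eq_refl) ->.
  by rewrite powR0 ?mul0r ?gt_eqF.
have [SBE|SBN] := eqVneq SB 0.
  rewrite big1 ?mulr_ge0 ?powR_ge0// => i _.
  have := psumr_eq0P (fun i _ => B0 i) SBE => /(_ i Logic.eq_refl) ->.
  by rewrite [0 `^ l]powR0 ?mulr0 ?gt_eqF.
apply: (@le_trans _ _ (\sum_i SA `^ (1 - l) * SB `^ l *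
    ((1 - l) * (A i / SA) + l * (B i / SB)))).
  apply: ler_sum => i _.
  have a0 : 0 <= A i / SA by rewrite divr_ge0.
  have b0 : 0 <= B i / SB by rewrite divr_ge0.
  rewrite -{1}(divfK SAN (A i)) -{1}(divfK SBN (B i)).
  rewrite (powRM _ a0)// (powRM _ b0)// mulrACA [leLHS]mulrC.
  by rewrite ler_wpM2l ?mulr_ge0 ?powR_ge0// powR_AGM.
rewrite -mulr_sumr big_split/= -!mulr_sumr -!mulr_suml divff// divff//.
by rewrite !mulr1 subrK mulr1.
Qed.

Variables (n : nat) (p q c : R).
Hypotheses (p1 : 1 < p) (q1 : 1 < q) (qp : q <= p) (c0 : 0 <= c).
Implicit Types x y s t : 'rV[R]_n.

Let p0 : 0 < p. Proof. exact: lt_trans p1. Qed.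
Let q0 : 0 < q. Proof. exact: lt_trans q1. Qed.

Definition expN_row (t : 'rV[R]_n) : 'rV[R]_n := map_mx (fun u => expR (- u)) t.

Lemma normlq_expN_mixture s t :
  normlq q (expN_row (p^-1 *: s + (1 - p^-1) *: t)) `^ p <=
  dotrV (expN_row s) (duality_map p q (expN_row t)).
Proof.
(* With x = exp (- s) and y = exp (- t), [A] lists x_i y_i^(q-1), the terms of the pairing up to the
   radial factor, and [B] lists y_i^q. The q-th power of the mixed coordinate is A^(q/p) B^(1-q/p),
   so Hoelder applies with these weights; for p = q equality holds. *)
pose A i := expR (- s ord0 i) * expR (- t ord0 i) `^ (q - 1).
pose B i := expR (- t ord0 i) `^ q.
have A0 i : 0 <= A i by rewrite mulr_ge0 ?powR_ge0 ?expR_ge0.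
have B0 i : 0 <= B i by exact: powR_ge0.
have -> : dotrV (expN_row s) (duality_map p q (expN_row t)) =
    (\sum_i A i) * (\sum_i B i) `^ (p / q - 1).
  rewrite /dotrV mulr_suml; apply: eq_bigr => i _; rewrite !mxE spow_gt0 ?expR_gt0//.
  rewrite mulrA mulrAC; congr (_ * _); rewrite /normlq -powRrM.
  congr (_ `^ _); last by field; rewrite gt_eqF.
  by apply: eq_bigr => k _; rewrite mxE gtr0_norm ?expR_gt0.
rewrite {1}/normlq -powRrM.
have E i : `|expN_row (p^-1 *: s + (1 - p^-1) *: t) ord0 i| `^ q =
    A i `^ (q / p) * B i `^ (1 - q / p).
  rewrite !mxE gtr0_norm ?expR_gt0// /A /B powRM ?powR_ge0 ?expR_ge0//.
  rewrite -!powRrM -!expRM -!expRD; congr expR.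
  by field; rewrite gt_eqF.
under eq_bigr do rewrite E.
have [qpE|qpN] := eqVneq q p.
  rewrite qpE divff ?gt_eqF// subrr.
  under eq_bigr do rewrite powRr0 mulr1 powRr1//.
  by rewrite powRr0 mulr1 mulVf ?gt_eqF// powRr1// sumr_ge0.
have l01 : 0 < 1 - q / p < 1.
  by rewrite subr_gt0 ltr_pdivrMr// mul1r lt_neqAle qpN qp/= gtrBl divr_gt0.
have := @hoelder_powR_sum n A B _ l01 A0 B0; rewrite subKr => H.
have pq0 : 0 <= q^-1 * p by rewrite mulr_ge0 ?invr_ge0 ?ltW.
apply: le_trans (ge0_ler_powR pq0 _ _ H) _.
- by rewrite nnegrE sumr_ge0// => i _; rewrite mulr_ge0 ?powR_ge0.
- by rewrite nnegrE mulr_ge0 ?powR_ge0.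
rewrite powRM ?powR_ge0// -!powRrM.
rewrite (_ : q / p * (q^-1 * p) = 1); last by field; rewrite !gt_eqF.
rewrite (_ : (1 - q / p) * (q^-1 * p) = p / q - 1); last by field; rewrite !gt_eqF.
by rewrite powRr1// sumr_ge0.
Qed.

Lemma normlq_flip i x : normlq q (flip_row i x) = normlq q x.
Proof.
rewrite /normlq; congr (_ `^ _); apply: eq_bigr => k _; rewrite flip_rowE.
by case: eqP; rewrite ?normrN.
Qed.

Lemma duality_map_flip i x :
  duality_map p q (flip_row i x) = flip_row i (duality_map p q x).
Proof.
rewrite /duality_map normlq_flip; apply/rowP => k; rewrite flip_rowE !mxE.
by case: eqP => _; rewrite ?spowN ?mulrN.
Qed.

Lemma flip_rowZ i (a : R) x : flip_row i (a *: x) = a *: flip_row i x.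
Proof. by apply/rowP => k; rewrite !mxE; case: eqP; rewrite ?mulrN. Qed.

Lemma legendre_flip i (Phi : 'rV[R]_n -> \bar R) y :
  (forall x, Phi (flip_row i x) = Phi x) ->
  legendre Phi (flip_row i y) = legendre Phi y.
Proof.
move=> Phii; rewrite /legendre; congr ereal_sup.
have E x w : dotrV (flip_row i x) (flip_row i w) = dotrV x w.
  by apply: eq_bigr => k _; rewrite !flip_rowE; case: eqP; rewrite ?mulrNN.
apply/seteqP; split=> _ [x _ <-]; exists (flip_row i x) => //; rewrite Phii.
  by rewrite -[in dotrV _ y](flip_rowK i y) E.
by rewrite E.
Qed.

Lemma measurable_duality_map :
  measurable_fun setT (duality_map p q : 'rV[R]_n -> 'rV[R]_n).
Proof.
apply: measurable_fun_rV => i.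
rewrite (_ : _ \o _ =
    (fun x => normlq q x `^ (p - q) * spow (q - 1) (rV_coord i x))%R).
  apply: measurable_funM.
    by apply: (measurableT_comp (measurable_powR _)); exact: measurable_normlq.
  apply: (measurableT_comp _ (measurable_rV_coord i)).
  exact: measurable_spow.
by apply/funext => x; rewrite /= /rV_coord !mxE.
Qed.

Local Open Scope ereal_scope.

(** Evaluated at [duality_map p q x] this is the integrand of the dual integral, because the
    gradient of V is [c * p] times the duality map. *)
Definition dual_density (Phi : 'rV[R]_n -> \bar R) (y : 'rV[R]_n) : \bar R :=
  expeR (- ((p - 1)^-1%:E * legendre Phi ((c * p) *: y)%R)).

Lemma measurable_dual_density Phi : measurable_fun setT (dual_density Phi).
Proof.
apply: measurable_expeR_opp; apply: measurable_funeM.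
exact: (measurableT_comp (measurable_legendre Phi) (measurable_scale_rV _)).
Qed.

Let j (t : R) := (2 * expR (- t))%R.

Let prod_j (x : 'rV[R]_n) :
  (\prod_i j (x ord0 i))%R = expR (\sum_i (ln 2 - x ord0 i)).
Proof.
by rewrite expR_sum; apply: eq_bigr => i _; rewrite expRD lnK// posrE.
Qed.

Lemma unconditional_inequality (m : R) (Phi : 'rV[R]_n -> \bar R) x0 :
  measurable_fun setT Phi -> (forall x, m%:E <= Phi x) -> Phi x0 < +oo ->
  (forall i x, Phi (flip_row i x) = Phi x) ->
  \int[@lebesgue_rV R n]_x expeR (- Phi x) *
  (\int[@lebesgue_rV R n]_x dual_density Phi (duality_map p q x)) `^ (p - 1) <=
  (\int[@lebesgue_rV R n]_x expeR (- (c * normlq q x `^ p)%:E)) `^ p.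
Proof.
move=> mPhi lbPhi Px0 flPhi.
pose f x := expeR (- Phi x); pose g x := dual_density Phi (duality_map p q x).
pose h x : \bar R := expeR (- (c * normlq q x `^ p)%:E).
have mf : measurable_fun setT f by exact: measurable_expeR_opp.
have mg : measurable_fun setT g.
  exact: (measurableT_comp (measurable_dual_density Phi) measurable_duality_map).
have mh : measurable_fun setT h.
  apply: measurable_expeR_opp; apply/measurable_EFinP.
  apply: measurable_funM => //.
  by apply: (measurableT_comp (measurable_powR _)); exact: measurable_normlq.
have f0 x : 0 <= f x by exact: expeR_ge0.
have g0 x : 0 <= g x by exact: expeR_ge0.
have h0 x : 0 <= h x by exact: expeR_ge0.
have flf i x : f (flip_row i x) = f x by rewrite /f flPhi.
have flg i x : g (flip_row i x) = g x.
  by rewrite /g duality_map_flip /dual_density -flip_rowZ legendre_flip.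
have flh i x : h (flip_row i x) = h x by rewrite /h normlq_flip.
have mN : measurable_fun setT (fun u : R => expR (- u)).
  by apply: measurableT_comp => //; exact: oppr_measurable.
have mj : measurable_fun setT j by exact: measurable_funM.
have j0 u : (0 <= j u)%R by rewrite mulr_ge0 ?expR_ge0.
(* Invariance under reflections makes each coordinate slice even, so the exponential substitution
   covers the whole space, with a factor 2 per coordinate. *)
have logE (F : 'rV[R]_n -> \bar R) : measurable_fun setT F -> (forall x, 0 <= F x) ->
    (forall i x, F (flip_row i x) = F x) ->
    \int[@lebesgue_rV R n]_x F x =
    \int[@lebesgue_rV R n]_x (F (expN_row x) * (\prod_i j (x ord0 i))%:E).
  move=> mF F0 FE; apply/esym.
  apply: (@ge0_integral_map_rV _ _ true (fun u => expR (- u)) j F) => //.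
  by move=> F1 mF1 F10 /(_ Logic.eq_refl); exact: ge0_integral_even_expRN.
have mlog (F : 'rV[R]_n -> \bar R) : measurable_fun setT F ->
    measurable_fun setT (fun x => F (expN_row x) * (\prod_i j (x ord0 i))%:E).
  move=> mF; apply: emeasurable_funM.
    exact: (measurableT_comp mF (measurable_map_rV mN)).
  by apply/measurable_EFinP; exact: measurable_prod_rV.
have log0 (F : 'rV[R]_n -> \bar R) : (forall x, 0 <= F x) ->
    forall x, 0 <= F (expN_row x) * (\prod_i j (x ord0 i))%:E.
  by move=> F0 x; rewrite mule_ge0// lee_fin prodr_ge0.
have p1' : (0 < p - 1)%R by rewrite subr_gt0.
have l01 : (0 < 1 - p^-1 < 1)%R.
  by rewrite subr_gt0 invf_lt1// p1 gtrBl invr_gt0.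
have key x y : f x `^ p^-1 * g y `^ (1 - p^-1) <=
    expeR (- ((c%:E * (dotrV x (duality_map p q y))%:E))).
  rewrite /f /g /dual_density; set L := legendre Phi _.
  have : (dotrV x ((c * p) *: duality_map p q y)%R)%:E - Phi x <= L.
    by apply: ereal_sup_ubound; exists x.
  rewrite !expeR_poweR ?invr_gt0//; last by case/andP: l01.
  rewrite -expeRD lee_expeR.
  have -> : dotrV x ((c * p) *: duality_map p q y)%R =
      (p * (c * dotrV x (duality_map p q y)))%R.
    rewrite /dotrV !mulr_sumr; apply: eq_bigr => k _; rewrite [in LHS]mxE.
    by rewrite mulrCA -mulrA mulrCA.
  have := lbPhi x; set D := dotrV _ _.
  case: (Phi x) => [r _||//]; last first.
    move=> _ _; rewrite muleN gt0_muley ?lte_fin ?invr_gt0//.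
    by rewrite addNye ?leNye.
  case: L => [L||//]; last first.
    move=> _; rewrite gt0_muley ?lte_fin ?invr_gt0//.
    by rewrite /= [(1 - _)%:E * _]gt0_muleNy ?lte_fin ?addeNy ?leNye//; case/andP: l01.
  rewrite -EFinB !lee_fin => H.
  (* The weights are chosen for this identity: potential and transform now both carry 1/p. *)
  have E1 : ((1 - p^-1) * ((p - 1)^-1 * L) = p^-1 * L)%R.
    by field; rewrite !gt_eqF.
  have : (p^-1 * (p * (c * D) - r) <= p^-1 * L)%R by rewrite ler_wpM2l// invr_ge0 ltW.
  rewrite mulrBr mulKf ?gt_eqF//; move: E1.
  by rewrite !mulrN => ->; lra.
have := @prekopa_leindler _ n _ _ _ _ l01 (mlog _ mf) (mlog _ mg) (mlog _ mh)
  (log0 _ f0) (log0 _ g0) (log0 _ h0).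
rewrite subKr -(logE f)// -(logE g)// -(logE h)//.
move=> /(_ _)/wrap[].
  move=> s t; rewrite !poweRM ?lee_fin ?prodr_ge0// muleACA.
  apply: lee_pmul; rewrite ?mule_ge0 ?poweR_ge0//.
    apply: le_trans (key _ _) _; rewrite lee_expeR leeN2 -EFinM lee_fin.
    by rewrite ler_wpM2l// normlq_expN_mixture.
  (* The logarithm of the Jacobian is affine, so the weighted geometric mean of its values at [s]
     and [t] is its value at the mixture. *)
  rewrite !poweR_EFin -EFinM lee_fin !prod_j -!expRM -expRD ler_expR.
  rewrite !mulr_suml -big_split/=; apply: ler_sum => k _; rewrite !mxE; lra.
(* Raising to the power p turns the exponents 1/p and 1 - 1/p into 1 and p - 1. *)
move=> H; have := le_poweR (ltW p0) _ H.
rewrite poweRM ?poweR_ge0// -!poweRrM mulVf ?gt_eqF//.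
rewrite mulrBl mulVf ?gt_eqF// mul1r poweRe1//; last exact: integral_ge0.
by apply; rewrite mule_ge0 ?poweR_ge0.
Qed.

End unconditional.

(** * Even functions *)

Section even.
Local Open Scope ereal_scope.
Context {R : realType}.
Variables (n : nat) (p q c : R).
Hypotheses (p1 : (1 < p)%R) (q2 : (2 <= q)%R) (qp : (q <= p)%R) (c0 : (0 <= c)%R).
Implicit Types (Phi Psi : 'rV[R]_n -> \bar R) (x y : 'rV[R]_n).

Lemma legendre_neqNy Phi x0 y : Phi x0 < +oo -> legendre Phi y != -oo.
Proof.
move=> Px0; rewrite gt_eqF//.
apply: lt_le_trans (_ : (dotrV x0 y)%:E - Phi x0 <= _).
  by case: (Phi x0) Px0 => // r _; rewrite -EFinB ltNyr.
by apply: ereal_sup_ubound; exists x0.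
Qed.

Lemma legendre_even Phi y : eeven Phi -> legendre Phi (- y)%R = legendre Phi y.
Proof.
move=> evPhi; rewrite /legendre; congr ereal_sup.
have E x w : dotrV (- x)%R (- w)%R = dotrV x w.
  by apply: eq_bigr => k _; rewrite !mxE mulrNN.
apply/seteqP; split=> _ [x _ <-]; exists (- x)%R => //; rewrite evPhi.
  by rewrite -[dotrV (- x)%R y]E opprK.
by rewrite E.
Qed.

Lemma le_integral_dual_symmetrize (i : 'I_n) Phi x0 :
  (forall x, Phi x != -oo) -> Phi x0 < +oo -> eeven Phi ->
  \int[@lebesgue_rV R n]_x dual_density p c Phi (duality_map p q x) <=
  \int[@lebesgue_rV R n]_x dual_density p c (symmetrize i Phi) (duality_map p q x).
Proof.
move=> NNy Px0 evPhi.
apply: (@duality_map_symmetrization _ p q q2 qp n i).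
- exact: measurable_dual_density.
- exact: measurable_dual_density.
- by move=> y; exact: expeR_ge0.
- by move=> y; exact: expeR_ge0.
- by move=> y; rewrite /dual_density scalerN legendre_even.
have k0 : (0 < (p - 1)^-1)%R by rewrite invr_gt0 subr_gt0.
have muleNNy (L : \bar R) : L != -oo -> (p - 1)^-1%:E * L != -oo.
  by case: L => [r||]//= _; rewrite gt0_muley ?lte_fin.
move=> y u v /(half_reflectedZ (c * p)) yuv; rewrite /dual_density.
have := legendre_symmetrize NNy Px0 yuv.
have := legendre_neqNy ((c * p) *: u)%R Px0.
have := legendre_neqNy ((c * p) *: v)%R Px0.
set A := legendre Phi _; set B := legendre Phi _ => BNy ANy H.
rewrite expeR_halves ?muleNNy// lee_expeR leeN2.
apply: (@le_trans _ _ ((p - 1)^-1%:E * ((2^-1)%:E * (B + A)))).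
  by rewrite lee_wpmul2l ?lee_fin ?(ltW k0).
rewrite muleCA muleDr// /adde_def.
by rewrite !(negbTE BNy) !(negbTE ANy) !andbF.
Qed.

(** Coordinates are symmetrized one at a time. What each round needs is carried along:
    semicontinuity for measurability, the lower bound against -oo, a finite value, and evenness for
    the dual comparison; reflections already gained persist by [symmetrize_flip_other]. *)
Lemma symmetrized (m : R) Phi x0 (l : seq 'I_n) :
  usc Phi -> (forall x, m%:E <= Phi x) -> Phi x0 < +oo -> eeven Phi ->
  exists Psi, [/\ usc Psi, (forall x, m%:E <= Psi x), (exists x1, Psi x1 < +oo),
    eeven Psi & forall i, i \in l -> forall x, Psi (flip_row i x) = Psi x] /\
    \int[@lebesgue_rV R n]_x expeR (- Phi x) <=
      \int[@lebesgue_rV R n]_x expeR (- Psi x) /\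
    \int[@lebesgue_rV R n]_x dual_density p c Phi (duality_map p q x) <=
      \int[@lebesgue_rV R n]_x dual_density p c Psi (duality_map p q x).
Proof.
move=> uPhi mPhi Px0 evPhi; elim: l => [|i l [Psi [[u1 m1 [x1 Px1] ev1 fl1] [le1 le2]]]].
  by exists Phi; split => //; split => //; exists x0.
exists (symmetrize i Psi); split; first split.
- exact: symmetrize_usc m1 u1.
- exact: symmetrize_ge.
- exact: symmetrize_proper Px1.
- exact: symmetrize_even.
- move=> k; rewrite inE => /predU1P[->|kl] x; first exact: symmetrize_flip.
  by apply: symmetrize_flip_other; exact: fl1.
split; first exact: le_trans le1 (le_integral_symmetrize _ m1 u1).
apply: le_trans le2 (le_integral_dual_symmetrize _ _ Px1 ev1) => x.
by rewrite gt_eqF// (lt_le_trans _ (m1 x))// ltNyr.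
Qed.

Lemma even_inequality (m : R) Phi x0 :
  usc Phi -> (forall x, m%:E <= Phi x) -> Phi x0 < +oo -> eeven Phi ->
  \int[@lebesgue_rV R n]_x expeR (- Phi x) *
  (\int[@lebesgue_rV R n]_x dual_density p c Phi (duality_map p q x)) `^ (p - 1) <=
  (\int[@lebesgue_rV R n]_x expeR (- (c * normlq q x `^ p)%:E)) `^ p.
Proof.
move=> uPhi mPhi Px0 evPhi.
have [Psi [[uPsi mPsi [x1 Px1] _ flPsi] [le1 le2]]] :=
  symmetrized (enum 'I_n) uPhi mPhi Px0 evPhi.
have q1 : (1 < q)%R by apply: lt_le_trans q2; rewrite ltr1n.
apply: le_trans (@unconditional_inequality _ _ p q c p1 q1 qp c0 m Psi x1
  (measurable_usc uPsi) mPsi Px1 _); last first.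
  by move=> i x; rewrite flPsi// mem_enum.
apply: lee_pmul; rewrite ?poweR_ge0//; first by apply: integral_ge0 => x _; exact: expeR_ge0.
apply: le_poweR => //; first by rewrite subr_ge0 ltW.
by apply: integral_ge0 => x _; exact: expeR_ge0.
Qed.

End even.

(** * Regularization by infima over boxes *)

Section regularization.
Local Open Scope ereal_scope.
Context {R : realType} {n : nat}.
Implicit Types (Phi : 'rV[R]_n -> \bar R) (x y u : 'rV[R]_n).

(* [Phi] need not be Borel, but its infimum over open boxes is upper
   semicontinuous. *)
Definition box_infimum (e : R) Phi x : \bar R :=
  ereal_inf [set Phi u | u in near_row e x].

Lemma box_infimum_lb (e : R) Phi x u : near_row e x u ->
  box_infimum e Phi x <= Phi u.
Proof. by move=> xu; apply: ereal_inf_lbound; exists u. Qed.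

Lemma box_infimum_le (e : R) Phi x : (0 < e)%R -> box_infimum e Phi x <= Phi x.
Proof. by move=> e0; apply: box_infimum_lb => i; rewrite subrr normr0. Qed.

Lemma box_infimum_ge (e : R) (m : \bar R) Phi x : (forall u, m <= Phi u) ->
  m <= box_infimum e Phi x.
Proof. by move=> mPhi; apply: le_ereal_inf_tmp => _ [u _ <-]. Qed.

Lemma box_infimum_usc (e : R) Phi : (0 < e)%R -> usc (box_infimum e Phi).
Proof.
move=> e0 a x /= /ereal_inf_lt[_ [u xu <-] ua].
pose d := (\big[Num.min/e]_i (e - `|u ord0 i - x ord0 i|))%R.
exists d; first by apply: lt_bigmin => // i _; rewrite subr_gt0.
move=> x' xx'; apply: le_lt_trans ua; apply: box_infimum_lb => i.
have : (d <= e - `|u ord0 i - x ord0 i|)%R by apply: bigmin_le.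
have := xx' i; have := ler_distD (x ord0 i) (u ord0 i) (x' ord0 i).
by rewrite (distrC (x ord0 i)); lra.
Qed.

Lemma box_infimum_invariant (e : R) (s : 'rV[R]_n -> 'rV[R]_n) Phi x :
  involutive s -> (forall x u, near_row e x u -> near_row e (s x) (s u)) ->
  (forall x, Phi (s x) = Phi x) -> box_infimum e Phi (s x) = box_infimum e Phi x.
Proof.
move=> sK sn Phis; rewrite /box_infimum; congr ereal_inf.
apply/seteqP; split=> _ [u xu <-]; exists (s u); rewrite ?Phis//; last exact: sn.
by rewrite -(sK x); exact: sn.
Qed.

(** Moving [x] within a box of radius [e] changes its pairing with [y] by at most [e] times the l1
    norm of [y], the support function of the box. *)
Lemma legendre_box_infimum (e : R) Phi x0 y :
  Phi x0 < +oo ->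
  legendre (box_infimum e Phi) y <= legendre Phi y + (e * \sum_i `|y ord0 i|)%:E.
Proof.
move=> Px0.
have := legendre_neqNy y Px0; case EL : (legendre Phi y) => [L||]// _; last first.
  by rewrite addye// leey.
rewrite -EFinD; apply: ge_ereal_sup => _ [x _ <-].
suff : (dotrV x y - (L + e * \sum_i `|y ord0 i|))%:E <= box_infimum e Phi x.
  by case: (box_infimum e Phi x) => [s||]//=;
    rewrite -?EFinB ?lee_fin ?addeNy ?leNye//; lra.
apply: le_ereal_inf_tmp => _ [u xu <-].
have : (dotrV u y)%:E - Phi u <= L%:E by rewrite -EL; apply: ereal_sup_ubound; exists u.
have : (dotrV x y <= dotrV u y + e * \sum_i `|y ord0 i|)%R.
  rewrite -lerBlDl /dotrV -sumrB mulr_sumr; apply: ler_sum => i _.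
  rewrite -mulrBl; apply: le_trans (ler_norm _) _; rewrite normrM.
  by rewrite ler_wpM2r// distrC ltW// xu.
by case: (Phi u) => [r||]//=; rewrite -?EFinB ?lee_fin ?leey//; lra.
Qed.

Variables (p c : R) (T : 'rV[R]_n -> 'rV[R]_n).
Hypotheses (p1 : (1 < p)%R) (mT : measurable_fun setT T).

Lemma dual_density_box_infimum (e : R) Phi x0 y :
  Phi x0 < +oo ->
  (expR (- (e * ((p - 1)^-1 * \sum_i `|((c * p) *: y)%R ord0 i|))))%:E *
    dual_density p c Phi y <= dual_density p c (box_infimum e Phi) y.
Proof.
move=> Px0; set s := (\sum_i _)%R; have k0 : (0 < (p - 1)^-1)%R by rewrite invr_gt0 subr_gt0.
have := legendre_box_infimum e ((c * p) *: y)%R Px0; rewrite -/s.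
have := legendre_neqNy ((c * p) *: y)%R Px0.
rewrite /dual_density; case: (legendre Phi _) => [L||]// _; last first.
  by move=> _; rewrite gt0_muley ?lte_fin//= mule0 expeR_ge0.
move=> H; have {H} := lee_wpmul2l (_ : 0 <= (p - 1)^-1%:E) H.
rewrite lee_fin => /(_ (ltW k0)) H.
rewrite -(EFinM (p - 1)^-1 L).
have -> (t : R) (a : R) : (expR t)%:E * expeR (- a%:E) = expeR (- (a - t)%:E).
  by rewrite -EFinM /= -expRD; congr (expR _)%:E; lra.
rewrite lee_expeR leeN2; apply: le_trans H _; rewrite -EFinD -EFinM lee_fin; lra.
Qed.

(** Take [e = 1/(k+1)]. The first integral only grows under regularization, so it needs no limit.
    The dual integral loses at most a factor exp (- e s(x)), which increases to 1, and monotone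
    convergence restores it. *)
Lemma regularization Phi x0 (Z : \bar R) : Phi x0 < +oo ->
  (forall e, (0 < e)%R ->
    \int[@lebesgue_rV R n]_x expeR (- box_infimum e Phi x) *
    (\int[@lebesgue_rV R n]_x dual_density p c (box_infimum e Phi) (T x)) `^ (p - 1)
      <= Z) ->
  \int[@lebesgue_rV R n]_x expeR (- Phi x) *
  (\int[@lebesgue_rV R n]_x dual_density p c Phi (T x)) `^ (p - 1) <= Z.
Proof.
move=> Px0 H; have k0 : (0 < (p - 1)^-1)%R by rewrite invr_gt0 subr_gt0.
pose s x : R := ((p - 1)^-1 * \sum_i `|((c * p) *: T x)%R ord0 i|)%R.
have s0 x : (0 <= s x)%R by rewrite mulr_ge0 ?(ltW k0)// sumr_ge0.
have ms : measurable_fun setT s.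
  apply: measurable_funM => //; apply: measurable_sum => i.
  apply: (measurableT_comp (@normr_measurable R _)).
  rewrite (_ : (fun x => _) = (fun x => (c * p * rV_coord i (T x))%R)).
    apply: measurable_funM => //.
    exact: (measurableT_comp (measurable_rV_coord i)).
  by apply/funext => x; rewrite mxE.
pose g x := dual_density p c Phi (T x).
have g0 x : 0 <= g x by exact: expeR_ge0.
have mg : measurable_fun setT g by exact: (measurableT_comp (measurable_dual_density p c Phi)).
pose G k x : \bar R := (expR (- (harmonic k * s x)))%:E * g x.
have mG k : measurable_fun setT (G k).
  apply: emeasurable_funM => //; apply/measurable_EFinP.
  apply: measurableT_comp => //; apply: measurableT_comp => //.
  exact: measurable_funM.
have G0 k x : 0 <= G k x by rewrite mule_ge0// lee_fin expR_ge0.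
have limG x : limn (G ^~ x) = g x.
  apply/cvg_lim => //; rewrite -[X in _ --> X]mul1e.
  apply: cvgeM; first by rewrite mule_defE onee_eq0 /= andbF.
    apply: cvg_EFin; first by near=> k.
    rewrite (_ : _ \o _ = fun k => expR (- (harmonic k * s x))) //.
    rewrite -[X in _ --> X]expR0; apply: continuous_cvg; first exact: continuous_expR.
    rewrite -oppr0; apply: cvgN; rewrite -(mul0r (s x)).
    apply: cvgM; [exact: cvg_harmonic|exact: cvg_cst].
  exact: cvg_cst.
have -> : \int[@lebesgue_rV R n]_x dual_density p c Phi (T x) =
    \int[@lebesgue_rV R n]_x (fun x => limn (G ^~ x)) x.
  by apply: eq_integral => x _; rewrite limG.
rewrite muleC; apply: (@poweR_lim_le _ (fun k => \int[@lebesgue_rV R n]_x G k x)).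
- by rewrite subr_gt0.
- by move=> k; exact: integral_ge0.
- apply: cvg_monotone_convergence => //.
  move=> x _ k l kl; rewrite lee_wpmul2r// lee_fin ler_expR lerN2.
  by rewrite ler_wpM2r// lef_pV2 ?posrE// ler_nat.
- by apply: integral_ge0 => x _; exact: expeR_ge0.
move=> k; rewrite muleC; have e0 : (0 < harmonic k :> R)%R by exact: harmonic_gt0.
apply: le_trans (H _ e0); apply: lee_pmul; rewrite ?poweR_ge0//.
- by apply: integral_ge0 => x _; exact: expeR_ge0.
- apply: ge0_le_integral_nonmeasurable => x; first exact: expeR_ge0.
  by rewrite lee_expeR leeN2 box_infimum_le.
apply: le_poweR; first by rewrite subr_ge0 ltW.
  exact: integral_ge0.
apply: ge0_le_integral_nonmeasurable => x //.
exact: (dual_density_box_infimum _ _ Px0).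
Unshelve. all: by end_near. Qed.

End regularization.

Section symmetries.
Context {R : realType} {n : nat}.
Implicit Types (Phi : 'rV[R]_n -> \bar R) (x : 'rV[R]_n).

Lemma unconditional_flip Phi : unconditional Phi ->
  forall i x, Phi (flip_row i x) = Phi x.
Proof.
move=> uPhi i x; rewrite -(uPhi (fun k => k == i) x); congr Phi.
apply/rowP => k; rewrite flip_rowE !mxE.
by case: eqP => _; rewrite ?expr1 ?expr0 ?mulN1r ?mul1r.
Qed.

Lemma unconditional_even Phi : unconditional Phi -> eeven Phi.
Proof.
move=> uPhi x; rewrite -(uPhi xpredT x); congr Phi.
by apply/rowP => k; rewrite !mxE expr1 mulN1r.
Qed.

(** The origin is the midpoint of [x] and [- x]. *)
Lemma econvex_even_min Phi x : econvex Phi -> eeven Phi -> (Phi 0%R <= Phi x)%E.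
Proof.
move=> cPhi evPhi; have := cPhi x (- x) 2^-1.
rewrite evPhi (_ : 1 - 2^-1 = 2^-1 :> R); last by lra.
rewrite -scalerDr subrr scaler0 -ge0_muleDl ?lee_fin ?invr_ge0//.
rewrite -EFinD (_ : 2^-1 + 2^-1 = 1 :> R) ?mul1e; last by lra.
by apply; lra.
Qed.

End symmetries.

Theorem corollary1p5 (R : realType) (n : nat) (p q c : R) :
  1 < p -> 1 < q -> 0 <= c ->
  let V := fun x : 'rV[R]_n => c * (normlq q x) `^ p in
  forall Phi : 'rV[R]_n -> \bar R,
  (forall x, Phi x != -oo%E) -> econvex Phi -> eproper Phi ->
  (q <= p /\ unconditional Phi) \/ ((2 <= q /\ q <= p) /\ eeven Phi) ->
  ((\int[@lebesgue_rV R n]_x expeR (- Phi x)) *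
   (\int[@lebesgue_rV R n]_x
      expeR (- ((p - 1)^-1%:E * legendre Phi (gradrV V x)))) `^ (p - 1)
   <= (\int[@lebesgue_rV R n]_x expeR (- (V x)%:E)) `^ p)%E.
Proof.
move=> p1 q1 c0 V Phi NNy cPhi [x0 Px0] sym.
have q0 : 0 < q by exact: lt_trans q1.
have evPhi : eeven Phi by case: sym => -[_ //]; exact: unconditional_even.
have min0 x : (Phi 0%R <= Phi x)%E by exact: econvex_even_min.
have P0 : (Phi 0%R < +oo)%E by rewrite (le_lt_trans (min0 x0))// ltey.
(* Properness makes the minimum [Phi 0] finite, which gives the real lower bound required by both
   inequalities. *)
have mPhi x : ((fine (Phi 0%R))%:E <= Phi x)%E.
  by rewrite fineK// fin_numE NNy -ltey.
rewrite (_ : (\int[_]_x expeR (- (_ * _)))%E =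
    (\int[@lebesgue_rV R n]_x dual_density p c Phi (duality_map p q x))%E); last first.
  by apply: eq_integral => x _; rewrite gradrV_normlq.
(* From here on the potential is the box infimum, which is Borel and inherits the lower bound and
   the symmetry of [Phi]. *)
apply: (regularization p1 (@measurable_duality_map R n p q) P0) => e e0.
have mB := fun x => box_infimum_ge e x mPhi.
have PB0 : (box_infimum e Phi 0%R < +oo)%E by exact: le_lt_trans (box_infimum_le _ _ e0) P0.
have uB := box_infimum_usc (Phi := Phi) e0.
case: sym => [[qp uPhi]|[[q2 qp] _]].
  apply: (unconditional_inequality p1 q1 qp c0 (measurable_usc uB) mB PB0) => i x.
  apply: box_infimum_invariant; [exact: flip_rowK| |exact: unconditional_flip].
  move=> y u yu k; rewrite !flip_rowE.
  by case: eqP => _; rewrite -?opprD ?normrN; exact: yu.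
apply: (even_inequality p1 q2 qp c0 uB mB PB0) => x.
apply: box_infimum_invariant => //; first exact: opprK.
by move=> y u yu k; rewrite !mxE -opprD normrN; exact: yu.
Qed.
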